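(* Let $p\le 11$ be a prime and let $k\in\{1,\dots,p-1\}\cup\{p+1\}$. Let $Z_k(q)=\sum_{n\ge -k}w_k(n)q^n$ be the unique weakly holomorphic modular function on $\mathrm{SL}_2(\mathbb{Z})$ satisfying $Z_k(q)=q^{-k}\prod_{n\ge2}(1-q^n)^{-1}+O(q)$. Then for every non-zero integer $n$, $$w_k(pn)\equiv 0\pmod{2^{11}}\ \text{if } p=2,\quad w_k(pn)\equiv0\pmod{3^5}\ \text{if } p=3,\quad w_k(pn)\equiv0\pmod{5^2}\ \text{if } p=5,\quad w_k(pn)\equiv 0\pmod p\ \text{if } p=7,11.$$
   Context: Here $q=e^{2\pi i\tau}$ with $\tau$ in the upper half-plane; a weakly holomorphic modular function on $\mathrm{SL}_2(\mathbb{Z})$ is one holomorphic on the upper half-plane whose poles (if any) are supported at the cusp $i\infty$. The coefficients $w_k(n)$ are integers (indeed $Z_k$ is a polynomial with integer coefficients in $j(\tau)$). *)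

(* Defs.v *)
From Stdlib Require Import Reals ZArith Znumtheory Lra Lia.
From Coquelicot Require Import Coquelicot.

Open Scope R_scope.

Definition Cexp (z : C) : C :=
  (exp (Re z) * cos (Im z), exp (Re z) * sin (Im z)).

Definition CpowZ (z : C) (n : Z) : C :=
  match n with
  | Z0 => RtoC 1
  | Zpos m => Cpow z (Pos.to_nat m)
  | Zneg m => Cinv (Cpow z (Pos.to_nat m))
  end.

Definition upper_half_plane (tau : C) : Prop := 0 < Im tau.

Definition nome (tau : C) : C := Cexp (RtoC 2 * RtoC PI * Ci * tau)%C.

Definition holomorphic_on_H (f : C -> C) : Prop :=
  forall tau : C, upper_half_plane tau ->
    ex_derive (K := C_AbsRing) (V := C_NormedModule) f tau.

Definition SL2Z_invariant (f : C -> C) : Prop :=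
  forall a b c d : Z, (a * d - b * c)%Z = 1%Z ->
  forall tau : C, upper_half_plane tau ->
    f ((RtoC (IZR a) * tau + RtoC (IZR b)) /
       (RtoC (IZR c) * tau + RtoC (IZR d)))%C = f tau.

(* f(tau) = sum_(n >= -N) w(n) q^n on the whole upper half-plane; the i-th term
   of the series is the one with exponent i - N. *)
Definition q_expansion (f : C -> C) (N : Z) (w : Z -> C) : Prop :=
  (forall n : Z, (n < - N)%Z -> w n = RtoC 0) /\
  (forall tau : C, upper_half_plane tau ->
     is_series (K := C_AbsRing) (V := C_NormedModule)
       (fun i : nat =>
          (w (Z.of_nat i - N)%Z * CpowZ (nome tau) (Z.of_nat i - N)%Z)%C)
       (f tau)).

(* The last clause is meromorphy at the cusp i*oo. *)
Definition weakly_holomorphic_modular_function (f : C -> C) : Prop :=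
  holomorphic_on_H f /\ SL2Z_invariant f /\
  exists (N : Z) (w : Z -> C), q_expansion f N w.

(* Formal power series are coefficient sequences, multiplied by [PS_mult]. *)

Definition FPS_one (n : nat) : R := if Nat.eqb n 0 then 1 else 0.

Definition FPS_one_minus_Xpow (m n : nat) : R :=
  FPS_one n - (if Nat.eqb n m then 1 else 0).

(* (1 - q^m)^(-1) = sum_j q^(m j), for m > 0; see [geom_inverse]. *)
Definition geom (m n : nat) : R := if Nat.eqb (n mod m) 0 then 1 else 0.

(* prod_(2 <= m <= M + 1) (1 - q^m)^(-1) *)
Fixpoint partial_product (M : nat) : nat -> R :=
  match M with
  | O => FPS_one
  | S M' => PS_mult (partial_product M') (geom (M' + 2))
  end.

(* Coefficient of q^n in prod_(m >= 2) (1 - q^m)^(-1): factors with m > n do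
   not contribute to it; see [partial_product_stable]. *)
Definition product_coef (n : nat) : R := partial_product n n.

Lemma PS_mult_first (a b : nat -> R) (n : nat) :
  (forall j, (0 < j <= n)%nat -> b j = 0) -> PS_mult a b n = a n * b 0%nat.
Proof.
  intros H; unfold PS_mult; destruct n as [|n]; [reflexivity|].
  rewrite tech5, Nat.sub_diag.
  rewrite (sum_eq _ (fun _ => 0)), sum_eq_R0; [ring|reflexivity|].
  intros i Hi; rewrite H; [ring|lia].
Qed.

Lemma partial_product_stable (n M : nat) :
  (n <= M)%nat -> partial_product M n = product_coef n.
Proof.
  intros H; unfold product_coef; induction H as [|M H IH]; [reflexivity|].
  rewrite <- IH; simpl; rewrite PS_mult_first.
  - unfold geom; rewrite Nat.Div0.mod_0_l; simpl; ring.
  - intros j Hj; unfold geom; rewrite Nat.mod_small by lia.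
    destruct j; [lia|reflexivity].
Qed.

Lemma sum_single (f : nat -> R) (i n : nat) :
  sum_f_R0 (fun k => if Nat.eqb k i then f k else 0) n =
  if Nat.leb i n then f i else 0.
Proof.
  induction n as [|n IH]; cbn [sum_f_R0].
  - destruct i; reflexivity.
  - rewrite IH; destruct (Nat.eqb_spec (S n) i) as [<-|Hi].
    + destruct (Nat.leb_spec (S n) n); [lia|].
      destruct (Nat.leb_spec (S n) (S n)); [ring|lia].
    + destruct (Nat.leb_spec i n), (Nat.leb_spec i (S n)); try lia; ring.
Qed.

Lemma geom_inverse (m n : nat) :
  (0 < m)%nat -> PS_mult (FPS_one_minus_Xpow m) (geom m) n = FPS_one n.
Proof.
  intros Hm; unfold PS_mult, FPS_one_minus_Xpow.
  rewrite (sum_eq _ (fun k => (if Nat.eqb k 0 then geom m (n - k) else 0) -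
                              (if Nat.eqb k m then geom m (n - k) else 0))).
  2: { intros i _; unfold FPS_one.
       destruct (Nat.eqb i 0), (Nat.eqb i m); ring. }
  rewrite minus_sum, (sum_single (fun k => geom m (n - k)) 0 n).
  rewrite (sum_single (fun k => geom m (n - k)) m n).
  rewrite Nat.sub_0_r; cbn [Nat.leb]; unfold FPS_one, geom.
  destruct (Nat.leb_spec m n) as [H|H].
  - replace (n mod m)%nat with ((n - m) mod m)%nat.
    + destruct n; [lia|]; cbn [Nat.eqb]; ring.
    + rewrite <- (Nat.Div0.mod_add (n - m) 1 m); f_equal; lia.
  - rewrite Nat.mod_small by exact H; ring.
Qed.

(* Z(q) = sum_(n >= -k) w(n) q^n is a weakly holomorphic modular function with
   Z(q) = q^(-k) prod_(m >= 2) (1 - q^m)^(-1) + O(q): the two q-series have the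
   same coefficients at all exponents n - k <= 0. *)
Definition is_Z (k : Z) (Zk : C -> C) (w : Z -> C) : Prop :=
  weakly_holomorphic_modular_function Zk /\
  q_expansion Zk k w /\
  (forall n : nat, (Z.of_nat n <= k)%Z ->
     w (Z.of_nat n - k)%Z = RtoC (product_coef n)).

(* z = 0 (mod M), which includes that z is a rational integer. *)
Definition congruent_0_mod (M : Z) (z : C) : Prop :=
  exists m : Z, z = RtoC (IZR (M * m)%Z).

(* Main.v *)
Require Import Defs.
From Stdlib Require Import Reals ZArith Znumtheory Lra Lia.
From Stdlib Require Import FunctionalExtensionality List.
From Coquelicot Require Import Coquelicot.

(** The product [Delta = q prod (1 - q^n)^24] has weight 12: for half periods
    [c, d] the lattice product for [wp(d) - wp(c)] converges absolutely, so its
    rows and columns may be exchanged, and Euler's sine product evaluates the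
    rows; multiplying the three differences gives [q^(1/2) prod (1 - q^n)^12].

    A function [sum_(n >= 1) a_n q^n] invariant under [t -> -1/t] vanishes: if
    [|f| <= B] then [|a_n| <= B], hence [|f| <= B/2] on [Im t >= 1/2], which
    meets every orbit.

    For a prime [p] and an invariant [f], the function [T_p(f Delta^r) / Delta^r]
    is invariant and keeps integral coefficients; [f = 1], [p = r = 2] gives a
    function [J = q^-1 + ...].  Subtracting integral polynomials in [J], a
    congruence between invariant functions need only be checked on exponents
    [<= 0].  Finally [prod (1 - q^n)^(24 p M)] is congruent to
    [prod (1 - q^(p n))^(24 M)] modulo the required power of [p] for a suitable
    [M], so that [T_p((Z_k - w_k(0)) Delta^(p M)) / Delta^(p M)] is congruent to
    [U_p(Z_k - w_k(0)) Delta^(M - p M)], and it suffices to check the coefficients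
    [w_k(p n)] with [n <= (p - 1) M], which is a computation. *)

Open Scope C_scope.
Set Bullet Behavior "Strict Subproofs".

(** * Sequences, sums and products of complex numbers *)

(** [Delta] is the only modular form built by hand, so its weight is the one deep analytic fact. [J]
    is taken from [r = 2] because [T_2(Delta) / Delta] is constant.

    The coefficients [w n] are given as complex numbers. Comparing [Z_k] modulo [D] with an integral
    polynomial in [J] yields their integrality and their residues at once.

    The other term of [T_p], a series in [q^p], carries the factor [p^(12 r - 1)] and disappears
    modulo [D]. The constant term of [Z_k] is subtracted because [U_p] would keep it, while the
    claim excludes [n = 0].

    Two conditions fix [M]. For [D = p^(e+1)] the Frobenius congruence needs [p^e] to divide [24 M],
    and [Delta^(p M)] must absorb the pole, that is [k <= p M]. The least choices are 128, 27 and 5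
    for [p = 2, 3, 5]; for [p = 7, 11] only the pole matters, and [k = p + 1] forces [M = 2]. *)

Lemma Rlt_mult_cancel (a b e : R) : (0 <= a)%R -> (0 < e)%R -> (b < e / (a + 1))%R ->
  (0 <= b)%R -> (a * b < e)%R.
Proof.
  intros Ha He Hb Hb0.
  assert (H : (b * (a + 1) < e)%R).
  { apply (Rmult_lt_compat_r (a + 1)) in Hb; [|lra].
    replace (e / (a + 1) * (a + 1))%R with e in Hb by (field; lra). exact Hb. }
  nra.
Qed.

(** Plain epsilon-N convergence keeps the estimates elementary; [is_series_Ccv] translates the
    series of the hypotheses into it. *)
Definition Ccv (u : nat -> C) (l : C) : Prop :=
  forall eps : R, (0 < eps)%R ->
    exists N, forall n, (N <= n)%nat -> (Cmod (u n - l) < eps)%R.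

Lemma Cmod_sym (a b : C) : Cmod (a - b) = Cmod (b - a).
Proof. rewrite <- Cmod_opp; f_equal; ring. Qed.

Lemma Cmod_triangle_minus (a b c : C) : (Cmod (a - c) <= Cmod (a - b) + Cmod (b - c))%R.
Proof.
  replace (a - c) with ((a - b) + (b - c)) by ring; apply Cmod_triangle.
Qed.

Lemma Cmod_minus_le (a b : C) : (Cmod (a - b) <= Cmod a + Cmod b)%R.
Proof.
  replace (Cmod b) with (Cmod (- b)) by apply Cmod_opp. apply Cmod_triangle.
Qed.

Lemma Cmod_le_plus (a b : C) : (Cmod a <= Cmod b + Cmod (a - b))%R.
Proof.
  replace (Cmod a) with (Cmod (b + (a - b))) by (f_equal; ring); apply Cmod_triangle.
Qed.

Lemma Ccv_unique (u : nat -> C) (l l' : C) : Ccv u l -> Ccv u l' -> l = l'.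
Proof.
  intros H H'.
  assert (Hz : Cmod (l - l') = 0%R).
  { apply Rle_antisym; [|apply Cmod_ge_0].
    apply Rnot_lt_le; intros Hp.
    destruct (H (Cmod (l - l') / 2)%R) as [N1 H1]; [lra|].
    destruct (H' (Cmod (l - l') / 2)%R) as [N2 H2]; [lra|].
    specialize (H1 (N1 + N2)%nat ltac:(lia)); specialize (H2 (N1 + N2)%nat ltac:(lia)).
    pose proof (Cmod_triangle_minus l (u (N1 + N2)%nat) l') as Ht.
    rewrite (Cmod_sym l (u _)) in Ht; lra. }
  apply Cmod_eq_0 in Hz.
  replace l with ((l - l') + l') by ring; rewrite Hz; ring.
Qed.

Lemma Ccv_ext (u v : nat -> C) (l : C) : (forall n, u n = v n) -> Ccv u l -> Ccv v l.
Proof. intros He H eps Heps; destruct (H eps Heps) as [N HN]; exists N; intros; rewrite <- He; auto. Qed.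

Lemma Ccv_eq (u : nat -> C) (l l' : C) : l = l' -> Ccv u l -> Ccv u l'.
Proof. now intros ->. Qed.

Lemma Ccv_const (c : C) : Ccv (fun _ => c) c.
Proof.
  intros eps Heps; exists 0%nat; intros; replace (c - c) with (RtoC 0) by ring.
  now rewrite Cmod_0.
Qed.

Lemma Ccv_subseq (u : nat -> C) (f : nat -> nat) (l : C) :
  (forall n, (n <= f n)%nat) -> Ccv u l -> Ccv (fun n => u (f n)) l.
Proof.
  intros Hf H eps Heps; destruct (H eps Heps) as [N HN]; exists N; intros n Hn.
  apply HN; specialize (Hf n); lia.
Qed.

Lemma Ccv_plus (u v : nat -> C) (a b : C) :
  Ccv u a -> Ccv v b -> Ccv (fun n => u n + v n) (a + b).
Proof.
  intros Hu Hv eps Heps.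
  destruct (Hu (eps / 2)%R) as [N1 H1]; [lra|].
  destruct (Hv (eps / 2)%R) as [N2 H2]; [lra|].
  exists (N1 + N2)%nat; intros n Hn.
  specialize (H1 n ltac:(lia)); specialize (H2 n ltac:(lia)).
  replace (u n + v n - (a + b)) with ((u n - a) + (v n - b)) by ring.
  pose proof (Cmod_triangle (u n - a) (v n - b)); lra.
Qed.

Lemma Ccv_bounded (u : nat -> C) (l : C) :
  Ccv u l -> exists N, forall n, (N <= n)%nat -> (Cmod (u n) <= Cmod l + 1)%R.
Proof.
  intros H; destruct (H 1%R) as [N HN]; [lra|]; exists N; intros n Hn.
  specialize (HN n Hn); pose proof (Cmod_le_plus (u n) l); lra.
Qed.

Lemma Ccv_mult (u v : nat -> C) (a b : C) :
  Ccv u a -> Ccv v b -> Ccv (fun n => u n * v n) (a * b).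
Proof.
  intros Hu Hv eps Heps.
  pose proof (Cmod_ge_0 a) as Ha; pose proof (Cmod_ge_0 b) as Hb.
  destruct (Ccv_bounded u a Hu) as [N0 H0].
  destruct (Hu (eps / 2 / (Cmod b + 1))%R) as [N1 H1].
  { apply Rdiv_lt_0_compat; lra. }
  destruct (Hv (eps / 2 / (Cmod a + 1 + 1))%R) as [N2 H2].
  { apply Rdiv_lt_0_compat; lra. }
  exists (N0 + N1 + N2)%nat; intros n Hn.
  specialize (H0 n ltac:(lia)); specialize (H1 n ltac:(lia)); specialize (H2 n ltac:(lia)).
  replace (u n * v n - a * b) with (u n * (v n - b) + b * (u n - a)) by ring.
  eapply Rle_lt_trans; [apply Cmod_triangle|]; rewrite !Cmod_mult.
  pose proof (Cmod_ge_0 (v n - b)); pose proof (Cmod_ge_0 (u n - a)).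
  pose proof (Rlt_mult_cancel (Cmod b) (Cmod (u n - a)) (eps / 2)) as K1.
  pose proof (Rlt_mult_cancel (Cmod a + 1) (Cmod (v n - b)) (eps / 2)) as K2.
  specialize (K1 ltac:(lra) ltac:(lra) H1 ltac:(lra)).
  specialize (K2 ltac:(lra) ltac:(lra) H2 ltac:(lra)).
  assert (Cmod (u n) * Cmod (v n - b) <= (Cmod a + 1) * Cmod (v n - b))%R.
  { apply Rmult_le_compat_r; lra. }
  lra.
Qed.

Lemma Ccv_scal (c : C) (u : nat -> C) (a : C) : Ccv u a -> Ccv (fun n => c * u n) (c * a).
Proof. intros H; apply (Ccv_mult (fun _ => c) u); [apply Ccv_const|exact H]. Qed.

Lemma Ccv_minus (u v : nat -> C) (a b : C) :
  Ccv u a -> Ccv v b -> Ccv (fun n => u n - v n) (a - b).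
Proof.
  intros Hu Hv; replace (a - b) with (a + (- (1)) * b) by ring.
  apply (Ccv_ext (fun n => u n + (- (1)) * v n)); [intros; ring|].
  apply Ccv_plus; [exact Hu|apply Ccv_scal, Hv].
Qed.

Lemma Ccv_inv (u : nat -> C) (a : C) : a <> 0 -> Ccv u a -> Ccv (fun n => / u n) (/ a).
Proof.
  intros Ha Hu eps Heps.
  assert (Hp : (0 < Cmod a)%R) by now apply Cmod_gt_0.
  destruct (Hu (Cmod a / 2)%R) as [N1 H1]; [lra|].
  destruct (Hu (eps * (Cmod a * Cmod a / 2))%R) as [N2 H2].
  { apply Rmult_lt_0_compat; nra. }
  exists (N1 + N2)%nat; intros n Hn.
  specialize (H1 n ltac:(lia)); specialize (H2 n ltac:(lia)).
  pose proof (Cmod_le_plus a (u n)) as H3; rewrite (Cmod_sym a) in H3.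
  assert (Hun : (Cmod a / 2 < Cmod (u n))%R) by lra.
  assert (Hn0 : u n <> 0) by (apply Cmod_gt_0; lra).
  replace (/ u n - / a) with (- (u n - a) / (u n * a)) by (field; auto).
  rewrite Cmod_div, Cmod_opp, Cmod_mult by (apply Cmult_neq_0; auto).
  apply (Rmult_lt_reg_r (Cmod (u n) * Cmod a)); [nra|].
  unfold Rdiv; rewrite Rmult_assoc, Rinv_l by nra.
  rewrite Rmult_1_r; eapply Rlt_le_trans; [exact H2|].
  apply Rmult_le_compat_l; nra.
Qed.

Lemma Ccv_div (u v : nat -> C) (a b : C) : b <> 0 ->
  Ccv u a -> Ccv v b -> Ccv (fun n => u n / v n) (a / b).
Proof. intros; unfold Cdiv; apply Ccv_mult; [|apply Ccv_inv]; auto. Qed.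

Lemma Ccv_le (u : nat -> C) (l : C) (B : R) (N : nat) :
  Ccv u l -> (forall n, (N <= n)%nat -> (Cmod (u n) <= B)%R) -> (Cmod l <= B)%R.
Proof.
  intros H HB; apply Rnot_lt_le; intros Hlt.
  destruct (H (Cmod l - B)%R) as [N1 H1]; [lra|].
  specialize (H1 (N + N1)%nat ltac:(lia)); specialize (HB (N + N1)%nat ltac:(lia)).
  pose proof (Cmod_le_plus l (u (N + N1)%nat)) as Ht; rewrite (Cmod_sym l) in Ht; lra.
Qed.

Lemma Ccv_squeeze (u : nat -> C) (l : C) (e : nat -> R) :
  is_lim_seq e 0%R -> (forall n, (Cmod (u n - l) <= e n)%R) -> Ccv u l.
Proof.
  intros He Hu eps Heps.
  apply is_lim_seq_spec in He; destruct (He (mkposreal eps Heps)) as [N HN]; simpl in HN.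
  exists N; intros n Hn; specialize (HN n Hn); specialize (Hu n).
  rewrite Rminus_0_r in HN; apply Rabs_def2 in HN; lra.
Qed.

Lemma Ccv_RtoC (u : nat -> R) (l : R) : is_lim_seq u l -> Ccv (fun n => RtoC (u n)) (RtoC l).
Proof.
  intros H eps Heps.
  apply is_lim_seq_spec in H; destruct (H (mkposreal eps Heps)) as [N HN]; simpl in HN.
  exists N; intros n Hn; rewrite <- RtoC_minus, Cmod_R; now apply HN.
Qed.

Fixpoint Csum (f : nat -> C) (n : nat) : C :=
  match n with O => 0 | S k => Csum f k + f k end.

Fixpoint Cprod (f : nat -> C) (n : nat) : C :=
  match n with O => 1 | S k => Cprod f k * f k end.

Fixpoint Rsum (f : nat -> R) (n : nat) : R :=
  match n with O => 0%R | S k => (Rsum f k + f k)%R end.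

Lemma sum_n_Csum (f : nat -> C) (n : nat) :
  sum_n (G := C_AbelianMonoid) f n = Csum f (S n).
Proof.
  induction n as [|n IH].
  - rewrite sum_O; simpl; ring.
  - rewrite sum_Sn, IH; reflexivity.
Qed.

Lemma is_series_Ccv (f : nat -> C) (l : C) :
  is_series (K := C_AbsRing) (V := C_NormedModule) f l <-> Ccv (Csum f) l.
Proof.
  unfold is_series; split; intros H.
  - intros eps Heps.
    apply (filterlim_locally_ball_norm (K := C_AbsRing) (U := C_NormedModule) (F := eventually)) with (eps := mkposreal eps Heps) in H.
    destruct H as [N HN]; exists (S N); intros n Hn.
    destruct n as [|n]; [lia|]; specialize (HN n ltac:(lia)).
    change (Cmod (sum_n (G := C_AbelianMonoid) f n - l) < eps)%R in HN.
    now rewrite sum_n_Csum in HN.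
  - apply (filterlim_locally_ball_norm (K := C_AbsRing) (U := C_NormedModule) (F := eventually)).
    intros [eps Heps]; destruct (H eps Heps) as [N HN]; exists N; intros n Hn.
    change (Cmod (sum_n (G := C_AbelianMonoid) f n - l) < eps)%R.
    rewrite sum_n_Csum; apply HN; lia.
Qed.

Lemma Csum_ext (f g : nat -> C) (n : nat) :
  (forall i, (i < n)%nat -> f i = g i) -> Csum f n = Csum g n.
Proof.
  induction n as [|n IH]; intros H; [reflexivity|].
  simpl; rewrite IH, H by auto; reflexivity.
Qed.

Lemma Cprod_ext (f g : nat -> C) (n : nat) :
  (forall i, (i < n)%nat -> f i = g i) -> Cprod f n = Cprod g n.
Proof.
  induction n as [|n IH]; intros H; [reflexivity|].
  simpl; rewrite IH, H by auto; reflexivity.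
Qed.

Lemma Rsum_ext (f g : nat -> R) (n : nat) :
  (forall i, (i < n)%nat -> f i = g i) -> Rsum f n = Rsum g n.
Proof.
  induction n as [|n IH]; intros H; [reflexivity|].
  simpl; rewrite IH, H by auto; reflexivity.
Qed.

Lemma Csum_plus (f g : nat -> C) (n : nat) :
  Csum (fun i => f i + g i) n = Csum f n + Csum g n.
Proof. induction n as [|n IH]; simpl; [ring|rewrite IH; ring]. Qed.

Lemma Csum_scal (c : C) (f : nat -> C) (n : nat) :
  Csum (fun i => c * f i) n = c * Csum f n.
Proof. induction n as [|n IH]; simpl; [ring|rewrite IH; ring]. Qed.

Lemma Csum_zero (n : nat) : Csum (fun _ => 0) n = 0.
Proof. induction n as [|n IH]; simpl; [ring|rewrite IH; ring]. Qed.

Lemma Csum_swap (f : nat -> nat -> C) (n m : nat) :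
  Csum (fun i => Csum (fun j => f i j) m) n = Csum (fun j => Csum (fun i => f i j) n) m.
Proof.
  induction n as [|n IH]; simpl.
  - now rewrite Csum_zero.
  - now rewrite IH, <- Csum_plus.
Qed.

Lemma Cprod_mult (f g : nat -> C) (n : nat) :
  Cprod (fun i => f i * g i) n = Cprod f n * Cprod g n.
Proof. induction n as [|n IH]; simpl; [ring|rewrite IH; ring]. Qed.

Lemma Cprod_swap (f : nat -> nat -> C) (n m : nat) :
  Cprod (fun i => Cprod (fun j => f i j) m) n = Cprod (fun j => Cprod (fun i => f i j) n) m.
Proof.
  induction n as [|n IH]; simpl.
  - induction m as [|m IHm]; simpl; [reflexivity|rewrite <- IHm; ring].
  - now rewrite IH, <- Cprod_mult.
Qed.

Lemma Cprod_add (f : nat -> C) (n m : nat) :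
  Cprod f (n + m) = Cprod f n * Cprod (fun i => f (n + i)%nat) m.
Proof.
  induction m as [|m IH]; simpl; [rewrite Nat.add_0_r; ring|].
  rewrite Nat.add_succ_r; simpl; rewrite IH; ring.
Qed.

Lemma Cprod_shift (f : nat -> C) (n : nat) :
  Cprod f (S n) = f 0%nat * Cprod (fun i => f (S i)) n.
Proof.
  induction n as [|n IH]; [simpl; ring|].
  change (Cprod f (S (S n))) with (Cprod f (S n) * f (S n)); rewrite IH; simpl; ring.
Qed.

Lemma Csum_shift (f : nat -> C) (n : nat) :
  Csum f (S n) = f 0%nat + Csum (fun i => f (S i)) n.
Proof.
  induction n as [|n IH]; [simpl; ring|].
  change (Csum f (S (S n))) with (Csum f (S n) + f (S n)); rewrite IH; simpl; ring.
Qed.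

Lemma Cprod_rev (f : nat -> C) (n : nat) :
  Cprod (fun i => f (n - S i)%nat) n = Cprod f n.
Proof.
  induction n as [|n IH]; [reflexivity|].
  rewrite Cprod_shift.
  change (Cprod (fun i => f (S n - S (S i))%nat) n) with (Cprod (fun i => f (n - S i)%nat) n).
  rewrite IH; replace (S n - 1)%nat with n by lia; simpl; ring.
Qed.

Lemma Cprod_neq_0 (f : nat -> C) (n : nat) : (forall i, (i < n)%nat -> f i <> 0) -> Cprod f n <> 0.
Proof.
  induction n as [|n IH]; intros H; simpl.
  - apply C1_nz.
  - apply Cmult_neq_0; auto.
Qed.

Lemma Cprod_div (f g : nat -> C) (n : nat) : (forall i, (i < n)%nat -> g i <> 0) ->
  Cprod (fun i => f i / g i) n = Cprod f n / Cprod g n.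
Proof.
  intros H; induction n as [|n IH]; simpl.
  - field.
  - rewrite IH by auto; field; split; [apply H; lia|apply Cprod_neq_0; auto].
Qed.

Lemma Csum_le (f : nat -> C) (a : nat -> R) (n : nat) :
  (forall i, (i < n)%nat -> (Cmod (f i) <= a i)%R) -> (Cmod (Csum f n) <= Rsum a n)%R.
Proof.
  induction n as [|n IH]; intros H; simpl.
  - rewrite Cmod_0; lra.
  - eapply Rle_trans; [apply Cmod_triangle|]; apply Rplus_le_compat; auto.
Qed.

Lemma Rsum_nonneg (a : nat -> R) (n : nat) : (forall i, (0 <= a i)%R) -> (0 <= Rsum a n)%R.
Proof. intros H; induction n; simpl; [lra|specialize (H n); lra]. Qed.

Lemma Rsum_mono (a : nat -> R) (n m : nat) :
  (forall i, (0 <= a i)%R) -> (n <= m)%nat -> (Rsum a n <= Rsum a m)%R.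
Proof. intros H Hnm; induction Hnm; simpl; [lra|specialize (H m); lra]. Qed.

Lemma Rsum_le (a b : nat -> R) (n : nat) :
  (forall i, (i < n)%nat -> (a i <= b i)%R) -> (Rsum a n <= Rsum b n)%R.
Proof. induction n; intros H; simpl; [lra|]. pose proof (H n ltac:(lia)). assert (Rsum a n <= Rsum b n)%R by auto. lra. Qed.

Lemma Rsum_scal (c : R) (f : nat -> R) (n : nat) :
  Rsum (fun i => c * f i)%R n = (c * Rsum f n)%R.
Proof. induction n as [|n IH]; simpl; [ring|rewrite IH; ring]. Qed.

Lemma Rsum_add (f : nat -> R) (n m : nat) :
  Rsum f (n + m) = (Rsum f n + Rsum (fun i => f (n + i)%nat) m)%R.
Proof.
  induction m as [|m IH]; simpl; [rewrite Nat.add_0_r; ring|].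
  rewrite Nat.add_succ_r; simpl; rewrite IH; ring.
Qed.

Definition summable (a : nat -> R) : Prop :=
  (forall i, (0 <= a i)%R) /\ exists B, forall n, (Rsum a n <= B)%R.

Lemma summable_cauchy (a : nat -> R) : summable a ->
  forall eps, (0 < eps)%R -> exists N, forall n m, (N <= n)%nat -> (n <= m)%nat ->
    (Rsum a m - Rsum a n < eps)%R.
Proof.
  intros [Hp [B HB]] eps Heps.
  assert (Hex : ex_finite_lim_seq (Rsum a)).
  { apply (ex_finite_lim_seq_incr _ B); [intros n; simpl; specialize (Hp n); lra|exact HB]. }
  apply ex_lim_seq_cauchy_corr in Hex.
  destruct (Hex (mkposreal eps Heps)) as [N HN]; exists N; intros n m Hn Hm; simpl in HN.
  specialize (HN m n ltac:(lia) ltac:(lia)); apply Rabs_def2 in HN; lra.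
Qed.

Lemma Ccv_complete (u : nat -> C) :
  (forall eps, (0 < eps)%R -> exists N, forall n m, (N <= n)%nat -> (n <= m)%nat ->
     (Cmod (u m - u n) < eps)%R) -> exists l, Ccv u l.
Proof.
  intros H.
  assert (Hpart : forall f : C -> R, (forall x y, (Rabs (f x - f y) <= Cmod (x - y))%R) ->
     ex_finite_lim_seq (fun n => f (u n))).
  { intros f Hf; apply ex_lim_seq_cauchy_corr; intros [eps Heps]; simpl.
    destruct (H eps Heps) as [N HN]; exists N; intros n m Hn Hm.
    eapply Rle_lt_trans; [apply Hf|].
    destruct (Nat.le_ge_cases n m); [rewrite Cmod_sym|]; apply HN; auto. }
  destruct (Hpart (fun c => Re c)) as [x Hx].
  { intros c d; replace (Re c - Re d)%R with (Re (c - d)) by reflexivity; apply re_le_Cmod. }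
  destruct (Hpart (fun c => Im c)) as [y Hy].
  { intros c d; replace (Im c - Im d)%R with (Im (c - d)) by reflexivity.
    eapply Rle_trans; [|apply Rmax_Cmod]; apply Rmax_r. }
  exists (x, y).
  assert (Hc : Ccv (fun n => RtoC (Re (u n)) + Ci * RtoC (Im (u n))) (RtoC x + Ci * RtoC y)).
  { apply Ccv_plus; [now apply Ccv_RtoC|apply Ccv_scal; now apply Ccv_RtoC]. }
  replace (x, y) with (RtoC x + Ci * RtoC y).
  - eapply Ccv_ext; [|exact Hc]; intros n; cbn beta.
    destruct (u n) as [a b]; unfold Ci, RtoC, Cmult, Cplus; simpl; f_equal; ring.
  - unfold Ci, RtoC, Cmult, Cplus; simpl; f_equal; ring.
Qed.

Lemma Csum_Ccv (f : nat -> C) (a : nat -> R) : summable a ->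
  (forall i, (Cmod (f i) <= a i)%R) -> exists l, Ccv (Csum f) l.
Proof.
  intros Ha Hf; apply Ccv_complete; intros eps Heps.
  destruct (summable_cauchy a Ha eps Heps) as [N HN]; exists N; intros n m Hn Hm.
  eapply Rle_lt_trans; [|apply (HN n m Hn Hm)].
  clear HN; induction Hm as [|m Hm IH]; simpl.
  - replace (Csum f n - Csum f n) with (RtoC 0) by ring; rewrite Cmod_0; lra.
  - replace (Csum f m + f m - Csum f n) with ((Csum f m - Csum f n) + f m) by ring.
    pose proof (Cmod_triangle (Csum f m - Csum f n) (f m)); specialize (Hf m); lra.
Qed.

Lemma exp_mono (x y : R) : (x <= y)%R -> (exp x <= exp y)%R.
Proof. intros H; destruct (Req_dec x y) as [<-|Hn]; [lra|left; apply exp_increasing; lra]. Qed.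

Lemma Cprod_bound (f : nat -> C) (a : nat -> R) (n : nat) :
  (forall i, (i < n)%nat -> (Cmod (f i - 1) <= a i)%R) ->
  (Cmod (Cprod f n) <= exp (Rsum a n))%R.
Proof.
  induction n as [|n IH]; intros H; simpl.
  - rewrite Cmod_1, exp_0; lra.
  - rewrite Cmod_mult, exp_plus.
    apply Rmult_le_compat; [apply Cmod_ge_0|apply Cmod_ge_0|auto|].
    pose proof (Cmod_le_plus (f n) 1) as H1; rewrite Cmod_1 in H1.
    pose proof (H n ltac:(lia)); pose proof (exp_ineq1_le (a n)); lra.
Qed.

(** Telescoping: the factor of index [i] changes the product by at most [a i] times the bound of
    [Cprod_bound]. This single estimate gives convergence, control of tails and, with [n = 0], the
    distance of a partial product from 1. *)
Lemma Cprod_diff (f : nat -> C) (a : nat -> R) (n m : nat) :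
  (forall i, (0 <= a i)%R) ->
  (n <= m)%nat -> (forall i, (i < m)%nat -> (Cmod (f i - 1) <= a i)%R) ->
  (Cmod (Cprod f m - Cprod f n) <= exp (Rsum a m) * (Rsum a m - Rsum a n))%R.
Proof.
  intros Ha Hnm; induction Hnm as [|m Hnm IH]; intros H; simpl.
  - replace (Cprod f n - Cprod f n) with (RtoC 0) by ring; rewrite Cmod_0; lra.
  - replace (Cprod f m * f m - Cprod f n) with (Cprod f m * (f m - 1) + (Cprod f m - Cprod f n)) by ring.
    eapply Rle_trans; [apply Cmod_triangle|]; rewrite Cmod_mult.
    pose proof (Cprod_bound f a m ltac:(auto)) as Hb.
    pose proof (H m ltac:(lia)) as Hm; specialize (IH ltac:(auto)).
    pose proof (Ha m); pose proof (Rsum_mono a n m Ha Hnm).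
    assert (Hle : (exp (Rsum a m) <= exp (Rsum a m + a m))%R).
    { apply exp_mono; lra. }
    assert (Cmod (Cprod f m) * Cmod (f m - 1) <= exp (Rsum a m) * a m)%R.
    { apply Rmult_le_compat; auto; apply Cmod_ge_0. }
    pose proof (exp_pos (Rsum a m)). nra.
Qed.

Lemma Cprod_Ccv (f : nat -> C) (a : nat -> R) : summable a ->
  (forall i, (Cmod (f i - 1) <= a i)%R) -> exists l, Ccv (Cprod f) l.
Proof.
  intros Ha Hf; apply Ccv_complete; intros eps Heps.
  pose proof Ha as [Hp [B HB]].
  destruct (summable_cauchy a Ha (eps / exp B)%R) as [N HN].
  { apply Rdiv_lt_0_compat; [exact Heps|apply exp_pos]. }
  exists N; intros n m Hn Hm.
  eapply Rle_lt_trans; [apply (Cprod_diff f a n m); auto|].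
  specialize (HN n m Hn Hm).
  apply Rle_lt_trans with (exp B * (Rsum a m - Rsum a n))%R.
  - apply Rmult_le_compat_r; [pose proof (Rsum_mono a n m Hp Hm); lra|apply exp_mono, HB].
  - apply (Rmult_lt_compat_l (exp B)) in HN; [|apply exp_pos].
    replace (exp B * (eps / exp B))%R with eps in HN; [exact HN|].
    field; pose proof (exp_pos B); lra.
Qed.

Lemma Cprod_Ccv_fixed (f : nat -> nat -> C) (g : nat -> C) (M : nat) :
  (forall j, (j < M)%nat -> Ccv (fun k => f k j) (g j)) ->
  Ccv (fun k => Cprod (f k) M) (Cprod g M).
Proof.
  induction M as [|M IH]; intros H; simpl; [exact (Ccv_const 1)|].
  apply Ccv_mult; auto.
Qed.

(* Tannery's theorem for products; [J k] is the number of factors at stage [k]. *)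
Lemma Cprod_dominated (f : nat -> nat -> C) (g : nat -> C) (a : nat -> R) (J : nat -> nat) (l : C) :
  summable a ->
  (forall k j, (j < J k)%nat -> (Cmod (f k j - 1) <= a j)%R) ->
  (forall j, Ccv (fun k => f k j) (g j)) ->
  (forall M, exists K, forall k, (K <= k)%nat -> (M <= J k)%nat) ->
  Ccv (Cprod g) l ->
  Ccv (fun k => Cprod (f k) (J k)) l.
Proof.
  intros Ha Hb Hc HJ Hl eps Heps.
  pose proof Ha as [Hp [B HB]].
  destruct (summable_cauchy a Ha (eps / 3 / exp B)%R) as [N HN].
  { apply Rdiv_lt_0_compat; [lra|apply exp_pos]. }
  destruct (Hl (eps / 3)%R) as [N1 HN1]; [lra|].
  set (M := (N + N1)%nat).
  destruct (Cprod_Ccv_fixed f g M ltac:(auto) (eps / 3)%R) as [K1 HK1]; [lra|].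
  destruct (HJ M) as [K2 HK2].
  exists (K1 + K2)%nat; intros k Hk.
  specialize (HK1 k ltac:(lia)); specialize (HK2 k ltac:(lia)); specialize (HN1 M ltac:(lia)).
  assert (H1 : (Cmod (Cprod (f k) (J k) - Cprod (f k) M) < eps / 3)%R).
  { eapply Rle_lt_trans; [apply (Cprod_diff (f k) a M (J k)); auto|].
    specialize (HN M (J k) ltac:(lia) HK2).
    apply Rle_lt_trans with (exp B * (Rsum a (J k) - Rsum a M))%R.
    - apply Rmult_le_compat_r; [pose proof (Rsum_mono a M (J k) Hp HK2); lra|apply exp_mono, HB].
    - apply (Rmult_lt_compat_l (exp B)) in HN; [|apply exp_pos].
      replace (exp B * (eps / 3 / exp B))%R with (eps / 3)%R in HN; [exact HN|].
      field; pose proof (exp_pos B); lra. }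
  pose proof (Cmod_triangle_minus (Cprod (f k) (J k)) (Cprod (f k) M) l).
  pose proof (Cmod_triangle_minus (Cprod (f k) M) (Cprod g M) l). lra.
Qed.

(** Fubini for infinite products. The majorant of product form makes the tail in [m] small uniformly
    in [N], so one finite block of rows approximates both iterated products. *)
Lemma double_product_swap (f : nat -> nat -> C) (a b : nat -> R) (Rw Cl : nat -> C) (X Y : C) :
  summable a -> summable b ->
  (forall m n, (Cmod (f m n - 1) <= a m * b n)%R) ->
  (forall m, Ccv (fun N => Cprod (f m) N) (Rw m)) ->
  (forall n, Ccv (fun M => Cprod (fun m => f m n) M) (Cl n)) ->
  Ccv (Cprod Rw) X -> Ccv (Cprod Cl) Y -> X = Y.
Proof.
  intros Ha Hb Hf HR HC HX HY.
  pose proof Ha as [Hpa [A HA]]; pose proof Hb as [Hpb [B HB]].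
  assert (HB0 : (0 <= B)%R) by (specialize (HB 0%nat); simpl in HB; lra).
  assert (HA0 : (0 <= A)%R) by (specialize (HA 0%nat); simpl in HA; lra).
  (* [a' m] dominates the distance from 1 of every partial product of row [m], whatever its length;
     this is the source of the uniformity. *)
  set (a' := fun m => (exp (A * B) * B * a m)%R).
  assert (Ha' : summable a').
  { split.
    - intros i; unfold a'; specialize (Hpa i); pose proof (exp_pos (A * B)).
      apply Rmult_le_pos; [apply Rmult_le_pos; lra|exact Hpa].
    - exists (exp (A * B) * B * A)%R; intros n; unfold a'; rewrite Rsum_scal.
      apply Rmult_le_compat_l; [apply Rmult_le_pos; [left; apply exp_pos|exact HB0]|apply HA]. }
  assert (HaA : forall m, (a m <= A)%R).
  { intros m; specialize (HA (S m)); simpl in HA; pose proof (Rsum_nonneg a m Hpa); lra. }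
  assert (Hrow : forall N m, (Cmod (Cprod (f m) N - 1) <= a' m)%R).
  { intros N m.
    pose proof (Cprod_diff (f m) (fun n => a m * b n)%R 0 N) as Hd; simpl in Hd.
    eapply Rle_trans; [apply Hd; [|lia|intros; apply Hf]|].
    - intros i; apply Rmult_le_pos; auto.
    - rewrite Rsum_scal, Rminus_0_r; unfold a'.
      specialize (HB N); specialize (HaA m); pose proof (Rsum_nonneg b N Hpb); specialize (Hpa m).
      apply Rle_trans with (exp (A * B) * (a m * Rsum b N))%R.
      + apply Rmult_le_compat_r; [apply Rmult_le_pos; auto|]; apply exp_mono; apply Rmult_le_compat; auto.
      + rewrite Rmult_assoc; apply Rmult_le_compat_l; [left; apply exp_pos|]; nra. }
  apply (Ccv_unique (Cprod Cl)); [|exact HY].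
  assert (Hcol : forall N, Ccv (fun M => Cprod (fun m => Cprod (f m) N) M) (Cprod Cl N)).
  { intros N; eapply Ccv_ext; [intros M; symmetry; apply Cprod_swap|].
    apply Cprod_Ccv_fixed; auto. }

  intros eps Heps.
  destruct (summable_cauchy a' Ha' (eps / 4 / exp (exp (A * B) * B * A))%R) as [N0 HN0].
  { apply Rdiv_lt_0_compat; [lra|apply exp_pos]. }
  assert (Htail : forall N m m', (N0 <= m)%nat -> (m <= m')%nat ->
    (Cmod (Cprod (fun i => Cprod (f i) N) m' - Cprod (fun i => Cprod (f i) N) m) < eps / 4)%R).
  { intros N m m' Hm Hmm'.
    destruct Ha' as [Hpa' _].
    eapply Rle_lt_trans; [apply (Cprod_diff _ a' m m'); auto|].
    specialize (HN0 m m' Hm Hmm').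
    assert (HBa : (Rsum a' m' <= exp (A * B) * B * A)%R).
    { unfold a'; rewrite Rsum_scal; apply Rmult_le_compat_l; [apply Rmult_le_pos; [left; apply exp_pos|exact HB0]|apply HA]. }
    set (D := (exp (A * B) * B * A)%R) in *.
    apply Rle_lt_trans with (exp D * (Rsum a' m' - Rsum a' m))%R.
    - apply Rmult_le_compat_r; [pose proof (Rsum_mono a' m m' Hpa' Hmm'); lra|now apply exp_mono].
    - apply (Rmult_lt_compat_l (exp D)) in HN0; [|apply exp_pos].
      replace (exp D * (eps / 4 / exp D))%R with (eps / 4)%R in HN0; [exact HN0|].
      field; pose proof (exp_pos D); lra. }
  destruct (HX (eps / 4)%R) as [N1 HN1]; [lra|].
  set (M := (N0 + N1)%nat).
  specialize (HN1 M ltac:(lia)).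
  destruct (Cprod_Ccv_fixed (fun N m => Cprod (f m) N) Rw M (fun j _ => HR j) (eps / 4)%R) as [K HK]; [lra|].
  exists K; intros N HN; specialize (HK N HN).
  assert (H4 : (Cmod (Cprod Cl N - Cprod (fun m => Cprod (f m) N) M) <= eps / 4)%R).
  { apply (Ccv_le (fun M' => Cprod (fun m => Cprod (f m) N) M' - Cprod (fun m => Cprod (f m) N) M) _ _ M).
    - apply Ccv_minus; [apply Hcol|apply Ccv_const].
    - intros M' HM'; left; apply Htail; [lia|exact HM']. }
  pose proof (Cmod_triangle_minus (Cprod Cl N) (Cprod (fun m => Cprod (f m) N) M) X).
  pose proof (Cmod_triangle_minus (Cprod (fun m => Cprod (f m) N) M) (Cprod Rw M) X). lra.
Qed.

(** * The sine product *)

Lemma Cexp_plus (a b : C) : Cexp (a + b) = Cexp a * Cexp b.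
Proof.
  destruct a as [x y], b as [u v]; unfold Cexp, Cmult, Cplus; simpl.
  rewrite exp_plus, cos_plus, sin_plus; f_equal; ring.
Qed.

Lemma Cexp_0 : Cexp 0 = 1.
Proof. unfold Cexp; simpl; rewrite exp_0, cos_0, sin_0; unfold RtoC; f_equal; ring. Qed.

Lemma Cmod_Cexp (z : C) : Cmod (Cexp z) = exp (Re z).
Proof.
  destruct z as [x y]; unfold Cexp, Cmod; simpl.
  replace (_ + _)%R with (exp x * exp x * ((sin y)² + (cos y)²))%R by (unfold Rsqr; ring).
  rewrite sin2_cos2, Rmult_1_r; apply sqrt_square; left; apply exp_pos.
Qed.

Lemma Cexp_neq_0 (z : C) : Cexp z <> 0.
Proof. apply Cmod_gt_0; rewrite Cmod_Cexp; apply exp_pos. Qed.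

Lemma Cexp_opp (z : C) : Cexp (- z) = / Cexp z.
Proof.
  assert (H : Cexp z * Cexp (- z) = 1).
  { rewrite <- Cexp_plus; replace (z + - z) with (RtoC 0) by ring; apply Cexp_0. }
  replace (Cexp (- z)) with (Cexp z * Cexp (- z) * / Cexp z) by (field; apply Cexp_neq_0).
  rewrite H; ring.
Qed.

Lemma Cexp_pow (z : C) (n : nat) : Cexp z ^ n = Cexp (INR n * z).
Proof.
  induction n as [|n IH].
  - change (Cexp z ^ 0) with (RtoC 1); simpl; rewrite Cmult_0_l; symmetry; apply Cexp_0.
  - rewrite Cpow_S, IH, <- Cexp_plus, S_INR; f_equal; rewrite RtoC_plus; ring.
Qed.

Definition Csin (w : C) : C := (Cexp (Ci * w) - Cexp (- (Ci * w))) / (2 * Ci).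
Definition Ccos (w : C) : C := (Cexp (Ci * w) + Cexp (- (Ci * w))) / 2.

Lemma Ci_neq_0 : Ci <> 0.
Proof. intros H; apply (f_equal snd) in H; simpl in H; lra. Qed.

Lemma Ci_sqr : Ci * Ci = - (1).
Proof. unfold Ci, Cmult, RtoC, Copp; simpl; f_equal; ring. Qed.

Lemma C2_neq_0 : RtoC 2 <> 0.
Proof. intros H; apply RtoC_inj in H; lra. Qed.

Lemma Csin_sqr (w : C) : Csin w * Csin w = 1 - Ccos w * Ccos w.
Proof.
  unfold Csin, Ccos; rewrite Cexp_opp.
  pose proof (Cexp_neq_0 (Ci * w)); pose proof Ci_neq_0; pose proof C2_neq_0.
  transitivity (((Cexp (Ci * w) - / Cexp (Ci * w)) * (Cexp (Ci * w) - / Cexp (Ci * w))) / (2 * 2 * (Ci * Ci)));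
    [field; auto|].
  rewrite Ci_sqr; field; auto.
Qed.

Lemma Csin_double (w : C) : Csin (2 * w) = 2 * Csin w * Ccos w.
Proof.
  unfold Csin, Ccos; rewrite !Cexp_opp.
  replace (Ci * (2 * w)) with (Ci * w + Ci * w) by ring.
  rewrite Cexp_plus; pose proof (Cexp_neq_0 (Ci * w)); pose proof Ci_neq_0; pose proof C2_neq_0.
  field; auto.
Qed.

Lemma Ccos_double (w : C) : Ccos (2 * w) = 1 - 2 * (Csin w * Csin w).
Proof.
  rewrite Csin_sqr; unfold Ccos; rewrite !Cexp_opp.
  replace (Ci * (2 * w)) with (Ci * w + Ci * w) by ring.
  rewrite Cexp_plus; pose proof (Cexp_neq_0 (Ci * w)); pose proof Ci_neq_0; pose proof C2_neq_0.
  field; auto.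
Qed.

Lemma Csin_R (x : R) : Csin (RtoC x) = RtoC (sin x).
Proof.
  unfold Csin.
  replace (Cexp (Ci * x)) with ((cos x, sin x) : C).
  2:{ unfold Cexp, Ci; simpl. replace (0 * x - 1 * 0)%R with 0%R by ring.
      replace (0 * 0 + 1 * x)%R with x by ring; rewrite exp_0; f_equal; ring. }
  replace (Cexp (- (Ci * x))) with ((cos x, - sin x)%R : C).
  2:{ unfold Cexp, Ci; simpl. replace (- (0 * x - 1 * 0))%R with 0%R by ring.
      replace (- (0 * 0 + 1 * x))%R with (- x)%R by ring.
      rewrite exp_0, cos_neg, sin_neg; f_equal; ring. }
  replace ((cos x, sin x) - (cos x, (- sin x)%R) : C) with (2 * Ci * sin x).
  - field; auto using Ci_neq_0, C2_neq_0.
  - unfold Ci, RtoC, Cmult, Cminus, Cplus, Copp; simpl; f_equal; ring.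
Qed.

(** The index is off by one: the angle is [j PI / 2^(k+1)] with [j = i + 1]. For [j < 2^k] these
    values are, up to sign, the zeros in the variable [sin w] of the polynomial
    [sin(2^(k+1) w) / (sin w cos w)]. *)
Definition dyadic_sin (k i : nat) : R := sin (INR (S i) * PI / 2 ^ S k).

(** This linear lower bound provides the majorant of order [1 / j^2] under which the dyadic products
    pass to the limit. *)
Lemma dyadic_sin_lower (k i : nat) : (i < 2 ^ k)%nat ->
  (INR (S i) <= 2 * (2 ^ S k * dyadic_sin k i))%R.
Proof.
  intros Hi; unfold dyadic_sin.
  assert (Hp : (0 < 2 ^ k)%R) by (apply pow_lt; lra).
  assert (Hi' : (INR (S i) <= 2 ^ k)%R).
  { apply le_INR in Hi; rewrite pow_INR in Hi; exact Hi. }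
  pose proof (lt_0_INR (S i) ltac:(lia)) as H0.
  pose proof PI_RGT_0; pose proof PI_4; pose proof PI2_3_2 as H32; unfold PI2 in H32.
  set (x := (INR (S i) * PI / 2 ^ S k)%R).
  assert (Hx : (x * 2 ^ S k = INR (S i) * PI)%R) by (unfold x; field; apply pow_nonzero; lra).
  assert (Hx2 : (0 <= x <= 2)%R).
  { simpl pow in Hx; split; [|nra].
    apply Rlt_le, Rdiv_lt_0_compat; [nra|simpl; nra]. }
  (* From [sin x >= x - x^3 / 6]; on [[0, 2]] the factor [1 - x^2 / 6] is at least [1 / 3]. *)
  assert (Hs : (x / 4 <= sin x)%R).
  { destruct (pre_sin_bound x 0) as [Hl _]; [lra|lra|].
    unfold sin_approx, sin_term in Hl; simpl in Hl.
    assert (x * (1 - x * x / 6) <= sin x)%R by lra.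
    assert (x * (1 / 4) <= x * (1 - x * x / 6))%R by (apply Rmult_le_compat_l; nra). lra. }
  apply Rle_trans with (2 * (2 ^ S k * (x / 4)))%R.
  - replace (2 * (2 ^ S k * (x / 4)))%R with (INR (S i) * (PI / 2))%R by (rewrite Rmult_comm in Hx; lra). nra.
  - apply Rmult_le_compat_l; [lra|]; apply Rmult_le_compat_l; [simpl; lra|exact Hs].
Qed.

Lemma dyadic_sin_pos (k i : nat) : (i < 2 ^ k)%nat -> (0 < dyadic_sin k i)%R.
Proof.
  intros Hi; pose proof (dyadic_sin_lower k i Hi); pose proof (lt_0_INR (S i) ltac:(lia)).
  assert (0 < 2 ^ S k)%R by (apply pow_lt; lra). nra.
Qed.

(** Euler's product in finite form, restricted to powers of 2 so that the double-angle formulas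
    suffice for the induction. Each old factor splits into two new ones, belonging to an angle and
    its complement, and the middle angle [PI / 4] contributes [1 - 2 sin^2 w = cos(2 w)]. *)
Lemma Csin_dyadic (k : nat) (w : C) :
  Csin (2 ^ S k * w) =
  2 ^ S k * (Csin w * Ccos w) *
  Cprod (fun i => 1 - Csin w * Csin w / (dyadic_sin k i * dyadic_sin k i)) (2 ^ k - 1).
Proof.
  revert w; induction k as [|k IH]; intros w.
  - simpl Cprod; replace (2 ^ 1 * w) with (2 * w) by (simpl; ring).
    rewrite Csin_double; simpl; ring.
  - replace (2 ^ S (S k) * w) with (2 ^ S k * (2 * w)) by (rewrite (Cpow_S _ (S k)); ring).
    rewrite IH, Ccos_double.
    set (n := (2 ^ k - 1)%nat).
    assert (H2k : (1 <= 2 ^ k)%nat) by (pose proof (Nat.pow_nonzero 2 k); lia).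
    assert (Hk2 : (0 < 2 ^ k)%R) by (apply pow_lt; lra).
    assert (Hn2k : INR n = (2 ^ k - 1)%R).
    { unfold n; rewrite minus_INR, pow_INR by exact H2k; reflexivity. }
    replace (2 ^ S k - 1)%nat with (n + S n)%nat by (unfold n; simpl; lia).
    rewrite Cprod_add, Cprod_shift.
    set (s := Csin w).
    (* The complementary angles come in decreasing order, so the second half is reversed before it
       is matched with the first. *)
    rewrite <- (Cprod_rev (fun i => 1 - s * s / (dyadic_sin (S k) (n + S i) * dyadic_sin (S k) (n + S i))) n).
    replace (1 - s * s / (RtoC (dyadic_sin (S k) (n + 0)) * dyadic_sin (S k) (n + 0))) with (1 - 2 * (s * s)).
    2:{ replace (dyadic_sin (S k) (n + 0)) with (sqrt 2 / 2)%R.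
        - rewrite <- RtoC_mult.
          replace (sqrt 2 / 2 * (sqrt 2 / 2))%R with (/ 2)%R.
          + rewrite RtoC_inv by lra; field; apply C2_neq_0.
          + pose proof (sqrt_sqrt 2 ltac:(lra)); lra.
        - unfold dyadic_sin; rewrite Nat.add_0_r, S_INR, Hn2k.
          replace ((2 ^ k - 1 + 1) * PI / 2 ^ S (S k))%R with (PI / 4)%R by (simpl; field; lra).
          rewrite sin_PI4.
          pose proof (sqrt_sqrt 2 ltac:(lra)); pose proof (sqrt_lt_R0 2 ltac:(lra)).
          apply (Rmult_eq_reg_r (sqrt 2)); [|lra].
          replace (1 / sqrt 2 * sqrt 2)%R with 1%R by (field; lra); lra. }
    rewrite (Cprod_ext
      (fun i => 1 - Csin (2 * w) * Csin (2 * w) / (dyadic_sin k i * dyadic_sin k i))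
      (fun i => (1 - s * s / (dyadic_sin (S k) i * dyadic_sin (S k) i)) *
                (1 - s * s / (dyadic_sin (S k) (n + S (n - S i)) * dyadic_sin (S k) (n + S (n - S i)))))).
    + rewrite Cprod_mult, Csin_double; fold s; rewrite (Cpow_S _ (S k)); ring.
    + intros i Hi.
      assert (Hi1 : (0 < dyadic_sin (S k) i)%R) by (apply dyadic_sin_pos; simpl; unfold n in Hi; lia).
      assert (Hc : dyadic_sin (S k) (n + S (n - S i)) = cos (INR (S i) * PI / 2 ^ S (S k))).
      { unfold dyadic_sin; rewrite <- sin_shift; f_equal.
        replace (S (n + S (n - S i)))%nat with (n + S n - i)%nat by lia.
        rewrite minus_INR, plus_INR, !S_INR, Hn2k by lia; simpl; field; lra. }
      assert (Hc0 : (0 < dyadic_sin (S k) (n + S (n - S i)))%R).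
      { apply dyadic_sin_pos; simpl; unfold n in *; lia. }
      assert (Hd : dyadic_sin k i = (2 * dyadic_sin (S k) i * dyadic_sin (S k) (n + S (n - S i)))%R).
      { rewrite Hc; unfold dyadic_sin; rewrite <- sin_2a; f_equal; simpl; field; lra. }
      assert (H1 : (dyadic_sin (S k) (n + S (n - S i)) * dyadic_sin (S k) (n + S (n - S i)) =
                    1 - dyadic_sin (S k) i * dyadic_sin (S k) i)%R).
      { rewrite Hc; unfold dyadic_sin; pose proof (sin2_cos2 (INR (S i) * PI / 2 ^ S (S k))) as E.
        unfold Rsqr in E; lra. }
      rewrite Hd; clear Hd Hc.
      set (t := dyadic_sin (S k) i) in *; set (c := dyadic_sin (S k) (n + S (n - S i))) in *.
      rewrite Csin_double; fold s.
      assert (Hs : Ccos w * Ccos w = 1 - s * s) by (unfold s; rewrite Csin_sqr; ring).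
      assert (Ht0 : RtoC t <> 0) by (intros E; apply RtoC_inj in E; lra).
      assert (Hcc0 : RtoC c <> 0) by (intros E; apply RtoC_inj in E; lra).
      assert (H1' : RtoC c * RtoC c = 1 - RtoC t * RtoC t).
      { rewrite <- !RtoC_mult, H1, RtoC_minus; reflexivity. }
      rewrite !RtoC_mult.
      transitivity (1 - s * s * (Ccos w * Ccos w) / (t * t * (c * c))).
      { field; auto using C2_neq_0. }
      transitivity (1 - s * s * (t * t + c * c) / (t * t * (c * c)) + s * s * (s * s) / (t * t * (c * c))).
      2:{ field; auto. }
      rewrite Hs, H1'. 
      assert (H3 : 1 - RtoC t * RtoC t <> 0) by (rewrite <- H1'; apply Cmult_neq_0; auto).
      field; auto.
Qed.

(** * Small-argument estimates and the limit of the dyadic products *)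

Lemma exp_taylor1 (x : R) : (Rabs x <= 1 / 2)%R -> (Rabs (exp x - 1 - x) <= 2 * (x * x))%R.
Proof.
  intros Hx; pose proof (exp_ineq1_le x) as H1; pose proof (exp_ineq1_le (- x)) as H3.
  apply Rabs_le_between in Hx; rewrite Rabs_pos_eq by lra.
  rewrite exp_Ropp in H3; pose proof (exp_pos x) as He.
  assert (H4 : ((1 + - x) * exp x <= 1)%R).
  { apply (Rmult_le_compat_r (exp x)) in H3; [|lra]. rewrite Rinv_l in H3 by lra. exact H3. }
  nra.
Qed.

Lemma sin_taylor1 (y : R) : (Rabs y <= 1 / 2)%R -> (Rabs (sin y - y) <= y * y)%R.
Proof.
  assert (Hpos : forall a, (0 <= a <= 1 / 2)%R -> (Rabs (sin a - a) <= a * a)%R).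
  { intros a Ha; destruct (pre_sin_bound a 0) as [Hl _]; [lra|lra|].
    unfold sin_approx, sin_term in Hl; simpl in Hl.
    assert (sin a <= a)%R.
    { destruct (Req_dec a 0) as [->|]; [rewrite sin_0; lra|left; apply sin_lt_x; lra]. }
    rewrite Rabs_left1 by lra. 
    assert (a - a * (a * a) / 6 <= sin a)%R by lra. nra. }
  intros Hy; destruct (Rle_dec 0 y).
  - apply Hpos; rewrite Rabs_pos_eq in Hy; lra.
  - rewrite Rabs_left in Hy by lra.
    specialize (Hpos (- y)%R ltac:(lra)); rewrite sin_neg in Hpos.
    rewrite <- Rabs_Ropp; replace (- (sin y - y))%R with (- sin y - - y)%R by ring; nra.
Qed.

Lemma cos_taylor1 (y : R) : (Rabs y <= 1 / 2)%R -> (Rabs (cos y - 1) <= 2 * (y * y))%R.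
Proof.
  intros Hy.
  replace (cos y) with (1 - 2 * sin (y / 2) * sin (y / 2))%R.
  2:{ rewrite <- cos_2a_sin; f_equal; field. }
  assert (Hy2 : (Rabs (y / 2) <= 1 / 2)%R).
  { unfold Rdiv; rewrite Rabs_mult, (Rabs_pos_eq (/ 2)) by lra; lra. }
  pose proof (sin_taylor1 (y / 2) Hy2) as Hs.
  apply Rabs_le_between in Hs; apply Rabs_le_between in Hy.
  assert (Ha : (Rabs (sin (y / 2)) <= Rabs y)%R).
  { apply Rabs_le; unfold Rabs; destruct (Rcase_abs y); nra. }
  apply Rsqr_le_abs_1 in Ha; unfold Rsqr in Ha.
  rewrite Rabs_left1; nra.
Qed.

Lemma Cexp_taylor1 (z : C) : (Cmod z <= 1 / 2)%R -> (Cmod (Cexp z - 1 - z) <= 16 * (Cmod z * Cmod z))%R.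
Proof.
  intros Hz; destruct z as [x y].
  assert (Hx : (Rabs x <= Cmod (x, y))%R) by (apply (re_le_Cmod (x, y))).
  assert (Hy : (Rabs y <= Cmod (x, y))%R).
  { eapply Rle_trans; [|apply Rmax_Cmod]; apply Rmax_r. }
  set (r := Cmod (x, y)) in *.
  pose proof (exp_taylor1 x ltac:(lra)) as H1.
  pose proof (sin_taylor1 y ltac:(lra)) as H2.
  pose proof (cos_taylor1 y ltac:(lra)) as H3.
  assert (Hxx : (x * x <= r * r)%R).
  { rewrite <- (Rabs_pos_eq (x * x)) by nra; rewrite Rabs_mult; pose proof (Rabs_pos x); nra. }
  assert (Hyy : (y * y <= r * r)%R).
  { rewrite <- (Rabs_pos_eq (y * y)) by nra; rewrite Rabs_mult; pose proof (Rabs_pos y); nra. }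
  assert (Hxy : (Rabs (x * y) <= r * r)%R).
  { rewrite Rabs_mult; pose proof (Rabs_pos y); pose proof (Rabs_pos x); nra. }
  assert (He : (exp x <= 3)%R).
  { apply Rle_trans with (exp 1); [apply exp_mono|apply exp_le_3].
    apply Rabs_le_between in Hx; lra. }
  pose proof (exp_pos x).
  assert (HA : (Rabs (exp x * cos y - 1 - x) <= 8 * (r * r))%R).
  { replace (exp x * cos y - 1 - x)%R with ((exp x - 1 - x) + exp x * (cos y - 1))%R by ring.
    eapply Rle_trans; [apply Rabs_triang|]; rewrite Rabs_mult, (Rabs_pos_eq (exp x)) by lra.
    pose proof (Rabs_pos (cos y - 1)). nra. }
  assert (HB : (Rabs (exp x * sin y - y) <= 8 * (r * r))%R).
  { replace (exp x * sin y - y)%R with (exp x * (sin y - y) + ((exp x - 1 - x) * y + x * y))%R by ring.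
    eapply Rle_trans; [apply Rabs_triang|].
    pose proof (Rabs_triang ((exp x - 1 - x) * y) (x * y)).
    rewrite Rabs_mult, (Rabs_pos_eq (exp x)) by lra.
    rewrite (Rabs_mult (exp x - 1 - x)) in H0.
    pose proof (Rabs_pos (sin y - y)); pose proof (Rabs_pos (exp x - 1 - x)); pose proof (Rabs_pos y).
    assert (Rabs (exp x - 1 - x) * Rabs y <= 2 * (x * x) * (1 / 2))%R by (apply Rmult_le_compat; lra).
    nra. }
  replace (Cexp (x, y) - 1 - (x, y)) with (RtoC (exp x * cos y - 1 - x) + Ci * RtoC (exp x * sin y - y)).
  - eapply Rle_trans; [apply Cmod_triangle|]; rewrite Cmod_mult, Cmod_Ci, !Cmod_R; lra.
  - unfold Cexp, Ci, RtoC, Cmult, Cminus, Cplus, Copp; simpl; f_equal; ring.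
Qed.

Lemma is_lim_seq_div_pow2 (c : R) : is_lim_seq (fun k => (c / 2 ^ S k)%R) 0%R.
Proof.
  apply (is_lim_seq_ext (fun k => (c / 2 * (/ 2) ^ k)%R)).
  - intros k; rewrite pow_inv; simpl; field; apply pow_nonzero; lra.
  - replace (Finite 0) with (Rbar_mult (c / 2)%R 0%R) by (simpl; f_equal; ring).
    apply is_lim_seq_scal_l, is_lim_seq_geom; rewrite Rabs_pos_eq; lra.
Qed.

Lemma Ccv_eventually (u : nat -> C) (l : C) (K : nat) :
  Ccv (fun n => u (n + K)%nat) l -> Ccv u l.
Proof.
  intros H eps Heps; destruct (H eps Heps) as [N HN]; exists (N + K)%nat; intros n Hn.
  specialize (HN (n - K)%nat ltac:(lia)); now replace (n - K + K)%nat with n in HN by lia.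
Qed.

Lemma div_pow2_small (c : R) : exists K, forall k, (K <= k)%nat -> (Rabs (c / 2 ^ S k) <= 1 / 2)%R.
Proof.
  pose proof (is_lim_seq_div_pow2 c) as H; apply is_lim_seq_spec in H.
  destruct (H (mkposreal (1 / 2) ltac:(lra))) as [K HK]; simpl in HK; exists K; intros k Hk.
  specialize (HK k Hk); rewrite Rminus_0_r in HK; simpl; lra.
Qed.

Lemma Ccv_Cexp_scaled (a : C) :
  Ccv (fun k => 2 ^ S k * (Cexp (a / 2 ^ S k) - 1)) a.
Proof.
  destruct (div_pow2_small (Cmod a)) as [K HK].
  apply (Ccv_eventually _ _ K).
  apply (Ccv_squeeze _ _ (fun k => (16 * (Cmod a * Cmod a)) / 2 ^ S (k + K))%R).
  { apply (is_lim_seq_incr_n (fun k => (16 * (Cmod a * Cmod a)) / 2 ^ S k)%R K), is_lim_seq_div_pow2. }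
  intros n; specialize (HK (n + K)%nat ltac:(lia)).
  assert (Hp : (0 < 2 ^ S (n + K))%R) by (apply pow_lt; lra).
  rewrite <- RtoC_pow; set (N := (2 ^ S (n + K))%R) in *.
  assert (HN : RtoC N <> 0) by (intros E; apply RtoC_inj in E; lra).
  assert (Hm : Cmod (a / N) = (Cmod a / N)%R).
  { rewrite Cmod_div, Cmod_R, Rabs_pos_eq by (auto; lra); reflexivity. }
  rewrite Rabs_pos_eq in HK by (apply Rcomplements.Rdiv_le_0_compat; [apply Cmod_ge_0|lra]).
  pose proof (Cexp_taylor1 (a / N) ltac:(rewrite Hm; exact HK)) as Ht.
  replace (N * (Cexp (a / N) - 1) - a) with (N * (Cexp (a / N) - 1 - a / N)) by (field; auto).
  rewrite Cmod_mult, Cmod_R, Rabs_pos_eq, Hm in * by lra.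
  apply (Rmult_le_compat_l N) in Ht; [|lra].
  eapply Rle_trans; [exact Ht|]; right; field; lra.
Qed.

Lemma Ccv_Cexp_1 (a : C) : Ccv (fun k => Cexp (a / 2 ^ S k)) 1.
Proof.
  apply (Ccv_eq _ (1 + 0 * a)); [ring|].
  apply (Ccv_ext (fun k => 1 + RtoC (1 / 2 ^ S k) * (2 ^ S k * (Cexp (a / 2 ^ S k) - 1)))).
  - intros k; rewrite RtoC_div, RtoC_pow by (apply pow_nonzero; lra).
    field; apply (Cpow_nz 2 (S k)), C2_neq_0.
  - apply Ccv_plus; [apply Ccv_const|apply Ccv_mult; [|apply Ccv_Cexp_scaled]].
    apply Ccv_RtoC, is_lim_seq_div_pow2.
Qed.

Lemma Ccv_Csin_scaled (a : C) : Ccv (fun k => 2 ^ S k * Csin (a / 2 ^ S k)) a.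
Proof.
  pose proof Ci_neq_0; pose proof C2_neq_0.
  apply (Ccv_eq _ ((Ci * a - (- (Ci * a))) / (2 * Ci))); [field; auto|].
  apply (Ccv_ext (fun k => (2 ^ S k * (Cexp ((Ci * a) / 2 ^ S k) - 1) - 2 ^ S k * (Cexp ((- (Ci * a)) / 2 ^ S k) - 1)) / (2 * Ci))).
  - intros k; unfold Csin.
    assert (H2k : 2 ^ S k <> 0) by (apply Cpow_nz; auto).
    replace (Ci * (a / 2 ^ S k)) with ((Ci * a) / 2 ^ S k) by (field; auto).
    replace (- (Ci * a / 2 ^ S k)) with ((- (Ci * a)) / 2 ^ S k) by (field; auto).
    field; auto.
  - apply Ccv_div; [apply Cmult_neq_0; auto| |apply Ccv_const].
    apply Ccv_minus; apply Ccv_Cexp_scaled.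
Qed.

Lemma Ccv_Ccos_scaled (a : C) : Ccv (fun k => Ccos (a / 2 ^ S k)) 1.
Proof.
  pose proof C2_neq_0.
  apply (Ccv_eq _ ((1 + 1) / 2)); [field; auto|].
  apply (Ccv_ext (fun k => (Cexp ((Ci * a) / 2 ^ S k) + Cexp ((- (Ci * a)) / 2 ^ S k)) / 2)).
  - intros k; unfold Ccos.
    assert (H2k : 2 ^ S k <> 0) by (apply Cpow_nz; auto).
    replace (Ci * (a / 2 ^ S k)) with ((Ci * a) / 2 ^ S k) by (field; auto).
    replace (- (Ci * a / 2 ^ S k)) with ((- (Ci * a)) / 2 ^ S k) by (field; auto).
    reflexivity.
  - apply Ccv_div; [auto| |apply Ccv_const].
    apply Ccv_plus; apply Ccv_Cexp_1.
Qed.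

Lemma Ccv_bounded_all (u : nat -> C) (l : C) : Ccv u l -> exists B, forall n, (Cmod (u n) <= B)%R.
Proof.
  intros H; destruct (Ccv_bounded u l H) as [N HN].
  assert (Hfin : exists B, forall n, (n < N)%nat -> (Cmod (u n) <= B)%R).
  { clear HN; induction N as [|N [B HB]]; [exists 0%R; intros; lia|].
    exists (Rmax B (Cmod (u N))); intros n Hn.
    destruct (Nat.eq_dec n N) as [->|Hne]; [apply Rmax_r|].
    eapply Rle_trans; [apply HB; lia|apply Rmax_l]. }
  destruct Hfin as [B HB]; exists (Rmax B (Cmod l + 1)); intros n.
  destruct (Nat.lt_ge_cases n N).
  - eapply Rle_trans; [apply HB; auto|apply Rmax_l].
  - eapply Rle_trans; [apply HN; auto|apply Rmax_r].
Qed.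

Lemma summable_scal (c : R) (a : nat -> R) : (0 <= c)%R -> summable a -> summable (fun i => c * a i)%R.
Proof.
  intros Hc [Hp [B HB]]; split; [intros; apply Rmult_le_pos; auto|].
  exists (c * B)%R; intros n; rewrite Rsum_scal; apply Rmult_le_compat_l; auto.
Qed.

Lemma summable_inv_sqr : summable (fun i => / (INR (S i) * INR (S i)))%R.
Proof.
  split.
  - intros i; pose proof (lt_0_INR (S i) ltac:(lia)); left; apply Rinv_0_lt_compat; nra.
  - exists 2%R.
    assert (H : forall n, (Rsum (fun i => / (INR (S i) * INR (S i)))%R (S n) <= 2 - / INR (S n))%R).
    { induction n as [|n IH].
      - simpl; lra.
      - change (Rsum (fun i => / (INR (S i) * INR (S i)))%R (S n) + / (INR (S (S n)) * INR (S (S n))) <= 2 - / INR (S (S n)))%R.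
        rewrite (S_INR (S n)); pose proof (lt_0_INR (S n) ltac:(lia)) as Hx.
        set (x := INR (S n)) in *.
        assert (/ ((x + 1) * (x + 1)) <= / x - / (x + 1))%R.
        { replace (/ x - / (x + 1))%R with (/ (x * (x + 1)))%R by (field; lra).
          apply Rinv_le_contravar; nra. }
        lra. }
    intros [|n]; [simpl; lra|].
    specialize (H n); pose proof (lt_0_INR (S n) ltac:(lia)) as Hx; apply Rinv_0_lt_compat in Hx; lra.
Qed.

Lemma RtoC_neq_0 (x : R) : x <> 0%R -> RtoC x <> 0.
Proof. intros H E; apply H, RtoC_inj, E. Qed.

(** [Cprod_dominated] applied to [Csin_dyadic] at [w = PI z / 2^(k+1)]: each dyadic factor tends to
    [1 - z^2 / j^2], because [2^(k+1) sin(a / 2^(k+1))] tends to [a]. *)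
Lemma sin_product (z : C) :
  Ccv (fun n => PI * z * Cprod (fun j => 1 - z * z / (INR (S j) * INR (S j))) n) (Csin (PI * z)).
Proof.
  set (g := fun j => 1 - z * z / (INR (S j) * INR (S j))).
  assert (Hg : exists l, Ccv (Cprod g) l).
  { apply (Cprod_Ccv g (fun i => Cmod (z * z) * / (INR (S i) * INR (S i)))%R).
    - apply summable_scal; [apply Cmod_ge_0|apply summable_inv_sqr].
    - intros i; unfold g; pose proof (lt_0_INR (S i) ltac:(lia)) as Hx.
      replace (1 - z * z / (INR (S i) * INR (S i)) - 1) with (- (z * z / RtoC (INR (S i) * INR (S i)))) by (rewrite RtoC_mult; ring).
      rewrite Cmod_opp, Cmod_div, (Cmod_R (_ * _)), Rabs_pos_eq by (try apply RtoC_neq_0; nra).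
      right; reflexivity. }
  destruct Hg as [l Hl].
  enough (H : Csin (PI * z) = PI * z * l) by (rewrite H; apply Ccv_scal, Hl).
  pose proof (Ccv_Csin_scaled (PI * z)) as Hs.
  destruct (Ccv_bounded_all _ _ Hs) as [B HB].
  set (f := fun k j => 1 - Csin (PI * z / 2 ^ S k) * Csin (PI * z / 2 ^ S k) / (dyadic_sin k j * dyadic_sin k j)).
  assert (Hprod : Ccv (fun k => Cprod (f k) (2 ^ k - 1)) l).
  { apply (Cprod_dominated f g (fun i => (4 * (B * B)) * / (INR (S i) * INR (S i)))%R); auto.
    - apply summable_scal; [nra|apply summable_inv_sqr].
    - intros k j Hj; unfold f.
      pose proof (dyadic_sin_pos k j ltac:(lia)) as Hd.
      pose proof (dyadic_sin_lower k j ltac:(lia)) as Hl'.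
      pose proof (lt_0_INR (S j) ltac:(lia)) as Hx.
      specialize (HB k); rewrite Cmod_mult, Cmod_pow, Cmod_R, Rabs_pos_eq in HB by lra.
      assert (Hp : (0 < 2 ^ S k)%R) by (apply pow_lt; lra).
      set (N := (2 ^ S k)%R) in *; set (s := Csin _) in *; set (d := dyadic_sin k j) in *; set (x := INR (S j)) in *.
      replace (1 - s * s / (d * d) - 1) with (- (s * s / RtoC (d * d))) by (rewrite RtoC_mult; ring).
      rewrite Cmod_opp, Cmod_div, Cmod_mult, Cmod_R, Rabs_pos_eq by (try apply RtoC_neq_0; nra).
      pose proof (Cmod_ge_0 s).
      assert (H0 : (0 <= N * Cmod s)%R) by (apply Rmult_le_pos; lra).
      assert (H1 : ((N * Cmod s) * (N * Cmod s) <= B * B)%R) by (apply Rmult_le_compat; lra).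
      assert (H2 : (x * x <= 4 * ((N * d) * (N * d)))%R).
      { replace (4 * ((N * d) * (N * d)))%R with ((2 * (N * d)) * (2 * (N * d)))%R by ring.
        apply Rmult_le_compat; lra. }
      apply (Rmult_le_reg_r (d * d * (x * x))); [apply Rmult_lt_0_compat; nra|].
      replace (Cmod s * Cmod s / (d * d) * (d * d * (x * x)))%R with (Cmod s * Cmod s * (x * x))%R by (field; lra).
      replace (4 * (B * B) * / (x * x) * (d * d * (x * x)))%R with (4 * (B * B) * (d * d))%R by (field; lra).
      apply Rle_trans with (Cmod s * Cmod s * (4 * ((N * d) * (N * d))))%R.
      + apply Rmult_le_compat_l; nra.
      + replace (Cmod s * Cmod s * (4 * (N * d * (N * d))))%R with (4 * ((N * Cmod s) * (N * Cmod s)) * (d * d))%R by ring.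
        apply Rmult_le_compat_r; nra.
    - intros j; unfold f, g.
      pose proof (lt_0_INR (S j) ltac:(lia)) as Hx; pose proof PI_RGT_0 as HPI.
      assert (HPI0 : RtoC PI <> 0) by (apply RtoC_neq_0; lra).
      assert (Hx0 : RtoC (INR (S j)) <> 0) by (apply RtoC_neq_0; lra).
      apply Ccv_minus; [apply Ccv_const|].
      pose proof (Ccv_Csin_scaled (RtoC (INR (S j) * PI))) as Hd.
      apply (Ccv_eq _ ((PI * z) * (PI * z) / (RtoC (INR (S j) * PI) * RtoC (INR (S j) * PI)))).
      { rewrite RtoC_mult; field; auto. }
      destruct (div_pow2_small (INR (S j) * PI)) as [K HK].
      assert (Hdiv : Ccv (fun k => (2 ^ S k * Csin (PI * z / 2 ^ S k)) * (2 ^ S k * Csin (PI * z / 2 ^ S k)) /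
        ((2 ^ S k * Csin (RtoC (INR (S j) * PI) / 2 ^ S k)) * (2 ^ S k * Csin (RtoC (INR (S j) * PI) / 2 ^ S k))))
        ((PI * z) * (PI * z) / (RtoC (INR (S j) * PI) * RtoC (INR (S j) * PI)))).
      { apply Ccv_div.
        - rewrite RtoC_mult; repeat apply Cmult_neq_0; auto.
        - now apply Ccv_mult.
        - now apply Ccv_mult. }
      (* Starting at [k = S j] guarantees [j < 2^k], hence a nonzero dyadic sine in the
         denominator. *)
      apply (Ccv_eventually _ _ (S j)).
      refine (Ccv_ext _ _ _ _ (Ccv_subseq _ (fun n => n + S j)%nat _ (fun n => Nat.le_add_r n (S j)) Hdiv)).
      intros n; cbv beta.
      replace (RtoC (INR (S j) * PI) / 2 ^ S (n + S j)) with (RtoC (INR (S j) * PI / 2 ^ S (n + S j))).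
      2:{ rewrite RtoC_div, RtoC_pow by (apply pow_nonzero; lra); reflexivity. }
      rewrite Csin_R; fold (dyadic_sin (n + S j) j).
      assert (Hd0 : (0 < dyadic_sin (n + S j) j)%R).
      { apply dyadic_sin_pos.
        apply Nat.lt_le_trans with (2 ^ S j)%nat; [|apply Nat.pow_le_mono_r; lia].
        apply Nat.lt_trans with (S j); [lia|apply Nat.pow_gt_lin_r; lia]. }
      field; split; [apply RtoC_neq_0; lra|apply Cpow_nz, C2_neq_0].
    - intros M; exists M; intros k Hk.
      pose proof (Nat.pow_gt_lin_r 2 k ltac:(lia)); lia. }
  symmetry; apply (Ccv_unique (fun k => (2 ^ S k * Csin (PI * z / 2 ^ S k)) * Ccos (PI * z / 2 ^ S k) * Cprod (f k) (2 ^ k - 1))).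
  - apply (Ccv_eq _ (PI * z * 1 * l)); [ring|].
    apply Ccv_mult; [apply Ccv_mult; [exact Hs|apply Ccv_Ccos_scaled]|exact Hprod].
  - apply (Ccv_ext (fun _ => Csin (PI * z))); [|apply Ccv_const].
    intros k; assert (H2 : 2 ^ S k <> 0) by apply Cpow_nz, C2_neq_0.
    replace (PI * z) with (2 ^ S k * (PI * z / 2 ^ S k)) at 1 by (field; auto).
    rewrite Csin_dyadic; unfold f; ring.
Qed.

(** * The transformation of the discriminant *)

Definition sinpi (z : C) : C := Csin (PI * z).

Lemma nome_plus (a b : C) : nome (a + b) = nome a * nome b.
Proof. unfold nome; rewrite <- Cexp_plus; f_equal; ring. Qed.

Lemma nome_opp (a : C) : nome (- a) = / nome a.
Proof. unfold nome; rewrite <- Cexp_opp; f_equal; ring. Qed.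

Lemma nome_neq_0 (a : C) : nome a <> 0.
Proof. apply Cexp_neq_0. Qed.

Lemma nome_pow (a : C) (n : nat) : nome a ^ n = nome (INR n * a).
Proof. unfold nome; rewrite Cexp_pow; f_equal; ring. Qed.

Lemma Cmod_nome (z : C) : Cmod (nome z) = exp (- (2 * PI * Im z)).
Proof. unfold nome; rewrite Cmod_Cexp; f_equal; destruct z as [x y]; simpl; ring. Qed.

Lemma nome_1 : nome 1 = 1.
Proof.
  unfold nome, Cexp; simpl.
  replace (((2 * PI - 0 * 0) * 0 - (2 * 0 + 0 * PI) * 1) * 1 -
   ((2 * PI - 0 * 0) * 1 + (2 * 0 + 0 * PI) * 0) * 0)%R with 0%R by ring.
  replace (((2 * PI - 0 * 0) * 0 - (2 * 0 + 0 * PI) * 1) * 0 +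
   ((2 * PI - 0 * 0) * 1 + (2 * 0 + 0 * PI) * 0) * 1)%R with (2 * PI)%R by ring.
  rewrite exp_0, cos_2PI, sin_2PI; unfold RtoC; f_equal; ring.
Qed.

Lemma nome_half : nome (/ 2) = - (1).
Proof.
  replace (/ 2) with (RtoC (/ 2)) by (rewrite RtoC_inv; [reflexivity|lra]).
  unfold nome, Cexp; simpl.
  replace (((2 * PI - 0 * 0) * 0 - (2 * 0 + 0 * PI) * 1) * / 2 -
   ((2 * PI - 0 * 0) * 1 + (2 * 0 + 0 * PI) * 0) * 0)%R with 0%R by ring.
  replace (((2 * PI - 0 * 0) * 0 - (2 * 0 + 0 * PI) * 1) * 0 +
   ((2 * PI - 0 * 0) * 1 + (2 * 0 + 0 * PI) * 0) * / 2)%R with PI by field.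
  rewrite exp_0, cos_PI, sin_PI; unfold RtoC, Copp; simpl; f_equal; ring.
Qed.

Lemma nome_lt_1 (z : C) : (0 < Im z)%R -> (Cmod (nome z) < 1)%R.
Proof.
  intros H; rewrite Cmod_nome, <- exp_0; apply exp_increasing.
  pose proof PI_RGT_0; nra.
Qed.

(** A square root of [nome z]; sine quotients become rational expressions in such roots. *)
Definition sroot (z : C) : C := Cexp (Ci * (PI * z)).

Lemma sroot_neq_0 (z : C) : sroot z <> 0.
Proof. apply Cexp_neq_0. Qed.

Lemma sroot_plus (a b : C) : sroot (a + b) = sroot a * sroot b.
Proof. unfold sroot; rewrite <- Cexp_plus; f_equal; ring. Qed.

Lemma sroot_opp (a : C) : sroot (- a) = / sroot a.
Proof. unfold sroot; rewrite <- Cexp_opp; f_equal; ring. Qed.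

Lemma sroot_sqr (a : C) : sroot a * sroot a = nome a.
Proof. unfold sroot, nome; rewrite <- Cexp_plus; f_equal; ring. Qed.

Lemma sinpi_sroot (z : C) : sinpi z = (sroot z - / sroot z) / (2 * Ci).
Proof. unfold sinpi, Csin; rewrite Cexp_opp; reflexivity. Qed.

Lemma sinpi_neq_0 (z : C) : nome z <> 1 -> sinpi z <> 0.
Proof.
  intros H E; apply H; rewrite <- sroot_sqr.
  rewrite sinpi_sroot in E.
  pose proof (sroot_neq_0 z); pose proof Ci_neq_0; pose proof C2_neq_0.
  assert (E2 : sroot z - / sroot z = 0).
  { replace (sroot z - / sroot z) with ((sroot z - / sroot z) / (2 * Ci) * (2 * Ci)) by (field; auto).
    rewrite E; ring. }
  replace (sroot z * sroot z) with (sroot z * (sroot z - / sroot z) + 1) by (field; auto).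
  rewrite E2; ring.
Qed.

Lemma Cmod_neq (x y : C) : Cmod x <> Cmod y -> x <> y.
Proof. intros H E; apply H; now rewrite E. Qed.

Lemma nome_neq_1 (z : C) : (0 < Im z)%R -> nome z <> 1.
Proof. intros H; apply Cmod_neq; rewrite Cmod_1; pose proof (nome_lt_1 z H); lra. Qed.

Lemma Cminus_neq_0 (a b : C) : a <> b -> a - b <> 0.
Proof. intros H E; apply H; replace a with (a - b + b) by ring; rewrite E; ring. Qed.

(** This is [sin(PI(w - z)) sin(PI(w + z)) / sin(PI w)^2] with [X = nome w] and [x = nome z]: the
    value of the product of [1 - z^2 / (w + n)^2] over all integers [n]. *)
Definition theta_row (X x : C) : C := (1 - X * x) * (1 - X / x) / ((1 - X) * (1 - X)).

Lemma sinpi_ratio (w z : C) : nome w <> 1 ->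
  sinpi (w - z) * sinpi (w + z) / (sinpi w * sinpi w) = theta_row (nome w) (nome z).
Proof.
  intros H; unfold theta_row; rewrite !sinpi_sroot.
  unfold Cminus; rewrite !sroot_plus, !sroot_opp, <- !sroot_sqr.
  rewrite <- sroot_sqr in H.
  pose proof (sroot_neq_0 z); pose proof (sroot_neq_0 w); pose proof Ci_neq_0; pose proof C2_neq_0.
  set (b := sroot w) in *; set (a := sroot z) in *.
  assert (1 - b * b <> 0) by (apply Cminus_neq_0; auto).
  assert (b * b - 1 <> 0) by (apply Cminus_neq_0; auto).
  field; repeat split; auto.
  intros E; apply H; replace (b * b) with (b * b + -1 + 1) by ring; rewrite E; ring.
Qed.

(** Determinant over trace of the quadratic form [|x t + y|^2] in [(x, y)], which bounds its smaller
    eigenvalue from below. *)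
Definition sum_sqr_lower (t : C) : R := (Im t * Im t / (1 + Re t * Re t + Im t * Im t))%R.

Lemma sum_sqr_lower_pos (t : C) : (0 < Im t)%R -> (0 < sum_sqr_lower t)%R.
Proof.
  intros H; unfold sum_sqr_lower; apply Rdiv_lt_0_compat; [nra|].
  pose proof (Rle_0_sqr (Re t)); unfold Rsqr in *; nra.
Qed.

Lemma Cmod_sqr (z : C) : (Cmod z * Cmod z = Re z * Re z + Im z * Im z)%R.
Proof. pose proof (Cmod2_alt z) as H; simpl in H; rewrite !Rmult_1_r in H; exact H. Qed.

Lemma lattice_lower (t : C) (x y : R) :
  (sum_sqr_lower t * (x * x + y * y) <= Cmod (x * t + y) * Cmod (x * t + y))%R.
Proof.
  rewrite Cmod_sqr; destruct t as [a b]; unfold sum_sqr_lower; simpl.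
  assert (Hp : (0 < 1 + a * a + b * b)%R) by nra.
  apply (Rmult_le_reg_l (1 + a * a + b * b)); [exact Hp|].
  replace ((1 + a * a + b * b) * (b * b / (1 + a * a + b * b) * (x * x + y * y)))%R
    with (b * b * (x * x + y * y))%R by (field; lra).
  apply Rminus_le_0.
  match goal with |- (0 <= ?E)%R =>
    replace E with (((a * a + b * b) * x + a * y) * ((a * a + b * b) * x + a * y) + (a * x + y) * (a * x + y))%R by ring end.
  apply Rplus_le_le_0_compat; apply Rle_0_sqr.
Qed.

Lemma lattice_upper (t : C) (x y : R) :
  (Cmod (x * t + y) * Cmod (x * t + y) <= (1 + Re t * Re t + Im t * Im t) * (x * x + y * y))%R.
Proof.
  rewrite Cmod_sqr; destruct t as [a b]; simpl.
  apply Rminus_le_0.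
  match goal with |- (0 <= ?E)%R =>
    replace E with ((a * y - x) * (a * y - x) + (b * y) * (b * y))%R by ring end.
  apply Rplus_le_le_0_compat; apply Rle_0_sqr.
Qed.

Definition half_period (t z : C) : Prop :=
  exists r s : R, z = r * t + s /\ (r = 0 \/ r = 1 / 2 \/ r = - (1 / 2))%R /\
    (s = 0 \/ s = 1 / 2 \/ s = - (1 / 2))%R.

Lemma half_shift_sqr (m : Z) (r : R) : (r = 0 \/ r = 1 / 2 \/ r = - (1 / 2))%R ->
  (IZR m * IZR m / 4 <= (IZR m + r) * (IZR m + r))%R /\
  (IZR m * IZR m / 4 <= (IZR m - r) * (IZR m - r))%R.
Proof.
  intros Hr.
  assert (Hm : m = 0%Z \/ (1 <= IZR m)%R \/ (IZR m <= -1)%R).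
  { destruct (Z.eq_dec m 0); [now left|right].
    destruct (Z.le_gt_cases 0 m); [left|right]; apply IZR_le; lia. }
  destruct Hm as [->|[H|H]]; destruct Hr as [->|[->| ->]]; split; nra.
Qed.

Lemma sqr_pos_inv (x : R) : (0 <= x)%R -> (0 < x * x)%R -> (0 < x)%R.
Proof. intros [H|H] H2; [exact H|subst; lra]. Qed.

(** The expression is [(w + z)(w - z) / w^2]. A shift by 0 or [1/2] in absolute value leaves a
    nonzero integer at least half as large, so both [w + z] and [w - z] are of the order of [w],
    uniformly over the lattice. *)
Lemma half_period_avoid (t z : C) : (0 < Im t)%R -> half_period t z ->
  exists del, (0 < del)%R /\ forall m n : Z, m <> 0%Z \/ n <> 0%Z ->
    (del <= Cmod (1 - z * z / ((IZR m * t + IZR n) * (IZR m * t + IZR n))))%R.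
Proof.
  intros Ht [r [s [-> [Hr Hs]]]].
  pose proof (sum_sqr_lower_pos t Ht) as Hk; set (k := sum_sqr_lower t) in *.
  set (T := (1 + Re t * Re t + Im t * Im t)%R).
  assert (HT : (0 < T)%R) by (unfold T; nra).
  exists (k / 4 / T)%R; split; [apply Rdiv_lt_0_compat; lra|].
  intros m n Hmn.
  set (S := (IZR m * IZR m + IZR n * IZR n)%R).
  assert (HS : (0 < S)%R).
  { apply Rlt_le_trans with 1%R; [lra|].
    unfold S; rewrite <- !mult_IZR, <- plus_IZR; apply IZR_le; nia. }
  set (w := IZR m * t + IZR n); set (z := r * t + s).
  assert (Hup : (Cmod w * Cmod w <= T * S)%R) by apply lattice_upper.
  assert (Hlo : (k * S <= Cmod w * Cmod w)%R) by apply lattice_lower.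
  assert (Hw : (0 < Cmod w)%R).
  { apply sqr_pos_inv; [apply Cmod_ge_0|]; assert (0 < k * S)%R by (apply Rmult_lt_0_compat; lra); lra. }
  assert (Hw0 : w <> 0) by (apply Cmod_gt_0; exact Hw).
  destruct (half_shift_sqr m r Hr) as [Hm1 Hm2]; destruct (half_shift_sqr n s Hs) as [Hn1 Hn2].
  assert (H1 : (k * (S / 4) <= Cmod (w + z) * Cmod (w + z))%R).
  { replace (w + z) with (RtoC (IZR m + r) * t + RtoC (IZR n + s)) by (unfold w, z; rewrite !RtoC_plus; ring).
    eapply Rle_trans; [|apply lattice_lower]; apply Rmult_le_compat_l; [left; exact Hk|unfold S; lra]. }
  assert (H2 : (k * (S / 4) <= Cmod (w - z) * Cmod (w - z))%R).
  { replace (w - z) with (RtoC (IZR m - r) * t + RtoC (IZR n - s)) by (unfold w, z; rewrite !RtoC_minus; ring).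
    eapply Rle_trans; [|apply lattice_lower]; apply Rmult_le_compat_l; [left; exact Hk|unfold S; lra]. }
  replace (1 - z * z / (w * w)) with ((w + z) * (w - z) / (w * w)) by (field; auto).
  rewrite Cmod_div, !Cmod_mult by (apply Cmult_neq_0; auto).
  set (A := Cmod (w + z)) in *; set (B := Cmod (w - z)) in *; set (W := Cmod w) in *.
  assert (HA : (0 <= A)%R) by apply Cmod_ge_0. assert (HB : (0 <= B)%R) by apply Cmod_ge_0.
  assert (HAB : (k * (S / 4) <= A * B)%R).
  { assert (HkS : (0 < k * (S / 4))%R) by (apply Rmult_lt_0_compat; lra).
    apply Rsqr_incr_0; [|lra|apply Rmult_le_pos; auto]. unfold Rsqr.
    replace (A * B * (A * B))%R with ((A * A) * (B * B))%R by ring.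
    apply Rmult_le_compat; lra. }
  apply (Rmult_le_reg_r (W * W)); [nra|].
  replace (A * B / (W * W) * (W * W))%R with (A * B)%R by (field; lra).
  eapply Rle_trans; [|exact HAB].
  apply Rle_trans with (k / 4 / T * (T * S))%R.
  - apply Rmult_le_compat_l; [|exact Hup]. left; apply Rdiv_lt_0_compat; lra.
  - right; field; lra.
Qed.

(* The factor at the lattice point [w] of the product of
   [sigma(c + d) sigma(c - d) / (sigma(c)^2 sigma(d)^2)]; since the arguments
   satisfy (c+d)^2 + (c-d)^2 = 2c^2 + 2d^2, it is [1 + O(w^-4)]. *)
Definition hfac (c d w : C) : C :=
  (1 - (c + d) * (c + d) / (w * w)) * (1 - (c - d) * (c - d) / (w * w)) /
  ((1 - c * c / (w * w)) * (1 - c * c / (w * w)) *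
   ((1 - d * d / (w * w)) * (1 - d * d / (w * w)))).

Lemma hfac_opp (c d w : C) : hfac c d (- w) = hfac c d w.
Proof. unfold hfac; replace (- w * - w) with (w * w) by ring; reflexivity. Qed.

Lemma hfac_scale (c d w s : C) : w <> 0 -> s <> 0 -> hfac (c / s) (d / s) (w / s) = hfac c d w.
Proof.
  intros Hw Hs; unfold hfac.
  replace ((c / s + d / s) * (c / s + d / s) / (w / s * (w / s))) with ((c + d) * (c + d) / (w * w)) by (field; auto).
  replace ((c / s - d / s) * (c / s - d / s) / (w / s * (w / s))) with ((c - d) * (c - d) / (w * w)) by (field; auto).
  replace (c / s * (c / s) / (w / s * (w / s))) with (c * c / (w * w)) by (field; auto).
  replace (d / s * (d / s) / (w / s * (w / s))) with (d * d / (w * w)) by (field; auto).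
  reflexivity.
Qed.

Definition inv1sqr (m : nat) : R := (/ (1 + INR m * INR m))%R.

Lemma inv1sqr_pos (m : nat) : (0 < inv1sqr m <= 1)%R.
Proof.
  unfold inv1sqr; pose proof (pos_INR m); split; [apply Rinv_0_lt_compat; nra|].
  rewrite <- Rinv_1; apply Rinv_le_contravar; nra.
Qed.

Lemma Rsum_shift (f : nat -> R) (n : nat) :
  Rsum f (S n) = (f 0%nat + Rsum (fun i => f (S i)) n)%R.
Proof.
  induction n as [|n IH]; [simpl; ring|].
  change (Rsum f (S (S n))) with (Rsum f (S n) + f (S n))%R; rewrite IH; simpl; ring.
Qed.

Lemma summable_inv1sqr : summable inv1sqr.
Proof.
  split; [intros i; pose proof (inv1sqr_pos i); lra|].
  destruct summable_inv_sqr as [Hp [B HB]].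
  exists (1 + B)%R; intros [|n]; [simpl; specialize (HB 0%nat); simpl in HB; lra|].
  rewrite Rsum_shift; apply Rplus_le_compat; [apply inv1sqr_pos|].
  eapply Rle_trans; [|apply (HB n)]; apply Rsum_le; intros i _.
  unfold inv1sqr; pose proof (lt_0_INR (S i) ltac:(lia)); apply Rinv_le_contravar; nra.
Qed.

(** Fourth-order decay in [w] is just enough: it splits into a product of summable majorants in [m]
    and [n], as [double_product_swap] requires. *)
Lemma hfac_bound (t c d : C) : (0 < Im t)%R -> half_period t c -> half_period t d ->
  exists K, (0 <= K)%R /\ forall m n : Z, m <> 0%Z \/ n <> 0%Z ->
    (Cmod (hfac c d (IZR m * t + IZR n) - 1) <=
     K * (/ (1 + IZR m * IZR m) * / (1 + IZR n * IZR n)))%R.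
Proof.
  intros Ht Hc Hd.
  destruct (half_period_avoid t c Ht Hc) as [dc [Hdc Hc']].
  destruct (half_period_avoid t d Ht Hd) as [dd [Hdd Hd']].
  pose proof (sum_sqr_lower_pos t Ht) as Hk; set (k := sum_sqr_lower t) in *.
  set (X := Cmod (c * c)); set (Y := Cmod (d * d)).
  assert (HX : (0 <= X)%R) by apply Cmod_ge_0; assert (HY : (0 <= Y)%R) by apply Cmod_ge_0.
  set (N := (6 * (X * Y) + 2 * (X + Y) * (X * Y) * / k + (X * Y) * (X * Y) * (/ k * / k))%R).
  assert (Hk' : (0 < / k)%R) by (apply Rinv_0_lt_compat; exact Hk).
  assert (HXY : (0 <= X * Y)%R) by (apply Rmult_le_pos; auto).
  assert (HN : (0 <= N)%R).
  { unfold N; repeat apply Rplus_le_le_0_compat; repeat apply Rmult_le_pos; lra. }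
  set (D := (dc * dc * (dd * dd))%R).
  assert (HD : (0 < D)%R) by (unfold D; repeat apply Rmult_lt_0_compat; auto).
  exists (4 * (N * (/ k * / k) / D))%R; split.
  { apply Rmult_le_pos; [lra|]; apply Rcomplements.Rdiv_le_0_compat; [|exact HD].
    apply Rmult_le_pos; [exact HN|nra]. }
  intros m n Hmn; specialize (Hc' m n Hmn); specialize (Hd' m n Hmn).
  set (S := (IZR m * IZR m + IZR n * IZR n)%R).
  assert (HS : (1 <= S)%R).
  { unfold S; rewrite <- !mult_IZR, <- plus_IZR; apply IZR_le; nia. }
  set (w := IZR m * t + IZR n) in *.
  assert (Hlo : (k * S <= Cmod w * Cmod w)%R) by apply lattice_lower.
  assert (Hw0 : w <> 0).
  { apply Cmod_gt_0, sqr_pos_inv; [apply Cmod_ge_0|]; nra. }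
  set (u := / (w * w)).
  assert (Hu : (Cmod u <= / k * / S)%R).
  { unfold u; rewrite Cmod_inv, Cmod_mult by (apply Cmult_neq_0; auto).
    rewrite <- Rinv_mult; apply Rinv_le_contravar; [nra|exact Hlo]. }
  assert (HSi : (0 < / S <= 1)%R).
  { split; [apply Rinv_0_lt_compat; lra|]; rewrite <- Rinv_1; apply Rinv_le_contravar; lra. }
  assert (Huk : (Cmod u <= / k)%R) by nra.
  pose proof (Cmod_ge_0 u) as Hu0.
  assert (Hc0 : 1 - c * c / (w * w) <> 0) by (apply Cmod_gt_0; lra).
  assert (Hd0 : 1 - d * d / (w * w) <> 0) by (apply Cmod_gt_0; lra).
  (* With [u = w^-2], the terms linear in [u] cancel and [u^2] factors out of the numerator. *)
  assert (E : hfac c d w - 1 =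
    u * u * (- (6) * (c * c * (d * d)) + 2 * (c * c + d * d) * (c * c * (d * d)) * u
       - (c * c * (d * d)) * (c * c * (d * d)) * (u * u)) /
    ((1 - c * c / (w * w)) * (1 - c * c / (w * w)) *
     ((1 - d * d / (w * w)) * (1 - d * d / (w * w))))).
  { unfold hfac.
    set (p := 1 - c * c / (w * w)) in *; set (q := 1 - d * d / (w * w)) in *.
    transitivity (((1 - (c + d) * (c + d) / (w * w)) * (1 - (c - d) * (c - d) / (w * w)) - p * p * (q * q)) / (p * p * (q * q))); [field; auto|].
    f_equal; unfold p, q, u; field; auto. }
  rewrite E; clear E.
  rewrite Cmod_div, !Cmod_mult by (repeat apply Cmult_neq_0; auto).
  set (P := Cmod (1 - c * c / (w * w))) in *; set (Q := Cmod (1 - d * d / (w * w))) in *.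
  assert (HPQ : (D <= P * P * (Q * Q))%R).
  { unfold D; apply Rmult_le_compat; try (apply Rmult_le_compat; lra); nra. }
  match goal with |- (_ * Cmod ?Z / _ <= _)%R => assert (HZ : (Cmod Z <= N)%R) end.
  { eapply Rle_trans; [apply Cmod_minus_le|]; unfold N.
    eapply Rle_trans; [apply Rplus_le_compat_r, Cmod_triangle|].
    assert (Hcd : (Cmod (c * c + d * d) <= X + Y)%R) by apply Cmod_triangle.
    rewrite (Cmod_mult (- (6))), (Cmod_mult _ u), (Cmod_mult _ (u * u)), (Cmod_mult u u), (Cmod_mult (2 * _)), (Cmod_mult 2).
    rewrite (Cmod_mult (c * c * (d * d))), (Cmod_mult (c * c) (d * d)).
    rewrite Cmod_opp, !Cmod_R, (Rabs_pos_eq 6), (Rabs_pos_eq 2) by lra; fold X Y.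
    apply Rplus_le_compat; [apply Rplus_le_compat; [lra|]|].
    - apply Rmult_le_compat; try apply Cmod_ge_0; auto.
      + repeat apply Rmult_le_pos; auto using Cmod_ge_0; lra.
      + apply Rmult_le_compat_r; auto; lra.
    - apply Rmult_le_compat_l; [apply Rmult_le_pos; auto|].
      apply Rmult_le_compat; auto. }
  match goal with |- (_ * Cmod ?Z / _ <= _)%R => set (Zm := Cmod Z) in *; assert (HZ0 : (0 <= Zm)%R) by apply Cmod_ge_0 end.
  (* Both [1 + m^2] and [1 + n^2] are at most [2 S], since [S >= 1]. *)
  assert (H4 : (/ S * / S <= 4 * (/ (1 + IZR m * IZR m) * / (1 + IZR n * IZR n)))%R).
  { rewrite <- !Rinv_mult.
    assert (0 < (1 + IZR m * IZR m) * (1 + IZR n * IZR n))%R by (apply Rmult_lt_0_compat; nra).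
    apply (Rmult_le_reg_r (S * S * ((1 + IZR m * IZR m) * (1 + IZR n * IZR n)))); [apply Rmult_lt_0_compat; nra|].
    replace (/ (S * S) * (S * S * ((1 + IZR m * IZR m) * (1 + IZR n * IZR n))))%R with ((1 + IZR m * IZR m) * (1 + IZR n * IZR n))%R by (field; lra).
    replace (4 * / ((1 + IZR m * IZR m) * (1 + IZR n * IZR n)) * (S * S * ((1 + IZR m * IZR m) * (1 + IZR n * IZR n))))%R with (4 * (S * S))%R by (field; nra).
    unfold S in *; set (x := (IZR m * IZR m)%R) in *; set (y := (IZR n * IZR n)%R) in *.
    assert (0 <= x)%R by (unfold x; nra); assert (0 <= y)%R by (unfold y; nra). nra. }
  apply Rle_trans with ((/ k * / S) * (/ k * / S) * N / D)%R.
  - unfold Rdiv; apply Rmult_le_compat.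
    + repeat apply Rmult_le_pos; auto.
    + left; apply Rinv_0_lt_compat; nra.
    + apply Rmult_le_compat; auto; [nra|]. apply Rmult_le_compat; auto.
    + apply Rinv_le_contravar; auto.
  - replace (/ k * / S * (/ k * / S) * N / D)%R with (N * (/ k * / k) / D * (/ S * / S))%R by (field; lra).
    replace (4 * (N * (/ k * / k) / D) * (/ (1 + IZR m * IZR m) * / (1 + IZR n * IZR n)))%R
      with (N * (/ k * / k) / D * (4 * (/ (1 + IZR m * IZR m) * / (1 + IZR n * IZR n))))%R by ring.
    apply Rmult_le_compat_l; [|exact H4].
    apply Rcomplements.Rdiv_le_0_compat; [|exact HD]. apply Rmult_le_pos; [exact HN|nra].
Qed.

Lemma Cinv_nz (z : C) : z <> 0 -> / z <> 0.
Proof. intros H E; apply C1_nz; rewrite <- (Cinv_r z H), E; ring. Qed.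

Lemma Cdiv_nz (a b : C) : a <> 0 -> b <> 0 -> a / b <> 0.
Proof. intros Ha Hb; apply Cmult_neq_0; [exact Ha|now apply Cinv_nz]. Qed.

(* All lattice points [+-m t +- n] up to sign, indexed by [m, n >= 0]. *)
Definition cell (t c d : C) (m n : nat) : C :=
  match m, n with
  | O, O => 1
  | O, S _ => hfac c d (INR n)
  | S _, O => hfac c d (INR m * t)
  | S _, S _ => hfac c d (INR m * t + INR n) * hfac c d (INR m * t - INR n)
  end.

Lemma cell_bound (t c d : C) : (0 < Im t)%R -> half_period t c -> half_period t d ->
  exists K, (0 <= K)%R /\ forall m n, (Cmod (cell t c d m n - 1) <= K * inv1sqr m * inv1sqr n)%R.
Proof.
  intros Ht Hc Hd; destruct (hfac_bound t c d Ht Hc Hd) as [K [HK H]].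
  assert (HKK : (0 <= K * K)%R) by nra.
  exists (2 * K + K * K)%R; split; [lra|]; intros m n.
  pose proof (inv1sqr_pos m) as Hm; pose proof (inv1sqr_pos n) as Hn.
  set (p := (inv1sqr m * inv1sqr n)%R).
  assert (Hp : (0 < p <= 1)%R) by (unfold p; nra).
  assert (Hpos : forall m' n' : Z, m' <> 0%Z \/ n' <> 0%Z -> (m' = Z.of_nat m \/ m' = - Z.of_nat m)%Z ->
     (n' = Z.of_nat n \/ n' = - Z.of_nat n)%Z -> (Cmod (hfac c d (IZR m' * t + IZR n') - 1) <= K * p)%R).
  { intros m' n' Hmn Hm' Hn'; eapply Rle_trans; [apply H; exact Hmn|]; right.
    unfold p, inv1sqr; rewrite !INR_IZR_INZ, <- !mult_IZR.
    replace (m' * m')%Z with (Z.of_nat m * Z.of_nat m)%Z by (destruct Hm' as [->| ->]; ring).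
    replace (n' * n')%Z with (Z.of_nat n * Z.of_nat n)%Z by (destruct Hn' as [->| ->]; ring).
    reflexivity. }
  rewrite Rmult_assoc; fold p.
  assert (HKp : (0 <= K * p)%R) by nra.
  assert (HKKp : (0 <= K * K * p)%R) by nra.
  destruct m as [|m], n as [|n]; unfold cell.
  - replace (1 - 1) with (RtoC 0) by ring; rewrite Cmod_0; nra.
  - replace (RtoC (INR (S n))) with (RtoC (IZR 0) * t + RtoC (IZR (Z.of_nat (S n)))) by (rewrite <- INR_IZR_INZ; ring).
    eapply Rle_trans; [apply Hpos; lia|]; lra.
  - replace (INR (S m) * t) with (RtoC (IZR (Z.of_nat (S m))) * t + RtoC (IZR 0)) by (rewrite <- INR_IZR_INZ; ring).
    eapply Rle_trans; [apply Hpos; lia|]; lra.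
  - pose proof (Hpos (Z.of_nat (S m)) (Z.of_nat (S n)) ltac:(lia) ltac:(lia) ltac:(lia)) as H1.
    pose proof (Hpos (Z.of_nat (S m)) (- Z.of_nat (S n))%Z ltac:(lia) ltac:(lia) ltac:(lia)) as H2.
    rewrite opp_IZR in H2; rewrite <- !INR_IZR_INZ, RtoC_opp in H2; rewrite <- !INR_IZR_INZ in H1.
    change (INR (S m) * t + - INR (S n)) with (INR (S m) * t - INR (S n)) in H2.
    set (a := hfac c d _) in *; set (b := hfac c d (_ - _)) in *.
    replace (a * b - 1) with ((a - 1) * (b - 1) + ((a - 1) + (b - 1))) by ring.
    eapply Rle_trans; [apply Cmod_triangle|]; rewrite Cmod_mult.
    pose proof (Cmod_triangle (a - 1) (b - 1)).
    pose proof (Cmod_ge_0 (a - 1)); pose proof (Cmod_ge_0 (b - 1)).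
    assert (Cmod (a - 1) * Cmod (b - 1) <= (K * p) * (K * p))%R by (apply Rmult_le_compat; auto).
    assert ((K * p) * (K * p) <= K * K * p)%R.
    { replace ((K * p) * (K * p))%R with (K * K * (p * p))%R by ring; apply Rmult_le_compat_l; nra. }
    lra.
Qed.

(** Dividing by [t] maps the lattice of [t] onto that of [-1/t] and exchanges the two coordinates up
    to sign. The factor [hfac] is homogeneous of degree 0 and even, so nothing else changes. *)
Lemma cell_S_transform (t c d : C) (m n : nat) : (0 < Im t)%R ->
  cell (- (1) / t) (c / t) (d / t) n m = cell t c d m n.
Proof.
  intros Ht.
  assert (Ht0 : t <> 0) by (intros ->; simpl in Ht; lra).
  assert (Hnz : forall x y : R, x <> 0%R \/ y <> 0%R -> x * t + y <> 0).
  { intros x y Hxy E. pose proof (lattice_lower t x y) as H; rewrite E, Cmod_0 in H.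
    pose proof (sum_sqr_lower_pos t Ht).
    assert (0 < x * x + y * y)%R.
    { destruct Hxy as [Hx|Hx]; apply Rsqr_pos_lt in Hx; unfold Rsqr in Hx; nra. }
    assert (0 < sum_sqr_lower t * (x * x + y * y))%R by (apply Rmult_lt_0_compat; auto). lra. }
  destruct m as [|m], n as [|n]; unfold cell; [reflexivity| | |].
  - pose proof (not_0_INR (S n) ltac:(lia)).
    rewrite <- (hfac_opp c d), <- (hfac_scale c d _ t); [apply (f_equal (hfac (c / t) (d / t))); field; auto| |auto].
    replace (- INR (S n)) with (RtoC 0 * t + RtoC (- INR (S n))) by (rewrite RtoC_opp; ring).
    apply Hnz; right; lra.
  - pose proof (not_0_INR (S m) ltac:(lia)).
    rewrite <- (hfac_scale c d _ t); [apply (f_equal (hfac (c / t) (d / t))); field; auto| |auto].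
    apply Cmult_neq_0; auto; apply RtoC_neq_0; auto.
  - pose proof (not_0_INR (S m) ltac:(lia)); pose proof (not_0_INR (S n) ltac:(lia)).
    rewrite <- (hfac_opp c d (_ + _)), <- (hfac_scale c d (- _) t), <- (hfac_scale c d (INR (S m) * t - _) t), Cmult_comm; auto.
    + f_equal; apply (f_equal (hfac (c / t) (d / t))); field; auto.
    + replace (_ - _) with (INR (S m) * t + RtoC (- INR (S n))) by (rewrite RtoC_opp; ring); apply Hnz; auto.
    + replace (- _) with (RtoC (- INR (S m)) * t + RtoC (- INR (S n))) by (rewrite !RtoC_opp; ring); apply Hnz; left; lra.
Qed.

(** * Evaluation of the rows of the lattice product *)

Definition sin_partial (v : C) (N : nat) : C :=
  v * Cprod (fun j => 1 - v * v / (INR (S j) * INR (S j))) N.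

Lemma sin_partial_Ccv (v : C) : Ccv (fun N => PI * sin_partial v N) (sinpi v).
Proof.
  eapply Ccv_ext; [|apply (sin_product v)]; intros n; unfold sin_partial; cbv beta; ring.
Qed.

Definition row_partial (z w : C) (N : nat) : C :=
  (1 - z * z / (w * w)) *
  Cprod (fun j => (1 - z * z / ((w + INR (S j)) * (w + INR (S j)))) *
                  (1 - z * z / ((w - INR (S j)) * (w - INR (S j))))) N.

Lemma Im_neq_0_C (z : C) : Im z <> 0%R -> z <> 0.
Proof. intros H E; apply H; now rewrite E. Qed.

(** The factors at [w + j] and [w - j] combine into a quotient of the [j]-th factors of the sine
    products at [w - z], [w + z] and [w]; Euler's product then evaluates the row. *)
Lemma row_partial_Ccv (z w : C) : (0 < Im w)%R ->
  Ccv (row_partial z w) (theta_row (nome w) (nome z)).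
Proof.
  intros Hw.
  assert (Hw0 : w <> 0) by (apply Im_neq_0_C; lra).
  assert (Hpl : forall x : R, w + x <> 0) by (intros x; apply Im_neq_0_C; destruct w; simpl in *; lra).
  assert (Hmi : forall x : R, w - x <> 0) by (intros x; apply Im_neq_0_C; destruct w; simpl in *; lra).
  assert (HPI : RtoC PI <> 0) by (apply RtoC_neq_0; pose proof PI_RGT_0; lra).
  assert (Hj : forall j, RtoC (INR (S j)) <> 0) by (intros j; apply RtoC_neq_0, not_0_INR; lia).
  assert (Hf : forall j, 1 - w * w / (INR (S j) * INR (S j)) <> 0).
  { intros j; specialize (Hj j); specialize (Hpl (INR (S j))); specialize (Hmi (INR (S j))).
    replace (1 - w * w / (INR (S j) * INR (S j))) with (- ((w + INR (S j)) * (w - INR (S j))) / (INR (S j) * INR (S j))) by (field; auto).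
    unfold Cdiv; apply Cmult_neq_0; [|apply Cinv_nz, Cmult_neq_0; auto].
    intros E; apply (Cmult_neq_0 _ _ Hpl Hmi).
    replace ((w + INR (S j)) * (w - INR (S j))) with (- - ((w + INR (S j)) * (w - INR (S j)))) by ring; rewrite E; ring. }
  assert (HF : forall N, sin_partial w N <> 0).
  { intros N; unfold sin_partial; apply Cmult_neq_0; auto; apply Cprod_neq_0; auto. }
  pose proof (nome_neq_1 w Hw) as Hn1.
  pose proof (sinpi_neq_0 w Hn1) as Hs.
  rewrite <- sinpi_ratio by exact Hn1.
  apply (Ccv_ext (fun N => (PI * sin_partial (w - z) N) * (PI * sin_partial (w + z) N) /
     ((PI * sin_partial w N) * (PI * sin_partial w N)))).
  - intros N; specialize (HF N).
    transitivity (sin_partial (w - z) N * sin_partial (w + z) N / (sin_partial w N * sin_partial w N)); [field; auto|].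
    unfold sin_partial, row_partial.
    rewrite (Cprod_ext (fun j => (1 - z * z / ((w + INR (S j)) * (w + INR (S j)))) * _)
      (fun j => (1 - (w - z) * (w - z) / (INR (S j) * INR (S j))) * (1 - (w + z) * (w + z) / (INR (S j) * INR (S j)))
        / ((1 - w * w / (INR (S j) * INR (S j))) * (1 - w * w / (INR (S j) * INR (S j)))))).
    + rewrite Cprod_div, !Cprod_mult by (intros; apply Cmult_neq_0; auto).
      unfold sin_partial in HF.
      assert (Cprod (fun j => 1 - w * w / (INR (S j) * INR (S j))) N <> 0) by (apply Cprod_neq_0; auto).
      set (A := Cprod _ N) in *.
      field; auto.
    + intros j _; specialize (Hj j); specialize (Hpl (INR (S j))); specialize (Hmi (INR (S j))); specialize (Hf j).
      set (n := RtoC (INR (S j))) in *.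
      assert (n * n - w * w <> 0).
      { replace (n * n - w * w) with ((1 - w * w / (n * n)) * (n * n)) by (field; auto).
        repeat apply Cmult_neq_0; auto. }
      field; repeat split; auto.
  - apply Ccv_div; [apply Cmult_neq_0; auto|apply Ccv_mult; apply sin_partial_Ccv|apply Ccv_mult; apply sin_partial_Ccv].
Qed.

Lemma hfac_den_neq_0 (t z : C) (m n : Z) : (0 < Im t)%R -> half_period t z ->
  m <> 0%Z \/ n <> 0%Z ->
  1 - z * z / ((IZR m * t + IZR n) * (IZR m * t + IZR n)) <> 0.
Proof.
  intros Ht Hz Hmn; destruct (half_period_avoid t z Ht Hz) as [del [Hd H]].
  apply Cmod_gt_0; specialize (H m n Hmn); lra.
Qed.

Definition psi_row (X xs xd xc xe : C) : C :=
  theta_row X xs * theta_row X xd / (theta_row X xc * theta_row X xc * (theta_row X xe * theta_row X xe)).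

Lemma theta_row_neq_0 (X x : C) : X <> 1 -> x <> 0 -> X * x <> 1 -> X <> x -> theta_row X x <> 0.
Proof.
  intros H1 H0 H2 H3; unfold theta_row, Cdiv; repeat apply Cmult_neq_0; try apply Cminus_neq_0; auto.
  - intros E; apply H3; replace X with (X * / x * x) by (field; auto); rewrite <- E; ring.
  - apply Cinv_nz, Cmult_neq_0; apply Cminus_neq_0; auto.
Qed.

Lemma half_period_Im (t z : C) : (0 < Im t)%R -> half_period t z -> (Rabs (Im z) <= Im t / 2)%R.
Proof.
  intros Ht [r [s [-> [Hr _]]]]; destruct t as [a b]; simpl in *.
  replace (r * b + 0 * a + 0)%R with (r * b)%R by ring.
  apply Rabs_le; destruct Hr as [->|[->| ->]]; lra.
Qed.

Lemma theta_row_half_period_neq_0 (t z : C) (m : nat) : (0 < Im t)%R -> half_period t z ->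
  theta_row (nome (INR (S m) * t)) (nome z) <> 0.
Proof.
  intros Ht Hz.
  pose proof (half_period_Im t z Ht Hz) as Hi; apply Rabs_le_between in Hi.
  pose proof (pos_INR m) as Hm.
  assert (HmI : Im (INR (S m) * t) = (INR (S m) * Im t)%R) by (destruct t; simpl; ring).
  rewrite S_INR in HmI.
  assert (HI : (Im t <= Im (INR (S m) * t))%R) by (rewrite S_INR, HmI; nra).
  apply theta_row_neq_0; [apply nome_neq_1; lra|apply nome_neq_0| |].
  - rewrite <- nome_plus; apply nome_neq_1; destruct z, (INR (S m) * t); simpl in *; lra.
  - intros E; apply (nome_neq_1 (INR (S m) * t - z)).
    + destruct z, (INR (S m) * t); simpl in *; lra.
    + unfold Cminus; rewrite nome_plus, nome_opp, E; field; apply nome_neq_0.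
Qed.

Lemma cell_row_Ccv (t c d : C) (m : nat) : (0 < Im t)%R -> half_period t c -> half_period t d ->
  Ccv (fun N => Cprod (cell t c d (S m)) N)
    (psi_row (nome (INR (S m) * t)) (nome (c + d)) (nome (c - d)) (nome c) (nome d)).
Proof.
  intros Ht Hc Hd; apply (Ccv_eventually _ _ 1).
  set (w := INR (S m) * t).
  assert (Hw : (0 < Im w)%R).
  { unfold w; replace (Im (INR (S m) * t)) with (INR (S m) * Im t)%R by (destruct t; simpl; ring).
    apply Rmult_lt_0_compat; [apply lt_0_INR; lia|exact Ht]. }
  assert (Hden : forall z, half_period t z ->
    1 - z * z / (w * w) <> 0 /\
    (forall j, 1 - z * z / ((w + INR (S j)) * (w + INR (S j))) <> 0) /\
    (forall j, 1 - z * z / ((w - INR (S j)) * (w - INR (S j))) <> 0)).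
  { intros z Hz; split; [|split; intros j].
    - replace w with (IZR (Z.of_nat (S m)) * t + IZR 0) by (unfold w; rewrite <- INR_IZR_INZ; ring).
      apply hfac_den_neq_0; auto; left; lia.
    - replace (w + INR (S j)) with (IZR (Z.of_nat (S m)) * t + IZR (Z.of_nat (S j))) by (unfold w; rewrite <- !INR_IZR_INZ; ring).
      apply hfac_den_neq_0; auto; left; lia.
    - replace (w - INR (S j)) with (IZR (Z.of_nat (S m)) * t + IZR (- Z.of_nat (S j))) by (unfold w; rewrite opp_IZR, <- !INR_IZR_INZ, RtoC_opp; ring).
      apply hfac_den_neq_0; auto; left; lia. }
  destruct (Hden c Hc) as [Hc1 [Hc2 Hc3]]; destruct (Hden d Hd) as [Hd1 [Hd2 Hd3]].
  apply (Ccv_ext (fun N => row_partial (c + d) w N * row_partial (c - d) w N /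
     (row_partial c w N * row_partial c w N * (row_partial d w N * row_partial d w N)))).
  - intros N; rewrite Nat.add_1_r, Cprod_shift.
    change (cell t c d (S m) 0) with (hfac c d w).
    rewrite (Cprod_ext (fun i => cell t c d (S m) (S i))
      (fun j => ((1 - (c + d) * (c + d) / ((w + INR (S j)) * (w + INR (S j)))) * (1 - (c + d) * (c + d) / ((w - INR (S j)) * (w - INR (S j))))) *
         ((1 - (c - d) * (c - d) / ((w + INR (S j)) * (w + INR (S j)))) * (1 - (c - d) * (c - d) / ((w - INR (S j)) * (w - INR (S j))))) /
         (((1 - c * c / ((w + INR (S j)) * (w + INR (S j)))) * (1 - c * c / ((w - INR (S j)) * (w - INR (S j))))) *
         ((1 - c * c / ((w + INR (S j)) * (w + INR (S j)))) * (1 - c * c / ((w - INR (S j)) * (w - INR (S j))))) *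
         (((1 - d * d / ((w + INR (S j)) * (w + INR (S j)))) * (1 - d * d / ((w - INR (S j)) * (w - INR (S j))))) *
         ((1 - d * d / ((w + INR (S j)) * (w + INR (S j)))) * (1 - d * d / ((w - INR (S j)) * (w - INR (S j))))))))).
    + rewrite Cprod_div by (intros; repeat apply Cmult_neq_0; auto).
      rewrite (Cprod_mult (fun j => _ * _) (fun j => (1 - (c - d) * (c - d) / ((w + INR (S j)) * (w + INR (S j)))) * _)).
      rewrite (Cprod_mult (fun j => _ * _ * (_ * _)) (fun j => _ * _ * (_ * _))).
      rewrite (Cprod_mult (fun j => (1 - c * c / ((w + INR (S j)) * (w + INR (S j)))) * _) (fun j => (1 - c * c / ((w + INR (S j)) * (w + INR (S j)))) * _)).
      rewrite (Cprod_mult (fun j => (1 - d * d / ((w + INR (S j)) * (w + INR (S j)))) * _) (fun j => (1 - d * d / ((w + INR (S j)) * (w + INR (S j)))) * _)).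
      assert (HC : Cprod (fun j => (1 - c * c / ((w + INR (S j)) * (w + INR (S j)))) * (1 - c * c / ((w - INR (S j)) * (w - INR (S j))))) N <> 0)
        by (apply Cprod_neq_0; intros; apply Cmult_neq_0; auto).
      assert (HD : Cprod (fun j => (1 - d * d / ((w + INR (S j)) * (w + INR (S j)))) * (1 - d * d / ((w - INR (S j)) * (w - INR (S j))))) N <> 0)
        by (apply Cprod_neq_0; intros; apply Cmult_neq_0; auto).
      unfold row_partial, hfac.
      set (PC := Cprod (fun j => (1 - c * c / _) * _) N) in *.
      set (PD := Cprod (fun j => (1 - d * d / _) * _) N) in *.
      set (PA := Cprod (fun j => (1 - (c + d) * (c + d) / _) * _) N) in *.
      set (PB := Cprod (fun j => (1 - (c - d) * (c - d) / _) * _) N) in *.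
      set (a1 := 1 - c * c / (w * w)) in *; set (a2 := 1 - d * d / (w * w)) in *.
      set (a3 := 1 - (c + d) * (c + d) / (w * w)) in *; set (a4 := 1 - (c - d) * (c - d) / (w * w)) in *.
      field; auto.
    + intros j _; unfold cell, hfac; fold w.
      specialize (Hc2 j); specialize (Hc3 j); specialize (Hd2 j); specialize (Hd3 j).
      set (b1 := 1 - c * c / ((w + _) * _)) in *; set (b2 := 1 - c * c / ((w - _) * _)) in *.
      set (b3 := 1 - d * d / ((w + _) * _)) in *; set (b4 := 1 - d * d / ((w - _) * _)) in *.
      set (b5 := 1 - (c + d) * (c + d) / ((w + _) * _)); set (b6 := 1 - (c + d) * (c + d) / ((w - _) * _)).
      set (b7 := 1 - (c - d) * (c - d) / ((w + _) * _)); set (b8 := 1 - (c - d) * (c - d) / ((w - _) * _)).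
      field; auto.
  - unfold psi_row; apply Ccv_div.
    + apply Cmult_neq_0; apply Cmult_neq_0; apply theta_row_half_period_neq_0; auto.
    + apply Ccv_mult; apply row_partial_Ccv; auto.
    + apply Ccv_mult; apply Ccv_mult; apply row_partial_Ccv; auto.
Qed.

Definition psi0 (c d : C) : C :=
  sinpi (c + d) * sinpi (c - d) / (sinpi c * sinpi c * (sinpi d * sinpi d)).

(** The row through the origin omits the point 0, so every sine product loses its leading factor
    [PI z]. What remains is the algebraic prefactor in [c] and [d], from which the weight will
    come. *)
Lemma cell_row0_Ccv (t c d : C) : (0 < Im t)%R -> half_period t c -> half_period t d ->
  c <> 0 -> d <> 0 -> c + d <> 0 -> c - d <> 0 -> nome c <> 1 -> nome d <> 1 ->
  Ccv (fun N => Cprod (cell t c d 0) N)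
    (PI * PI * (c * c * (d * d)) / ((c + d) * (c - d)) * psi0 c d).
Proof.
  intros Ht Hc Hd Hc0 Hd0 Hs0 Hm0 Hnc Hnd; apply (Ccv_eventually _ _ 1).
  assert (HPI : RtoC PI <> 0) by (apply RtoC_neq_0; pose proof PI_RGT_0; lra).
  set (g := fun z N => Cprod (fun j => 1 - z * z / (INR (S j) * INR (S j))) N).
  assert (Hg : forall z : C, z <> 0 -> Ccv (g z) (sinpi z / (PI * z))).
  { intros z Hz.
    apply (Ccv_ext (fun N => PI * sin_partial z N / (PI * z))).
    - intros N; unfold sin_partial, g; field; auto.
    - apply Ccv_div; [apply Cmult_neq_0; auto|apply sin_partial_Ccv|apply Ccv_const]. }
  assert (Hden : forall z, half_period t z -> forall j, 1 - z * z / (INR (S j) * INR (S j)) <> 0).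
  { intros z Hz j.
    replace (RtoC (INR (S j))) with (IZR 0 * t + IZR (Z.of_nat (S j))) by (rewrite <- !INR_IZR_INZ; ring).
    apply hfac_den_neq_0; auto; right; lia. }
  pose proof (sinpi_neq_0 c Hnc) as Hsc; pose proof (sinpi_neq_0 d Hnd) as Hsd.
  apply (Ccv_ext (fun N => g (c + d) N * g (c - d) N / (g c N * g c N * (g d N * g d N)))).
  - intros N; rewrite Nat.add_1_r, Cprod_shift; change (cell t c d 0 0) with (RtoC 1).
    unfold g; rewrite <- !Cprod_mult, <- Cprod_div.
    + rewrite Cmult_1_l; apply Cprod_ext; intros j _; reflexivity.
    + intros j _; repeat apply Cmult_neq_0; auto.
  - apply (Ccv_eq _ (sinpi (c + d) / (PI * (c + d)) * (sinpi (c - d) / (PI * (c - d))) /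
      (sinpi c / (PI * c) * (sinpi c / (PI * c)) * (sinpi d / (PI * d) * (sinpi d / (PI * d)))))).
    + unfold psi0; field; repeat split; auto.
    + apply Ccv_div.
      * apply Cmult_neq_0; apply Cmult_neq_0; apply Cdiv_nz; auto using Cmult_neq_0.
      * apply Ccv_mult; auto.
      * apply Ccv_mult; apply Ccv_mult; auto.
Qed.

Lemma half_period_S (t z : C) : t <> 0 -> half_period t z -> half_period (- (1) / t) (z / t).
Proof.
  intros Ht [r [s [-> [Hr Hs]]]]; exists (- s)%R, r; split; [|split; [|exact Hr]].
  - rewrite RtoC_opp; field; auto.
  - destruct Hs as [->|[->| ->]]; [left|right; right|right; left]; lra.
Qed.

Lemma Im_S (t : C) : (0 < Im t)%R -> (0 < Im (- (1) / t))%R.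
Proof.
  intros H; destruct t as [a b]; simpl in *.
  assert (Hp : (0 < a * (a * 1) + b * (b * 1))%R) by nra.
  match goal with |- (0 < ?E)%R => replace E with (b / (a * (a * 1) + b * (b * 1)))%R by (field; lra) end.
  apply Rdiv_lt_0_compat; auto.
Qed.

Lemma upper_neq_0 (t : C) : (0 < Im t)%R -> t <> 0.
Proof. intros H; apply Im_neq_0_C; lra. Qed.

Definition psi_rows (t c d : C) (m : nat) : C :=
  psi_row (nome (INR (S m) * t)) (nome (c + d)) (nome (c - d)) (nome c) (nome d).

(* [psi0 c d * P] is a constant times [wp(d) - wp(c)], whence the weight 2. *)
Lemma psi_S (t c d P P' : C) : (0 < Im t)%R -> half_period t c -> half_period t d ->
  c <> 0 -> d <> 0 -> c + d <> 0 -> c - d <> 0 -> nome c <> 1 -> nome d <> 1 ->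
  nome (c / t) <> 1 -> nome (d / t) <> 1 ->
  Ccv (Cprod (psi_rows t c d)) P ->
  Ccv (Cprod (psi_rows (- (1) / t) (c / t) (d / t))) P' ->
  psi0 (c / t) (d / t) * P' = t * t * (psi0 c d * P).
Proof.
  intros Ht Hc Hd Hc0 Hd0 Hs0 Hm0 Hnc Hnd Hnc' Hnd' HP HP'.
  pose proof (upper_neq_0 t Ht) as Ht0.
  pose proof (Im_S t Ht) as Ht'.
  assert (HPI : RtoC PI <> 0) by (apply RtoC_neq_0; pose proof PI_RGT_0; lra).
  assert (Hdiv : forall z : C, z <> 0 -> z / t <> 0).
  { intros z Hz; unfold Cdiv; apply Cmult_neq_0; auto; apply Cinv_nz; auto. }
  set (R0 := fun (t c d : C) m => match m with O => PI * PI * (c * c * (d * d)) / ((c + d) * (c - d)) * psi0 c d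
                                 | S k => psi_rows t c d k end).
  assert (HR : forall t c d P, Ccv (Cprod (psi_rows t c d)) P ->
    Ccv (Cprod (R0 t c d)) (PI * PI * (c * c * (d * d)) / ((c + d) * (c - d)) * psi0 c d * P)).
  { intros t0 c0 d0 P0 H; apply (Ccv_eventually _ _ 1).
    eapply Ccv_ext; [|apply Ccv_scal, H]; intros n; cbv beta; rewrite Nat.add_1_r, Cprod_shift; reflexivity. }
  destruct (cell_bound t c d Ht Hc Hd) as [K [HK Hb]].
  assert (E : PI * PI * (c * c * (d * d)) / ((c + d) * (c - d)) * psi0 c d * P =
     PI * PI * (c / t * (c / t) * (d / t * (d / t))) / ((c / t + d / t) * (c / t - d / t)) * psi0 (c / t) (d / t) * P').
  { apply (double_product_swap (cell t c d) (fun m => K * inv1sqr m)%R inv1sqr (R0 t c d) (R0 (- (1) / t) (c / t) (d / t))).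
    - apply summable_scal; auto using summable_inv1sqr.
    - apply summable_inv1sqr.
    - exact Hb.
    - intros [|m]; [apply cell_row0_Ccv|apply cell_row_Ccv]; auto.
    - intros n.
      apply (Ccv_ext (fun M => Cprod (cell (- (1) / t) (c / t) (d / t) n) M)).
      { intros M; apply Cprod_ext; intros m _; apply cell_S_transform; auto. }
      destruct n as [|n]; [apply cell_row0_Ccv|apply cell_row_Ccv]; auto using half_period_S.
      + replace (c / t + d / t) with ((c + d) / t) by (field; auto); auto.
      + replace (c / t - d / t) with ((c - d) / t) by (field; auto); auto.
    - apply HR, HP.
    - apply HR, HP'. }
  (* The prefactor is homogeneous of degree 2 in [(c, d)]: this is where [t^2] arises. *)
  replace (PI * PI * (c / t * (c / t) * (d / t * (d / t))) / ((c / t + d / t) * (c / t - d / t)))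
    with (PI * PI * (c * c * (d * d)) / ((c + d) * (c - d)) / (t * t)) in E.
  2:{ field; repeat split; auto. }
  set (k := PI * PI * (c * c * (d * d)) / ((c + d) * (c - d))) in *.
  assert (Hk : k <> 0).
  { unfold k, Cdiv; repeat apply Cmult_neq_0; auto; apply Cinv_nz, Cmult_neq_0; auto. }
  replace (t * t * (psi0 c d * P)) with (t * t * (/ k) * (k * psi0 c d * P)) by (field; auto).
  rewrite E; field; auto.
Qed.

Lemma psi0_nome (c d : C) : nome c <> 1 -> nome d <> 1 ->
  psi0 c d = - (4) * ((nome c * nome d - 1) * (nome c - nome d)) /
    ((nome c - 1) * (nome c - 1) * ((nome d - 1) * (nome d - 1))).
Proof.
  intros Hc Hd; unfold psi0; rewrite !sinpi_sroot.
  unfold Cminus; rewrite !sroot_plus, !sroot_opp, <- !sroot_sqr.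
  rewrite <- sroot_sqr in Hc, Hd.
  pose proof (sroot_neq_0 c); pose proof (sroot_neq_0 d); pose proof Ci_neq_0; pose proof C2_neq_0.
  set (a := sroot c) in *; set (b := sroot d) in *.
  assert (Ha : a * a - 1 <> 0) by (apply Cminus_neq_0; auto).
  assert (Hb : b * b - 1 <> 0) by (apply Cminus_neq_0; auto).
  transitivity ((2 * 2) * (Ci * Ci) * ((a * a * (b * b) - 1) * (a * a - b * b)) /
    ((a * a - 1) * (a * a - 1) * ((b * b - 1) * (b * b - 1)))).
  - field; repeat split; auto.
  - rewrite Ci_sqr; field; repeat split; auto.
    + intros E; apply Hb; rewrite <- E; ring.
    + intros E; apply Ha; rewrite <- E; ring.
Qed.

(** * Infinite products in the nome and theta values at half periods *)

Lemma Rsum_geom (r : R) (n : nat) : (0 <= r < 1)%R -> (Rsum (fun i => r ^ i)%R n <= / (1 - r))%R.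
Proof.
  intros Hr.
  assert (E : ((1 - r) * Rsum (fun i => r ^ i)%R n = 1 - r ^ n)%R).
  { induction n as [|n IH]; simpl; [ring|rewrite Rmult_plus_distr_l, IH; ring]. }
  pose proof (pow_le r n ltac:(lra)).
  apply (Rmult_le_reg_l (1 - r)); [lra|]; rewrite E, Rinv_r by lra; lra.
Qed.

Lemma summable_geom (r : R) : (0 <= r < 1)%R -> summable (fun i => r ^ i)%R.
Proof.
  intros Hr; split; [intros; apply pow_le; lra|]; exists (/ (1 - r))%R; intros n; now apply Rsum_geom.
Qed.

(** The product of the inverse factors converges as well, and the two limits multiply to 1. *)
Lemma Cprod_limit_neq_0 (u : nat -> C) (a : nat -> R) (r : R) : (r < 1)%R ->
  summable a -> (forall i, (Cmod (u i) <= a i)%R) -> (forall i, (Cmod (u i) <= r)%R) ->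
  exists l : C, l <> 0 /\ Ccv (Cprod (fun i => 1 + u i)) l.
Proof.
  intros Hr Ha Hu Hur.
  assert (Hnz : forall i, 1 + u i <> 0).
  { intros i E; specialize (Hur i).
    assert (Hm : Cmod (u i) = 1%R); [|lra].
    replace (u i) with ((1 + u i) - 1) by ring; rewrite E.
    replace (0 - 1) with (- (1)) by ring; apply Cmod_m1. }
  destruct (Cprod_Ccv (fun i => 1 + u i) a Ha) as [l Hl].
  { intros i; replace (1 + u i - 1) with (u i) by ring; auto. }
  destruct (Cprod_Ccv (fun i => / (1 + u i)) (fun i => / (1 - r) * a i)%R) as [l' Hl'].
  { apply summable_scal; auto; left; apply Rinv_0_lt_compat; lra. }
  { intros i; specialize (Hnz i).
    replace (/ (1 + u i) - 1) with (- u i / (1 + u i)) by (field; auto).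
    rewrite Cmod_div, Cmod_opp by auto.
    assert (Hlow : (1 - r <= Cmod (1 + u i))%R).
    { pose proof (Cmod_le_plus 1 (1 + u i)) as H; rewrite Cmod_1 in H.
      replace (1 - (1 + u i)) with (- u i) in H by ring; rewrite Cmod_opp in H.
      specialize (Hur i); lra. }
    unfold Rdiv; rewrite Rmult_comm; apply Rmult_le_compat; auto.
    - left; apply Rinv_0_lt_compat; lra.
    - apply Cmod_ge_0.
    - apply Rinv_le_contravar; lra. }
  exists l; split; [|exact Hl].
  intros E; apply C1_nz.
  apply (Ccv_unique (fun _ => 1)); [apply Ccv_const|].
  apply (Ccv_eq _ (l * l')); [rewrite E; ring|].
  eapply Ccv_ext; [|apply Ccv_mult; [exact Hl|exact Hl']].
  intros n; cbv beta; rewrite <- Cprod_mult.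
  induction n as [|n IH]; simpl; [reflexivity|rewrite IH; field; auto].
Qed.

Lemma qprod_exists (x s : C) (f : nat -> nat) : (Cmod x < 1)%R -> (Cmod s <= 1)%R ->
  (forall i, (i < f i)%nat) ->
  exists l : C, l <> 0 /\ Ccv (Cprod (fun i => 1 + s * x ^ f i)) l.
Proof.
  intros Hx Hs Hf; pose proof (Cmod_ge_0 x) as Hx0; pose proof (Cmod_ge_0 s) as Hs0.
  assert (Hpow : forall i, (Cmod (s * x ^ f i) <= Cmod x * Cmod x ^ i)%R).
  { intros i; rewrite Cmod_mult, Cmod_pow.
    assert (Hle : (Cmod x ^ f i <= Cmod x * Cmod x ^ i)%R).
    { replace (f i) with (S i + (f i - S i))%nat by (specialize (Hf i); lia).
      rewrite pow_add; simpl.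
      rewrite <- (Rmult_1_r (Cmod x * Cmod x ^ i)) at 2.
      apply Rmult_le_compat_l; [apply Rmult_le_pos; auto; apply pow_le; auto|].
      rewrite <- (pow1 (f i - S i)); apply pow_incr; lra. }
    pose proof (pow_le _ (f i) Hx0); nra. }
  apply (Cprod_limit_neq_0 _ (fun i => Cmod x * Cmod x ^ i)%R (Cmod x)); auto.
  - apply summable_scal; auto; apply summable_geom; lra.
  - intros i; eapply Rle_trans; [apply Hpow|].
    assert (Cmod x ^ i <= 1)%R by (rewrite <- (pow1 i); apply pow_incr; lra).
    pose proof (pow_le _ i Hx0); nra.
Qed.

Definition eulerP (q : C) (e : C) : Prop := Ccv (Cprod (fun i => 1 - q ^ S i)) e.

Lemma eulerP_exists (q : C) : (Cmod q < 1)%R -> exists e : C, e <> 0 /\ eulerP q e.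
Proof.
  intros Hq; destruct (qprod_exists q (- (1)) S Hq) as [l [Hl H]]; auto.
  - rewrite Cmod_m1; lra.
  - exists l; split; auto; eapply Ccv_ext; [|exact H]; intros n; apply Cprod_ext; intros; ring.
Qed.

(* The four classical products: [E = prod (1 - q^n)], [B = prod (1 + q^n)],
   [P = prod (1 + Q^(2n-1))], [M = prod (1 - Q^(2n-1))], with [q = Q^2]. *)
Definition four_products (Q E B P M : C) : Prop :=
  eulerP (Q * Q) E /\
  Ccv (Cprod (fun i => 1 + (Q * Q) ^ S i)) B /\
  Ccv (Cprod (fun i => 1 + Q ^ S (2 * i))) P /\
  Ccv (Cprod (fun i => 1 - Q ^ S (2 * i))) M /\
  E <> 0 /\ B <> 0 /\ P <> 0 /\ M <> 0 /\ B * P * M = 1.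

Lemma four_products_exist (Q : C) : (Cmod Q < 1)%R -> exists E B P M, four_products Q E B P M.
Proof.
  intros HQ; pose proof (Cmod_ge_0 Q).
  assert (Hq : (Cmod (Q * Q) < 1)%R) by (rewrite Cmod_mult; nra).
  destruct (eulerP_exists _ Hq) as [E [HE0 HE]].
  destruct (qprod_exists (Q * Q) 1 S Hq) as [B [HB0 HB]]; auto.
  { rewrite Cmod_1; lra. }
  destruct (qprod_exists Q 1 (fun i => S (2 * i)) HQ) as [P [HP0 HP]]; auto.
  { rewrite Cmod_1; lra. }
  { intros i; lia. }
  destruct (qprod_exists Q (- (1)) (fun i => S (2 * i)) HQ) as [M [HM0 HM]]; auto.
  { rewrite Cmod_m1; lra. }
  { intros i; lia. }
  assert (HB' : Ccv (Cprod (fun i => 1 + (Q * Q) ^ S i)) B).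
  { eapply Ccv_ext; [|exact HB]; intros n; apply Cprod_ext; intros; ring. }
  assert (HP' : Ccv (Cprod (fun i => 1 + Q ^ S (2 * i))) P).
  { eapply Ccv_ext; [|exact HP]; intros n; apply Cprod_ext; intros; ring. }
  assert (HM' : Ccv (Cprod (fun i => 1 - Q ^ S (2 * i))) M).
  { eapply Ccv_ext; [|exact HM]; intros n; apply Cprod_ext; intros; ring. }
  exists E, B, P, M; repeat split; auto.
  (* Euler's identity: multiplying the [n]-th factors of the four products gives
     [(1 - q^(2n-1)) (1 - q^(2n))], so the first [N] factors of all four make up the first [2 N]
     factors of [E]. *)
  assert (Hlim : B * P * M * E = E).
  { apply (Ccv_unique (fun n => Cprod (fun i => 1 - (Q * Q) ^ S i) (2 * n))).
    - eapply Ccv_ext; [|apply Ccv_mult; [apply Ccv_mult; [apply Ccv_mult; [exact HB'|exact HP']|exact HM']|exact HE]].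
      intros n; cbv beta; rewrite <- !Cprod_mult; induction n as [|n IH]; [reflexivity|].
      replace (2 * S n)%nat with (S (S (2 * n))) by lia; cbn [Cprod]; rewrite IH.
      replace ((Q * Q) ^ S (2 * n)) with (Q ^ S (2 * n) * Q ^ S (2 * n)) by (rewrite <- Cpow_mult_l; reflexivity).
      replace ((Q * Q) ^ S (S (2 * n))) with ((Q * Q) ^ S n * (Q * Q) ^ S n) by (rewrite <- Cpow_add_r; f_equal; lia).
      ring.
    - apply (Ccv_subseq (Cprod (fun i => 1 - (Q * Q) ^ S i)) (fun n => 2 * n)%nat); [intros; lia|exact HE]. }
  replace (B * P * M) with (B * P * M * E / E) by (field; auto); rewrite Hlim; field; auto.
Qed.

Definition theta_limit (q x L : C) : Prop := Ccv (Cprod (fun m => theta_row (q ^ S m) x)) L.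

Lemma theta_limit_inv (q x L : C) : x <> 0 -> theta_limit q x L -> theta_limit q (/ x) L.
Proof.
  intros Hx H; eapply Ccv_ext; [|exact H]; intros n; apply Cprod_ext; intros m _; unfold theta_row.
  replace (q ^ S m / / x) with (q ^ S m * x) by (field; auto).
  change (q ^ S m / x) with (q ^ S m * / x); unfold Cdiv; ring.
Qed.

Lemma pow_lt_1_neq (q : C) (n : nat) : (Cmod q < 1)%R -> 1 - q ^ S n <> 0.
Proof.
  intros Hq; apply Cminus_neq_0, Cmod_neq; rewrite Cmod_1, Cmod_pow.
  pose proof (Cmod_ge_0 q).
  assert (Cmod q ^ n <= 1)%R by (rewrite <- (pow1 n); apply pow_incr; lra).
  pose proof (pow_le _ n H); simpl; nra.
Qed.

Lemma theta_limit_of (q x L1 L2 E : C) : (Cmod q < 1)%R -> eulerP q E -> E <> 0 ->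
  Ccv (Cprod (fun m => 1 - q ^ S m * x)) L1 -> Ccv (Cprod (fun m => 1 - q ^ S m / x)) L2 ->
  theta_limit q x (L1 * L2 / (E * E)).
Proof.
  intros Hq HE HE0 H1 H2.
  eapply Ccv_ext; [|apply Ccv_div; [|apply Ccv_mult; [exact H1|exact H2]|apply Ccv_mult; [exact HE|exact HE]]].
  - intros n; cbv beta; rewrite <- !Cprod_mult, <- Cprod_div; [reflexivity|].
    intros; apply Cmult_neq_0; apply pow_lt_1_neq; auto.
  - now apply Cmult_neq_0.
Qed.

Lemma Ccv_tail (f : nat -> C) (l : C) : f 0%nat <> 0 -> Ccv (Cprod f) l ->
  Ccv (Cprod (fun i => f (S i))) (l / f 0%nat).
Proof.
  intros H0 H.
  apply (Ccv_ext (fun n => Cprod f (S n) / f 0%nat)).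
  - intros n; rewrite Cprod_shift; field; auto.
  - apply Ccv_div; auto using Ccv_const; apply (Ccv_subseq _ S); auto.
Qed.

Section ThetaValues.

Context (Q E B P M : C) (HQ : (Cmod Q < 1)%R) (HQ0 : Q <> 0) (H4 : four_products Q E B P M).

Lemma Qsqr_lt_1 : (Cmod (Q * Q) < 1)%R.
Proof. pose proof (Cmod_ge_0 Q); rewrite Cmod_mult; nra. Qed.

Lemma one_minus_Q : 1 - Q <> 0.
Proof. pose proof (pow_lt_1_neq Q 0 HQ) as H; simpl in H; now rewrite Cmult_1_r in H. Qed.

Lemma one_plus_Q : 1 + Q <> 0.
Proof.
  pose proof (pow_lt_1_neq (- Q) 0) as H; rewrite Cmod_opp in H; specialize (H HQ).
  intros E'; apply H; rewrite <- E'; simpl; ring.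
Qed.

Lemma one_plus_q : 1 + Q * Q <> 0.
Proof.
  pose proof (pow_lt_1_neq (- (Q * Q)) 0) as H; rewrite Cmod_opp in H; specialize (H Qsqr_lt_1).
  intros E'; apply H; rewrite <- E'; simpl; ring.
Qed.

(** The arguments needed, up to inversion, are [-1], [Q], [-Q] and [-Q^2]: the nomes of [1/2],
    [t/2], [(1 + t)/2] and of the sum [1/2 + t] of the last two. *)
Lemma theta_limit_m1 : theta_limit (Q * Q) (- (1)) (B * B / (E * E)).
Proof.
  destruct H4 as (HE & HB & HP & HM & HE0 & _).
  apply theta_limit_of; auto using Qsqr_lt_1; eapply Ccv_ext; try exact HB; intros n; apply Cprod_ext; intros m _.
  - ring.
  - field.
Qed.

Lemma theta_limit_Q : theta_limit (Q * Q) Q (M / (1 - Q) * M / (E * E)).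
Proof.
  destruct H4 as (HE & HB & HP & HM & HE0 & _).
  apply theta_limit_of; auto using Qsqr_lt_1.
  - assert (H0 : 1 - Q ^ S (2 * 0) <> 0) by (simpl; rewrite Cmult_1_r; apply one_minus_Q).
    pose proof (Ccv_tail (fun i => 1 - Q ^ S (2 * i)) M H0 HM) as HT.
    cbv beta in HT; replace (1 - Q ^ S (2 * 0)) with (1 - Q) in HT by (simpl; ring).
    eapply Ccv_ext; [|exact HT]; intros n; apply Cprod_ext; intros m _.
    rewrite Cpow_mult_l, <- Cpow_add_r, (Cpow_S Q (2 * S m)).
    replace (2 * S m)%nat with (S m + S m)%nat by lia; ring.
  - eapply Ccv_ext; [|exact HM]; intros n; apply Cprod_ext; intros m _.
    rewrite Cpow_mult_l, <- Cpow_add_r.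
    replace (S m + S m)%nat with (S (S (2 * m))) by lia; rewrite (Cpow_S Q (S (2 * m))); field; auto.
Qed.

Lemma theta_limit_mQ : theta_limit (Q * Q) (- Q) (P / (1 + Q) * P / (E * E)).
Proof.
  destruct H4 as (HE & HB & HP & HM & HE0 & _).
  apply theta_limit_of; auto using Qsqr_lt_1.
  - assert (H0 : 1 + Q ^ S (2 * 0) <> 0) by (simpl; rewrite Cmult_1_r; apply one_plus_Q).
    pose proof (Ccv_tail (fun i => 1 + Q ^ S (2 * i)) P H0 HP) as HT.
    cbv beta in HT; replace (1 + Q ^ S (2 * 0)) with (1 + Q) in HT by (simpl; ring).
    eapply Ccv_ext; [|exact HT]; intros n; apply Cprod_ext; intros m _.
    rewrite Cpow_mult_l, <- Cpow_add_r, (Cpow_S Q (2 * S m)).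
    replace (2 * S m)%nat with (S m + S m)%nat by lia; ring.
  - eapply Ccv_ext; [|exact HP]; intros n; apply Cprod_ext; intros m _.
    rewrite Cpow_mult_l, <- Cpow_add_r.
    replace (S m + S m)%nat with (S (S (2 * m))) by lia; rewrite (Cpow_S Q (S (2 * m))); field; auto.
Qed.

(** Dividing [q^m] by [-q] lowers the exponents by one, and the factor with exponent 0 equals 2. It
    is one of the sources of the 16 in [transform_B]. *)
Lemma theta_limit_mq : theta_limit (Q * Q) (- (Q * Q)) (B / (1 + Q * Q) * (2 * B) / (E * E)).
Proof.
  destruct H4 as (HE & HB & HP & HM & HE0 & _).
  apply theta_limit_of; auto using Qsqr_lt_1.
  - assert (H0 : 1 + (Q * Q) ^ S 0 <> 0) by (simpl; rewrite Cmult_1_r; apply one_plus_q).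
    pose proof (Ccv_tail (fun i => 1 + (Q * Q) ^ S i) B H0 HB) as HT.
    cbv beta in HT; replace (1 + (Q * Q) ^ 1) with (1 + Q * Q) in HT by (simpl; ring).
    eapply Ccv_ext; [|exact HT]; intros n; apply Cprod_ext; intros m _.
    rewrite (Cpow_S (Q * Q) (S m)); ring.
  - apply (Ccv_eventually _ _ 1).
    eapply Ccv_ext; [|apply (Ccv_scal 2), HB]; intros n; cbv beta; rewrite Nat.add_1_r, Cprod_shift.
    f_equal.
    + simpl; field; auto.
    + apply Cprod_ext; intros m _; rewrite (Cpow_S (Q * Q) (S m)); field; auto.
Qed.

End ThetaValues.

Lemma psi_rows_limit (t c d Ls Ld Lc Le : C) :
  theta_limit (nome t) (nome (c + d)) Ls -> theta_limit (nome t) (nome (c - d)) Ld ->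
  theta_limit (nome t) (nome c) Lc -> theta_limit (nome t) (nome d) Le ->
  Lc <> 0 -> Le <> 0 -> (0 < Im t)%R -> half_period t c -> half_period t d ->
  Ccv (Cprod (psi_rows t c d)) (Ls * Ld / (Lc * Lc * (Le * Le))).
Proof.
  intros Hs Hd Hc He Hc0 He0 Ht Hhc Hhd.
  eapply Ccv_ext; [|apply Ccv_div; [|apply Ccv_mult; [exact Hs|exact Hd]|
    apply Ccv_mult; [apply Ccv_mult; [exact Hc|exact Hc]|apply Ccv_mult; [exact He|exact He]]]].
  - intros n; cbv beta; rewrite <- !Cprod_mult, <- Cprod_div.
    + apply Cprod_ext; intros m _; unfold psi_rows, psi_row; rewrite <- nome_pow; reflexivity.
    + intros m _; rewrite nome_pow; apply Cmult_neq_0; apply Cmult_neq_0; apply theta_row_half_period_neq_0; auto.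
  - apply Cmult_neq_0; now apply Cmult_neq_0.
Qed.

(** * The three theta constants under inversion *)

Lemma half_neq_0 : / 2 <> 0.
Proof. apply Cinv_nz, C2_neq_0. Qed.

Lemma Im_half (t : C) : Im (t / 2) = (Im t / 2)%R.
Proof. destruct t as [a b]; simpl; field. Qed.

Lemma nome_half_sqr (t : C) : nome (t / 2) * nome (t / 2) = nome t.
Proof. rewrite <- nome_plus; f_equal; field. Qed.

Lemma half_period_intro (t : C) (r s : R) : (r = 0 \/ r = 1 / 2 \/ r = - (1 / 2))%R ->
    (s = 0 \/ s = 1 / 2 \/ s = - (1 / 2))%R -> half_period t (r * t + s).
Proof. intros Hr Hs; exists r, s; auto. Qed.

Lemma RtoC_half : RtoC (1 / 2) = / 2.
Proof. rewrite RtoC_div by lra; field. Qed.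

Lemma half_period_1 (t : C) : half_period t (/ 2).
Proof.
  replace (/ 2) with (RtoC 0 * t + RtoC (1 / 2)) by (rewrite RtoC_half; ring).
  apply half_period_intro; auto.
Qed.

Lemma half_period_t (t : C) : half_period t (t / 2).
Proof.
  replace (t / 2) with (RtoC (1 / 2) * t + RtoC 0) by (rewrite RtoC_half; field).
  apply half_period_intro; auto.
Qed.

Lemma half_period_1t (t : C) : half_period t ((1 + t) / 2).
Proof.
  replace ((1 + t) / 2) with (RtoC (1 / 2) * t + RtoC (1 / 2)) by (rewrite RtoC_half; field).
  apply half_period_intro; auto.
Qed.

Lemma m1_neq_1 : - (1) <> RtoC 1.
Proof. rewrite <- RtoC_opp; intros E; apply RtoC_inj in E; lra. Qed.

Lemma Copp_nz (z : C) : z <> 0 -> - z <> 0.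
Proof. intros H E; apply H; replace z with (- - z) by ring; rewrite E; ring. Qed.

Lemma four_products_neq_0 (Q E B P M : C) : four_products Q E B P M ->
  E <> 0 /\ B <> 0 /\ P <> 0 /\ M <> 0 /\ B = / (P * M).
Proof.
  intros (_ & _ & _ & _ & HE & HB & HP & HM & H); repeat split; auto.
  replace B with (B * P * M / (P * M)) by (field; auto); rewrite H; field; auto.
Qed.

Section Transform.

Context (t : C) (Ht : (0 < Im t)%R) (E B P M E' B' P' M' : C).
Let t' := - (1) / t.
Let Q := nome (t / 2).
Let Q' := nome (t' / 2).
Context (H4 : four_products Q E B P M) (H4' : four_products Q' E' B' P' M').

Lemma transform_facts :
  t <> 0 /\ Q <> 0 /\ Q' <> 0 /\ (Cmod Q < 1)%R /\ (Cmod Q' < 1)%R /\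
  1 - Q <> 0 /\ 1 + Q <> 0 /\ 1 - Q' <> 0 /\ 1 + Q' <> 0 /\ 1 + Q' * Q' <> 0 /\
  nome t = Q * Q /\ nome t' = Q' * Q' /\ (0 < Im t')%R.
Proof.
  pose proof (Im_S t Ht) as Ht'; fold t' in Ht'.
  assert (HQ : (Cmod Q < 1)%R) by (apply nome_lt_1; rewrite Im_half; lra).
  assert (HQ' : (Cmod Q' < 1)%R) by (apply nome_lt_1; rewrite Im_half; lra).
  repeat split; auto; try apply nome_neq_0; try (symmetry; apply nome_half_sqr).
  - apply upper_neq_0, Ht.
  - now apply one_minus_Q.
  - now apply one_plus_Q.
  - now apply one_minus_Q.
  - now apply one_plus_Q.
  - now apply one_plus_q.
Qed.

(** [E P^2] is the theta constant [theta_3]. Its fourth power is, up to a constant, the difference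
    of the [wp] values at [1/2] and [t/2], and inversion exchanges these two half periods up to
    sign, so [theta_3] is carried to itself. *)
Lemma transform_P : E' ^ 4 * P' ^ 8 = - (t * t) * (E ^ 4 * P ^ 8).
Proof.
  destruct transform_facts as (Ht0 & HQ0 & HQ0' & HQ & HQ' & HmQ & HpQ & HmQ' & HpQ' & Hpq' & Hq & Hq' & Ht').
  destruct (four_products_neq_0 _ _ _ _ _ H4) as (HE & HB & HP & HM & EB).
  destruct (four_products_neq_0 _ _ _ _ _ H4') as (HE' & HB' & HP' & HM' & EB').
  pose proof half_neq_0 as Hh; pose proof m1_neq_1 as Hm1; pose proof C2_neq_0 as H2.
  assert (Hc : nome (/ 2) = - (1)) by apply nome_half.
  assert (Hd : nome (t / 2) = Q) by reflexivity.
  assert (Hs : nome (/ 2 + t / 2) = - Q) by (rewrite nome_plus, Hc, Hd; ring).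
  assert (Hm : nome (/ 2 - t / 2) = / - Q) by (unfold Cminus; rewrite nome_plus, nome_opp, Hc, Hd; field; auto).
  assert (Ec : / 2 / t = - (t' / 2)) by (unfold t'; field; auto).
  assert (Ed : t / 2 / t = / 2) by (field; auto).
  assert (Hc' : nome (/ 2 / t) = / Q') by (rewrite Ec, nome_opp; reflexivity).
  assert (Hd' : nome (t / 2 / t) = - (1)) by (rewrite Ed; exact Hc).
  assert (Hs' : nome (/ 2 / t + t / 2 / t) = / - Q') by (rewrite nome_plus, Hc', Hd'; field; auto).
  assert (Hm' : nome (/ 2 / t - t / 2 / t) = / - Q') by (unfold Cminus; rewrite nome_plus, nome_opp, Hc', Hd'; field; auto).
  assert (N1 : nome (/ 2) <> 1) by (rewrite Hc; auto).
  assert (N2 : nome (t / 2) <> 1) by (apply nome_neq_1; rewrite Im_half; lra).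
  assert (N4 : nome (t / 2 / t) <> 1) by (rewrite Hd'; auto).
  assert (N3 : nome (/ 2 / t) <> 1).
  { rewrite Hc'; intros Ex; apply HmQ'; replace (1 - Q') with (Q' * (/ Q' - 1)) by (field; auto); rewrite Ex; ring. }
  assert (Imh : forall x y : R, x * t + y <> 0 \/ x = 0%R) by
    (intros x y; destruct (Req_dec x 0); [now right|left; apply Im_neq_0_C; destruct t; simpl in *; nra]).
  pose proof (psi_rows_limit t (/ 2) (t / 2)) as L; rewrite Hs, Hm, Hc, Hd, Hq in L.
  specialize (L _ _ _ _ (theta_limit_mQ Q E B P M HQ HQ0 H4)
    (theta_limit_inv _ _ _ (Copp_nz _ HQ0) (theta_limit_mQ Q E B P M HQ HQ0 H4))
    (theta_limit_m1 Q E B P M HQ H4) (theta_limit_Q Q E B P M HQ HQ0 H4)).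
  pose proof (psi_rows_limit t' (/ 2 / t) (t / 2 / t)) as L'; rewrite Hs', Hm', Hc', Hd', Hq' in L'.
  specialize (L' _ _ _ _
    (theta_limit_inv _ _ _ (Copp_nz _ HQ0') (theta_limit_mQ Q' E' B' P' M' HQ' HQ0' H4'))
    (theta_limit_inv _ _ _ (Copp_nz _ HQ0') (theta_limit_mQ Q' E' B' P' M' HQ' HQ0' H4'))
    (theta_limit_inv _ _ _ HQ0' (theta_limit_Q Q' E' B' P' M' HQ' HQ0' H4'))
    (theta_limit_m1 Q' E' B' P' M' HQ' H4')).
  specialize (L ltac:(apply Cdiv_nz; auto using Cmult_neq_0) ltac:(repeat apply Cdiv_nz; auto using Cmult_neq_0, Cdiv_nz)
     Ht (half_period_1 t) (half_period_t t)).
  specialize (L' ltac:(repeat apply Cdiv_nz; auto using Cmult_neq_0, Cdiv_nz) ltac:(apply Cdiv_nz; auto using Cmult_neq_0)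
     Ht' (half_period_S t _ Ht0 (half_period_1 t)) (half_period_S t _ Ht0 (half_period_t t))).
  assert (I1 : / 2 + t / 2 <> 0).
  { replace (/ 2 + t / 2) with (RtoC (1 / 2) * t + RtoC (1 / 2)) by (rewrite RtoC_half; field).
    destruct (Imh (1 / 2)%R (1 / 2)%R); auto; lra. }
  assert (I2 : / 2 - t / 2 <> 0).
  { replace (/ 2 - t / 2) with (RtoC (- (1 / 2)) * t + RtoC (1 / 2)) by (rewrite RtoC_opp, RtoC_half; field).
    destruct (Imh (- (1 / 2))%R (1 / 2)%R); auto; lra. }
  pose proof (psi_S t (/ 2) (t / 2) _ _ Ht (half_period_1 t) (half_period_t t) Hh (Cdiv_nz _ _ Ht0 H2) I1 I2 N1 N2 N3 N4 L L') as EQ.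
  rewrite !psi0_nome in EQ by auto.
  rewrite Hc, Hd, Hc', Hd', EB, EB' in EQ.
  clear L L' Imh Hs Hm Hc Hd Hs' Hm' Hc' Hd' N1 N2 N3 N4 Ec Ed I1 I2.
  clear EB EB' HB HB' Hm1 Hh Hpq' Hq Hq' Ht Ht' HQ HQ' H4 H4'.
  clearbody Q Q' t'.
  assert (Hd1 : Q - 1 <> 0) by (intros Ex; apply HmQ; replace (1 - Q) with (- (Q - 1)) by ring; rewrite Ex; ring).
  match type of EQ with ?l = t * t * ?r =>
    replace l with (E' ^ 4 * P' ^ 8) in EQ; [replace r with (- (E ^ 4 * P ^ 8)) in EQ|] end.
  - rewrite EQ; ring.
  - field; repeat split; auto.
  - field; repeat split; auto.
Qed.
(** Here [16 Q E^4 B^8] is [theta_2^4] and [E^4 M^8] is [theta_4^4]. The pair [1/2, (1 + t)/2] is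
    sent to the half periods [t'/2, (1 + t')/2] up to sign and lattice translation, so the two theta
    constants are exchanged. *)
Lemma transform_B : 16 * Q' * (E' ^ 4 * B' ^ 8) = - (t * t) * (E ^ 4 * M ^ 8).
Proof.
  destruct transform_facts as (Ht0 & HQ0 & HQ0' & HQ & HQ' & HmQ & HpQ & HmQ' & HpQ' & Hpq' & Hq & Hq' & Ht').
  destruct (four_products_neq_0 _ _ _ _ _ H4) as (HE & HB & HP & HM & EB).
  destruct (four_products_neq_0 _ _ _ _ _ H4') as (HE' & HB' & HP' & HM' & EB').
  pose proof half_neq_0 as Hh; pose proof m1_neq_1 as Hm1; pose proof C2_neq_0 as H2.
  assert (Hc : nome (/ 2) = - (1)) by apply nome_half.
  assert (Eh : (1 + t) / 2 = / 2 + t / 2) by (field; auto).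
  assert (Hd : nome ((1 + t) / 2) = - Q) by (rewrite Eh, nome_plus, Hc; fold Q; ring).
  assert (Hs : nome (/ 2 + (1 + t) / 2) = Q) by (rewrite nome_plus, Hc, Hd; ring).
  assert (Hm : nome (/ 2 - (1 + t) / 2) = / Q) by (unfold Cminus; rewrite nome_plus, nome_opp, Hc, Hd; field; auto).
  assert (Ec : / 2 / t = - (t' / 2)) by (unfold t'; field; auto).
  assert (Ed : (1 + t) / 2 / t = / 2 + - (t' / 2)) by (unfold t'; field; auto).
  assert (Hc' : nome (/ 2 / t) = / Q') by (rewrite Ec, nome_opp; reflexivity).
  assert (Hd' : nome ((1 + t) / 2 / t) = / - Q') by (rewrite Ed, nome_plus, nome_opp, Hc; fold Q'; field; auto).
  assert (Hs' : nome (/ 2 / t + (1 + t) / 2 / t) = / - (Q' * Q')) by (rewrite nome_plus, Hc', Hd'; field; auto).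
  assert (Hm' : nome (/ 2 / t - (1 + t) / 2 / t) = - (1)) by (unfold Cminus; rewrite nome_plus, nome_opp, Hc', Hd'; field; auto).
  assert (N1 : nome (/ 2) <> 1) by (rewrite Hc; auto).
  assert (N2 : nome ((1 + t) / 2) <> 1).
  { rewrite Hd; intros Ex; apply HpQ; replace (1 + Q) with (1 - (- Q)) by ring; rewrite Ex; ring. }
  assert (N3 : nome (/ 2 / t) <> 1).
  { rewrite Hc'; intros Ex; apply HmQ'; replace (1 - Q') with (Q' * (/ Q' - 1)) by (field; auto); rewrite Ex; ring. }
  assert (N4 : nome ((1 + t) / 2 / t) <> 1).
  { rewrite Hd'; intros Ex; apply HpQ'; replace (1 + Q') with (- Q' * (/ - Q' - 1)) by (field; auto); rewrite Ex; ring. }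
  assert (Imh : forall x y : R, x * t + y <> 0 \/ x = 0%R) by
    (intros x y; destruct (Req_dec x 0); [now right|left; apply Im_neq_0_C; destruct t; simpl in *; nra]).
  pose proof (psi_rows_limit t (/ 2) ((1 + t) / 2)) as L; rewrite Hs, Hm, Hc, Hd, Hq in L.
  specialize (L _ _ _ _ (theta_limit_Q Q E B P M HQ HQ0 H4)
    (theta_limit_inv _ _ _ HQ0 (theta_limit_Q Q E B P M HQ HQ0 H4))
    (theta_limit_m1 Q E B P M HQ H4) (theta_limit_mQ Q E B P M HQ HQ0 H4)).
  pose proof (psi_rows_limit t' (/ 2 / t) ((1 + t) / 2 / t)) as L'; rewrite Hs', Hm', Hc', Hd', Hq' in L'.
  specialize (L' _ _ _ _
    (theta_limit_inv _ _ _ (Copp_nz _ (Cmult_neq_0 _ _ HQ0' HQ0')) (theta_limit_mq Q' E' B' P' M' HQ' HQ0' H4'))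
    (theta_limit_m1 Q' E' B' P' M' HQ' H4')
    (theta_limit_inv _ _ _ HQ0' (theta_limit_Q Q' E' B' P' M' HQ' HQ0' H4'))
    (theta_limit_inv _ _ _ (Copp_nz _ HQ0') (theta_limit_mQ Q' E' B' P' M' HQ' HQ0' H4'))).
  specialize (L ltac:(apply Cdiv_nz; auto using Cmult_neq_0) ltac:(repeat apply Cdiv_nz; auto using Cmult_neq_0, Cdiv_nz)
     Ht (half_period_1 t) (half_period_1t t)).
  specialize (L' ltac:(repeat apply Cdiv_nz; auto using Cmult_neq_0, Cdiv_nz) ltac:(repeat apply Cdiv_nz; auto using Cmult_neq_0, Cdiv_nz)
     Ht' (half_period_S t _ Ht0 (half_period_1 t)) (half_period_S t _ Ht0 (half_period_1t t))).
  assert (I1 : / 2 + (1 + t) / 2 <> 0).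
  { replace (/ 2 + (1 + t) / 2) with (RtoC (1 / 2) * t + RtoC 1) by (rewrite RtoC_half; field; auto).
    destruct (Imh (1 / 2)%R 1%R); auto; lra. }
  assert (I2 : / 2 - (1 + t) / 2 <> 0).
  { replace (/ 2 - (1 + t) / 2) with (RtoC (- (1 / 2)) * t + RtoC 0) by (rewrite RtoC_opp, RtoC_half; field; auto).
    destruct (Imh (- (1 / 2))%R 0%R); auto; lra. }
  assert (I3 : (1 + t) / 2 <> 0).
  { replace ((1 + t) / 2) with (RtoC (1 / 2) * t + RtoC (1 / 2)) by (rewrite RtoC_half; field; auto).
    destruct (Imh (1 / 2)%R (1 / 2)%R); auto; lra. }
  pose proof (psi_S t (/ 2) ((1 + t) / 2) _ _ Ht (half_period_1 t) (half_period_1t t) Hh I3 I1 I2 N1 N2 N3 N4 L L') as EQ.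
  rewrite !psi0_nome in EQ by auto.
  rewrite Hc, Hd, Hc', Hd', EB in EQ.
  clear L L' Imh Hs Hm Hc Hd Hs' Hm' Hc' Hd' N1 N2 N3 N4 Ec Ed Eh I1 I2 I3.
  clear EB HB Hm1 Hh Hq Hq' Ht Ht' HQ HQ' H4.
  assert (EB2 : B' * P' * M' = 1) by apply H4'.
  clear H4' EB'; clearbody Q Q' t'.
  assert (Hd1 : Q - 1 <> 0) by (intros Ex; apply HmQ; replace (1 - Q) with (- (Q - 1)) by ring; rewrite Ex; ring).
  assert (Hd2 : Q' - 1 <> 0) by (intros Ex; apply HmQ'; replace (1 - Q') with (- (Q' - 1)) by ring; rewrite Ex; ring).
  assert (Hd3 : - Q - 1 <> 0) by (intros Ex; apply HpQ; replace (1 + Q) with (- (- Q - 1)) by ring; rewrite Ex; ring).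
  assert (Hd4 : - Q' - 1 <> 0) by (intros Ex; apply HpQ'; replace (1 + Q') with (- (- Q' - 1)) by ring; rewrite Ex; ring).
  match type of EQ with ?l = t * t * ?r =>
    replace l with (16 * Q' * (E' ^ 4 * B' ^ 4) * / (P' ^ 4 * M' ^ 4)) in EQ; [replace r with (- (E ^ 4 * M ^ 8)) in EQ|] end.
  - replace (16 * Q' * (E' ^ 4 * B' ^ 8)) with (16 * Q' * (E' ^ 4 * B' ^ 4) * / (P' ^ 4 * M' ^ 4) * (B' * P' * M') ^ 4) by (field; auto).
    rewrite EQ, EB2; ring.
  - field; repeat split; auto.
  - field; repeat split; auto.
Qed.

End Transform.

(** Since [B P M = 1], the product of the three fourth powers [theta_2^4 theta_3^4 theta_4^4] is
    [16 Q E^12], of weight 6 up to sign; its square is a constant times the discriminant. *)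
Theorem discriminant_S (t e e' : C) : (0 < Im t)%R ->
  eulerP (nome t) e -> eulerP (nome (- (1) / t)) e' ->
  nome (- (1) / t) * e' ^ 24 = t ^ 12 * (nome t * e ^ 24).
Proof.
  intros Ht He He'.
  set (t' := - (1) / t); pose proof (Im_S t Ht) as Ht'; fold t' in Ht'.
  pose proof (upper_neq_0 t Ht) as Ht0.
  assert (Et : - (1) / t' = t) by (unfold t'; field; auto).
  destruct (four_products_exist (nome (t / 2))) as (E & B & P & M & H4).
  { apply nome_lt_1; rewrite Im_half; lra. }
  destruct (four_products_exist (nome (t' / 2))) as (E' & B' & P' & M' & H4').
  { apply nome_lt_1; rewrite Im_half; lra. }
  assert (EE : E = e).
  { apply (Ccv_unique _ _ _ (proj1 H4)); rewrite nome_half_sqr; exact He. }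
  assert (EE' : E' = e').
  { apply (Ccv_unique _ _ _ (proj1 H4')); rewrite nome_half_sqr; exact He'. }
  pose proof (transform_P t Ht E B P M E' B' P' M' H4 H4') as T1.
  pose proof (transform_B t Ht E B P M E' B' P' M' H4 H4') as T2.
  (* Applied at [-1/t], the same lemma gives the transformation in the opposite direction, that of
     [theta_4] into [theta_2]. *)
  pose proof (transform_B t' Ht' E' B' P' M' E B P M H4') as T3.
  rewrite Et in T3; specialize (T3 H4); fold t' in T2.
  set (Q := nome (t / 2)) in *; set (Q' := nome (t' / 2)) in *.
  assert (T3' : E' ^ 4 * M' ^ 8 = - (t * t) * (16 * Q * (E ^ 4 * B ^ 8))).
  { rewrite T3; unfold t'; field; auto. }
  assert (HB : B * P * M = 1) by apply H4; assert (HB' : B' * P' * M' = 1) by apply H4'.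
  assert (K : 16 * (Q' * E' ^ 12) = 16 * (- t ^ 6 * (Q * E ^ 12))).
  { transitivity ((E' ^ 4 * P' ^ 8) * (16 * Q' * (E' ^ 4 * B' ^ 8)) * (E' ^ 4 * M' ^ 8)).
    - transitivity (16 * (Q' * E' ^ 12) * (B' * P' * M') ^ 8); [rewrite HB'; ring|ring].
    - rewrite T1, T2, T3'.
      transitivity (16 * (- t ^ 6 * (Q * E ^ 12)) * (B * P * M) ^ 8); [ring|rewrite HB; ring]. }
  assert (H16 : RtoC 16 <> 0) by (apply RtoC_neq_0; lra).
  assert (K2 : Q' * E' ^ 12 = - t ^ 6 * (Q * E ^ 12)).
  { replace (Q' * E' ^ 12) with (16 * (Q' * E' ^ 12) / 16) by (field; auto); rewrite K; field; auto. }
  rewrite <- (nome_half_sqr t'), <- (nome_half_sqr t); fold Q Q'; rewrite <- EE, <- EE'.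
  transitivity ((Q' * E' ^ 12) * (Q' * E' ^ 12)); [ring|].
  rewrite K2; ring.
Qed.

(** * Power series and their values in the unit disc *)

Definition cev (a : nat -> C) (q v : C) : Prop := Ccv (Csum (fun n => a n * q ^ n)) v.

Definition cconv (a : nat -> C) : Prop :=
  forall r, (0 <= r < 1)%R -> summable (fun i => Cmod (a i) * r ^ i)%R.

Lemma summable_nonneg_term (a : nat -> C) (r : R) : (0 <= r)%R ->
  forall i, (0 <= Cmod (a i) * r ^ i)%R.
Proof. intros Hr i; apply Rmult_le_pos; [apply Cmod_ge_0|apply pow_le; exact Hr]. Qed.

Lemma cconv_cev (a : nat -> C) (q : C) : cconv a -> (Cmod q < 1)%R -> exists v, cev a q v.
Proof.
  intros Ha Hq; apply (Csum_Ccv _ (fun i => Cmod (a i) * Cmod q ^ i)%R).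
  - apply Ha; split; [apply Cmod_ge_0|exact Hq].
  - intros i; rewrite Cmod_mult, Cmod_pow; lra.
Qed.

Lemma cev_unique (a : nat -> C) (q v v' : C) : cev a q v -> cev a q v' -> v = v'.
Proof. apply Ccv_unique. Qed.

Lemma cev_plus (a b : nat -> C) (q v v' : C) : cev a q v -> cev b q v' ->
  cev (fun n => a n + b n) q (v + v').
Proof.
  intros Ha Hb; eapply Ccv_ext; [|apply Ccv_plus; [exact Ha|exact Hb]].
  intros n; cbv beta; rewrite <- Csum_plus; apply Csum_ext; intros; ring.
Qed.

Lemma cev_scal (c : C) (a : nat -> C) (q v : C) : cev a q v -> cev (fun n => c * a n) q (c * v).
Proof.
  intros Ha; eapply Ccv_ext; [|apply (Ccv_scal c), Ha].
  intros n; cbv beta; rewrite <- Csum_scal; apply Csum_ext; intros; ring.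
Qed.

Lemma Ccv_terms_bounded (f : nat -> C) (l : C) : Ccv (Csum f) l -> exists B, forall n, (Cmod (f n) <= B)%R.
Proof.
  intros H; destruct (Ccv_bounded_all _ _ H) as [B HB]; exists (B + B)%R; intros n.
  replace (f n) with (Csum f (S n) - Csum f n) by (simpl; ring).
  eapply Rle_trans; [apply Cmod_minus_le|]; apply Rplus_le_compat; auto.
Qed.

(** Abel's argument: convergence at a radius [s] between [r] and 1 bounds the terms there, and the
    terms at [r] are smaller by the geometric factor [(r / s)^i]. *)
Lemma cconv_of_cev (a : nat -> C) :
  (forall r : R, (0 < r < 1)%R -> exists v, cev a r v) -> cconv a.
Proof.
  intros H r Hr; split; [apply summable_nonneg_term; lra|].
  set (s := ((1 + r) / 2)%R).
  assert (Hs : (0 < s < 1)%R) by (unfold s; lra).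
  assert (Hrs : (r < s)%R) by (unfold s; lra).
  destruct (H s Hs) as [v Hv]; destruct (Ccv_terms_bounded _ _ Hv) as [B HB].
  assert (Hd : (0 <= r / s < 1)%R).
  { split; [apply Rcomplements.Rdiv_le_0_compat; lra|].
    apply (Rmult_lt_reg_r s); [lra|]; unfold Rdiv; rewrite Rmult_assoc, Rinv_l by lra; lra. }
  assert (HB0 : (0 <= B)%R) by (eapply Rle_trans; [apply Cmod_ge_0|apply (HB 0%nat)]).
  exists (B * / (1 - r / s))%R; intros n.
  apply Rle_trans with (Rsum (fun i => B * (r / s) ^ i)%R n).
  - apply Rsum_le; intros i _; specialize (HB i).
    rewrite Cmod_mult, Cmod_pow, Cmod_R, Rabs_pos_eq in HB by lra.
    replace (r ^ i)%R with (s ^ i * (r / s) ^ i)%R.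
    + rewrite <- Rmult_assoc; apply Rmult_le_compat_r; [apply pow_le; lra|exact HB].
    + rewrite <- Rpow_mult_distr; f_equal; field; lra.
  - rewrite Rsum_scal; apply Rmult_le_compat_l; [exact HB0|]; apply Rsum_geom; exact Hd.
Qed.

Definition cmul (a b : nat -> C) (n : nat) : C := Csum (fun i => a i * b (n - i)%nat) (S n).

Lemma Csum_cmul (a b : nat -> C) (q : C) (N : nat) :
  Csum (fun n => cmul a b n * q ^ n) N =
  Csum (fun i => a i * q ^ i * Csum (fun j => b j * q ^ j) (N - i)) N.
Proof.
  induction N as [|N IH]; [reflexivity|].
  cbn [Csum]; rewrite IH.
  replace (S N - N)%nat with 1%nat by lia.
  rewrite (Csum_ext (fun i => a i * q ^ i * Csum _ (S N - i))
    (fun i => a i * q ^ i * Csum (fun j => b j * q ^ j) (N - i) + q ^ N * (a i * b (N - i)%nat))).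
  - rewrite Csum_plus, Csum_scal; unfold cmul; cbn [Csum]; rewrite Nat.sub_diag; simpl; ring.
  - intros i Hi; replace (S N - i)%nat with (S (N - i)) by lia; cbn [Csum].
    replace (q ^ N) with (q ^ i * q ^ (N - i)) by (rewrite <- Cpow_add_r; f_equal; lia). ring.
Qed.

Lemma Rsum_nonneg_le (a : nat -> R) (n m : nat) (B : R) :
  (forall i, (0 <= a i)%R) -> (n <= m)%nat -> (Rsum a m <= B)%R -> (Rsum a m - Rsum a n <= B)%R.
Proof. intros Ha Hnm HB; pose proof (Rsum_nonneg a n Ha); lra. Qed.

(** The product of the partial sums exceeds the partial sum of the Cauchy product by a sum of terms
    of [a] times tails of [b]. With [s] between [|q|] and 1 and [d = |q| / s], the term of index [i]
    gives [d^i] and its tail [d^(N - i)], so the error is of order [d^N]. *)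
Lemma cmul_cev (a b : nat -> C) (q u v : C) : cconv a -> cconv b -> (Cmod q < 1)%R ->
  cev a q u -> cev b q v -> cev (cmul a b) q (u * v).
Proof.
  intros Ha Hb Hq Hu Hv.
  pose proof (Cmod_ge_0 q) as Hq0.
  set (r := Cmod q) in *; set (s := ((1 + r) / 2)%R).
  assert (Hs : (0 < s < 1)%R) by (unfold s; lra).
  assert (Hrs : (r < s)%R) by (unfold s; lra).
  destruct (Ha s ltac:(lra)) as [Hpa [A HA]]; destruct (Hb s ltac:(lra)) as [Hpb [B HB]].
  assert (Hd : (0 <= r / s < 1)%R).
  { split; [apply Rcomplements.Rdiv_le_0_compat; lra|].
    apply (Rmult_lt_reg_r s); [lra|]; unfold Rdiv; rewrite Rmult_assoc, Rinv_l by lra; lra. }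
  set (d := (r / s)%R) in *.
  assert (Hpow : forall i, (r ^ i = s ^ i * d ^ i)%R).
  { intros i; rewrite <- Rpow_mult_distr; f_equal; unfold d; field; lra. }
  assert (HB0 : (0 <= B)%R) by (specialize (HB 0%nat); simpl in HB; lra).
  pose (Sb := Csum (fun j => b j * q ^ j)).
  assert (Htail : forall N i, (i <= N)%nat ->
    (Cmod (Sb N - Sb (N - i)%nat) <= d ^ (N - i) * B)%R).
  { intros N i Hi.
    eapply Rle_trans with (d ^ (N - i) * (Rsum (fun j => Cmod (b j) * s ^ j) N - Rsum (fun j => Cmod (b j) * s ^ j) (N - i)))%R.
    - assert (Hgen : forall m n, (m <= n)%nat ->
        (Cmod (Sb n - Sb m) <=
         d ^ m * (Rsum (fun j => Cmod (b j) * s ^ j) n - Rsum (fun j => Cmod (b j) * s ^ j) m))%R).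
      { intros m n Hmn; induction Hmn as [|n Hmn IH].
        - unfold Cminus; rewrite Cplus_opp_r, Cmod_0; lra.
        - unfold Sb at 1; cbn [Csum Rsum]; fold (Sb n).
          replace (Sb n + b n * q ^ n - Sb m)
            with ((Sb n - Sb m) + b n * q ^ n) by ring.
          eapply Rle_trans; [apply Cmod_triangle|]; rewrite Cmod_mult, Cmod_pow; fold r; rewrite Hpow.
          assert (Hdn : (d ^ n <= d ^ m)%R).
          { replace n with (m + (n - m))%nat by lia; rewrite pow_add.
            assert (d ^ (n - m) <= 1)%R by (rewrite <- (pow1 (n - m)); apply pow_incr; lra).
            pose proof (pow_le d m ltac:(lra)); pose proof (pow_le d (n - m) ltac:(lra)); nra. }
          specialize (Hpb n).
          replace (Cmod (b n) * (s ^ n * d ^ n))%R with (d ^ n * (Cmod (b n) * s ^ n))%R by ring.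
          nra. }
      apply Hgen; lia.
    - apply Rmult_le_compat_l; [apply pow_le; lra|].
      apply Rsum_nonneg_le; auto; lia. }
  apply (Ccv_ext (fun N => Csum (fun n => a n * q ^ n) N * Csum (fun n => b n * q ^ n) N -
     (Csum (fun n => a n * q ^ n) N * Csum (fun n => b n * q ^ n) N - Csum (fun n => cmul a b n * q ^ n) N))).
  { intros n; ring. }
  apply (Ccv_eq _ (u * v - 0)); [ring|].
  apply Ccv_minus; [apply Ccv_mult; auto|].
  apply (Ccv_squeeze _ _ (fun N => A * B * d ^ N)%R).
  { replace (Finite 0) with (Rbar_mult (A * B)%R 0%R) by (simpl; f_equal; ring).
    apply is_lim_seq_scal_l, is_lim_seq_geom; rewrite Rabs_pos_eq; lra. }
  intros N; rewrite Csum_cmul.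
  set (SB := Csum (fun n => b n * q ^ n) N).
  replace (Csum (fun n => a n * q ^ n) N * SB - _ - 0)
    with (Csum (fun i => a i * q ^ i * (SB - Csum (fun j => b j * q ^ j) (N - i))) N).
  2:{ rewrite (Cmult_comm _ SB), <- Csum_scal.
      rewrite (Csum_ext _ (fun i => SB * (a i * q ^ i) + (- (1)) * (a i * q ^ i * Csum (fun j => b j * q ^ j) (N - i)))) by (intros; ring).
      rewrite Csum_plus, (Csum_scal (- (1))); ring. }
  eapply Rle_trans; [apply (Csum_le _ (fun i => (B * d ^ N) * (Cmod (a i) * s ^ i))%R)|].
  - intros i Hi; rewrite !Cmod_mult, Cmod_pow; fold r.
    specialize (Htail N i ltac:(lia)); fold Sb; change (Sb N) with SB in Htail.
    rewrite Hpow.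
    replace (B * d ^ N * (Cmod (a i) * s ^ i))%R with (Cmod (a i) * (s ^ i * d ^ i) * (d ^ (N - i) * B))%R.
    + apply Rmult_le_compat_l; [|exact Htail].
      repeat apply Rmult_le_pos; try apply pow_le; try apply Cmod_ge_0; lra.
    + replace N with (i + (N - i))%nat at 2 by lia; rewrite pow_add; ring.
  - rewrite Rsum_scal.
    replace (A * B * d ^ N)%R with (B * d ^ N * A)%R by ring.
    apply Rmult_le_compat_l; auto; apply Rmult_le_pos; auto; apply pow_le; lra.
Qed.

Lemma cmul_cconv (a b : nat -> C) : cconv a -> cconv b -> cconv (cmul a b).
Proof.
  intros Ha Hb; apply cconv_of_cev; intros r Hr.
  assert (Hm : (Cmod r < 1)%R) by (rewrite Cmod_R, Rabs_pos_eq; lra).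
  destruct (cconv_cev a r Ha Hm) as [u Hu]; destruct (cconv_cev b r Hb Hm) as [v Hv].
  exists (u * v); now apply cmul_cev.
Qed.

(** * Formal power series with integer coefficients *)

Definition fps : Type := nat -> Z.

Fixpoint Zsum (f : nat -> Z) (n : nat) : Z :=
  match n with O => 0%Z | S k => (Zsum f k + f k)%Z end.

Definition fzero : fps := fun _ => 0%Z.
Definition fone : fps := fun n => if Nat.eqb n 0 then 1%Z else 0%Z.
Definition fadd (a b : fps) : fps := fun n => (a n + b n)%Z.
Definition fsub (a b : fps) : fps := fun n => (a n - b n)%Z.
Definition fopp (a : fps) : fps := fun n => (- a n)%Z.
Definition fmul (a b : fps) : fps := fun n => Zsum (fun i => a i * b (n - i)%nat)%Z (S n).
Fixpoint fpow (a : fps) (k : nat) : fps := match k with O => fone | S k => fmul a (fpow a k) end.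

Lemma Zsum_ext (f g : nat -> Z) (n : nat) :
  (forall i, (i < n)%nat -> f i = g i) -> Zsum f n = Zsum g n.
Proof.
  induction n as [|n IH]; intros H; [reflexivity|].
  simpl; rewrite IH, H by auto; reflexivity.
Qed.

Lemma Zsum_plus (f g : nat -> Z) (n : nat) :
  Zsum (fun i => f i + g i)%Z n = (Zsum f n + Zsum g n)%Z.
Proof. induction n as [|n IH]; simpl; [ring|rewrite IH; ring]. Qed.

Lemma Zsum_scal (c : Z) (f : nat -> Z) (n : nat) :
  Zsum (fun i => c * f i)%Z n = (c * Zsum f n)%Z.
Proof. induction n as [|n IH]; simpl; [ring|rewrite IH; ring]. Qed.

Lemma Zsum_zero (n : nat) : Zsum (fun _ => 0%Z) n = 0%Z.
Proof. induction n as [|n IH]; simpl; [ring|rewrite IH; ring]. Qed.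

Lemma Zsum_shift (f : nat -> Z) (n : nat) :
  Zsum f (S n) = (f 0%nat + Zsum (fun i => f (S i)) n)%Z.
Proof.
  induction n as [|n IH]; [simpl; ring|].
  change (Zsum f (S (S n))) with (Zsum f (S n) + f (S n))%Z; rewrite IH; simpl; ring.
Qed.

Lemma Zsum_rev (f : nat -> Z) (n : nat) : Zsum (fun i => f (n - i)%nat) (S n) = Zsum f (S n).
Proof.
  revert f; induction n as [|n IH]; intros f; [reflexivity|].
  rewrite Zsum_shift, Nat.sub_0_r.
  change (Zsum f (S (S n))) with (Zsum f (S n) + f (S n))%Z.
  change (Zsum (fun i => f (S n - S i)%nat) (S n)) with (Zsum (fun i => f (n - i)%nat) (S n)).
  rewrite IH; ring.
Qed.

Lemma Zsum_triangle (f : nat -> nat -> Z) (n : nat) :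
  Zsum (fun i => Zsum (fun j => f i j) (S i)) (S n) =
  Zsum (fun j => Zsum (fun k => f (j + k)%nat j) (S (n - j))) (S n).
Proof.
  induction n as [|n IH]; [reflexivity|].
  change (Zsum (fun i => Zsum (fun j => f i j) (S i)) (S (S n))) with
    (Zsum (fun i => Zsum (fun j => f i j) (S i)) (S n) + Zsum (fun j => f (S n) j) (S (S n)))%Z.
  rewrite IH.
  change (Zsum (fun j => Zsum (fun k => f (j + k)%nat j) (S (S n - j))) (S (S n))) with
    (Zsum (fun j => Zsum (fun k => f (j + k)%nat j) (S (S n - j))) (S n) +
     Zsum (fun k => f (S n + k)%nat (S n)) (S (S n - S n)))%Z.
  rewrite (Zsum_ext (fun j => Zsum (fun k => f (j + k)%nat j) (S (S n - j)))
    (fun j => Zsum (fun k => f (j + k)%nat j) (S (n - j)) + f (S n) j)%Z).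
  - rewrite Zsum_plus, Nat.sub_diag.
    change (Zsum (fun j => f (S n) j) (S (S n))) with (Zsum (fun j => f (S n) j) (S n) + f (S n) (S n))%Z.
    change (Zsum (fun k => f (S n + k)%nat (S n)) 1) with (f (S n + 0)%nat (S n)).
    rewrite Nat.add_0_r; change (fun j => f (S n) j) with (f (S n)); ring.
  - intros j Hj; replace (S n - j)%nat with (S (n - j)) by lia.
    change (Zsum (fun k => f (j + k)%nat j) (S (S (n - j)))) with
      (Zsum (fun k => f (j + k)%nat j) (S (n - j)) + f (j + S (n - j))%nat j)%Z.
    replace (j + S (n - j))%nat with (S n) by lia; reflexivity.
Qed.

Lemma fmul_comm (a b : fps) : fmul a b = fmul b a.
Proof.
  extensionality n; unfold fmul; rewrite <- Zsum_rev; apply Zsum_ext; intros i Hi.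
  replace (n - (n - i))%nat with i by lia; ring.
Qed.

Lemma fmul_assoc (a b c : fps) : fmul a (fmul b c) = fmul (fmul a b) c.
Proof.
  extensionality n; unfold fmul; symmetry.
  rewrite (Zsum_ext _ (fun i => Zsum (fun j => a j * b (i - j)%nat * c (n - i)%nat)%Z (S i))).
  - rewrite (Zsum_triangle (fun i j => a j * b (i - j)%nat * c (n - i)%nat)%Z).
    apply Zsum_ext; intros j Hj; rewrite <- Zsum_scal; apply Zsum_ext; intros k Hk.
    replace (j + k - j)%nat with k by lia; replace (n - (j + k))%nat with (n - j - k)%nat by lia; ring.
  - intros i _; rewrite Z.mul_comm, <- Zsum_scal; apply Zsum_ext; intros; ring.
Qed.

Lemma fmul_one_l (a : fps) : fmul fone a = a.
Proof.
  extensionality n; unfold fmul; rewrite Zsum_shift, Nat.sub_0_r.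
  rewrite (Zsum_ext _ (fun _ => 0%Z)); [rewrite Zsum_zero; unfold fone; cbn [Nat.eqb]; ring|].
  intros i _; unfold fone; cbn [Nat.eqb]; ring.
Qed.

Lemma fmul_add_l (a b c : fps) : fmul (fadd a b) c = fadd (fmul a c) (fmul b c).
Proof.
  extensionality n; unfold fmul, fadd; rewrite <- Zsum_plus; apply Zsum_ext; intros; ring.
Qed.

(** Stated for Leibniz equality, by functional extensionality, so that [ring] proves identities
    between series that can be rewritten with. *)
Lemma fps_ring_theory : ring_theory fzero fone fadd fmul fsub fopp (@eq fps).
Proof.
  constructor; intros.
  - extensionality n; unfold fadd, fzero; ring.
  - extensionality n; unfold fadd; ring.
  - extensionality n; unfold fadd; ring.
  - apply fmul_one_l.
  - apply fmul_comm.
  - apply fmul_assoc.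
  - apply fmul_add_l.
  - extensionality n; unfold fadd, fsub, fopp; ring.
  - extensionality n; unfold fadd, fopp, fzero; ring.
Qed.

Add Ring fps_ring : fps_ring_theory.

Definition injC (a : fps) (n : nat) : C := RtoC (IZR (a n)).

Lemma injC_fmul (a b : fps) : injC (fmul a b) = cmul (injC a) (injC b).
Proof.
  extensionality n; unfold injC, fmul, cmul.
  generalize (S n) as m; induction m as [|m IH]; [reflexivity|].
  simpl; rewrite plus_IZR, RtoC_plus, IH, mult_IZR, RtoC_mult; reflexivity.
Qed.

Definition ev (a : fps) (q v : C) : Prop := cev (injC a) q v.
Definition conv (a : fps) : Prop := cconv (injC a).

Lemma ev_mul (a b : fps) (q u v : C) : conv a -> conv b -> (Cmod q < 1)%R ->
  ev a q u -> ev b q v -> ev (fmul a b) q (u * v).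
Proof. unfold ev; rewrite injC_fmul; apply cmul_cev. Qed.

Lemma conv_mul (a b : fps) : conv a -> conv b -> conv (fmul a b).
Proof. unfold conv; rewrite injC_fmul; apply cmul_cconv. Qed.

Lemma conv_of_ev (a : fps) : (forall q : C, (Cmod q < 1)%R -> exists v, ev a q v) -> conv a.
Proof.
  intros H; apply cconv_of_cev; intros r Hr; apply H; rewrite Cmod_R, Rabs_pos_eq; lra.
Qed.

Lemma conv_ev (a : fps) (q : C) : conv a -> (Cmod q < 1)%R -> exists v, ev a q v.
Proof. apply cconv_cev. Qed.

Lemma ev_add (a b : fps) (q u v : C) : ev a q u -> ev b q v -> ev (fadd a b) q (u + v).
Proof.
  intros Ha Hb; eapply Ccv_ext; [|apply (cev_plus _ _ _ _ _ Ha Hb)].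
  intros n; apply Csum_ext; intros i _; unfold injC, fadd; rewrite plus_IZR, RtoC_plus; ring.
Qed.

Lemma ev_fscal (c : Z) (a : fps) (q v : C) : ev a q v -> ev (fun n => c * a n)%Z q (IZR c * v).
Proof.
  intros Ha; eapply Ccv_ext; [|apply (cev_scal (IZR c) _ _ _ Ha)].
  intros n; apply Csum_ext; intros i _; unfold injC; rewrite mult_IZR, RtoC_mult; ring.
Qed.

Lemma ev_finite (a : fps) (q : C) (N : nat) : (forall n, (N <= n)%nat -> a n = 0%Z) ->
  ev a q (Csum (fun n => injC a n * q ^ n) N).
Proof.
  intros H; apply (Ccv_eventually _ _ N).
  eapply Ccv_ext; [|apply Ccv_const]; intros n; cbv beta.
  induction n as [|n IH]; [reflexivity|].
  simpl; rewrite <- IH; unfold injC; rewrite (H (n + N)%nat) by lia; ring.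
Qed.

Lemma ev_one (q : C) : ev fone q 1.
Proof.
  eapply Ccv_eq; [|apply (ev_finite fone q 1)].
  - simpl; unfold injC, fone; simpl; ring.
  - intros [|n] Hn; [lia|reflexivity].
Qed.

Lemma conv_one : conv fone.
Proof. apply conv_of_ev; intros q _; exists 1; apply ev_one. Qed.

Lemma conv_pow (a : fps) (k : nat) : conv a -> conv (fpow a k).
Proof. intros Ha; induction k; simpl; [apply conv_one|now apply conv_mul]. Qed.

Lemma ev_pow (a : fps) (q v : C) (k : nat) : conv a -> (Cmod q < 1)%R ->
  ev a q v -> ev (fpow a k) q (v ^ k).
Proof.
  intros Ha Hq Hv; induction k; simpl; [apply ev_one|].
  apply ev_mul; auto using conv_pow.
Qed.

Lemma conv_add (a b : fps) : conv a -> conv b -> conv (fadd a b).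
Proof.
  intros Ha Hb; apply conv_of_ev; intros q Hq.
  destruct (conv_ev a q Ha Hq) as [u Hu]; destruct (conv_ev b q Hb Hq) as [v Hv].
  exists (u + v); now apply ev_add.
Qed.

Definition fshift (k : nat) (a : fps) : fps := fun n => if Nat.leb k n then a (n - k)%nat else 0%Z.

Lemma cev_shift (k : nat) (a : nat -> C) (q v : C) : cev a q v ->
  cev (fun n => if Nat.leb k n then a (n - k)%nat else 0) q (q ^ k * v).
Proof.
  intros H; apply (Ccv_eventually _ _ k).
  eapply Ccv_ext; [|apply (Ccv_scal (q ^ k)), H]; intros n; cbv beta.
  induction n as [|n IH].
  - simpl; rewrite Cmult_0_r, (Csum_ext _ (fun _ => 0)), Csum_zero; [reflexivity|].
    intros i Hi; destruct (Nat.leb_spec k i); [lia|ring].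
  - simpl; rewrite <- IH; destruct (Nat.leb_spec k (n + k)); [|lia].
    replace (n + k - k)%nat with n by lia; rewrite Cpow_add_r; ring.
Qed.

Lemma ev_shift (k : nat) (a : fps) (q v : C) : ev a q v -> ev (fshift k a) q (q ^ k * v).
Proof.
  intros H; eapply Ccv_ext; [|apply (cev_shift k _ _ _ H)]; intros n; apply Csum_ext; intros i _.
  unfold injC, fshift; destruct (Nat.leb k i); reflexivity.
Qed.

(** * Euler's product as a power series *)

Definition fX (m : nat) : fps := fun n => if Nat.eqb n m then 1%Z else 0%Z.
Definition one_minus_X (m : nat) : fps := fsub fone (fX m).
Definition fgeom (m : nat) : fps := fun n => if Nat.eqb (n mod m) 0 then 1%Z else 0%Z.

Lemma Zsum_single (f : nat -> Z) (m n : nat) :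
  Zsum (fun i => if Nat.eqb i m then f i else 0%Z) n = if Nat.ltb m n then f m else 0%Z.
Proof.
  induction n as [|n IH]; [reflexivity|]; cbn [Zsum]; rewrite IH.
  destruct (Nat.eqb_spec n m) as [E|Hne].
  - subst m; destruct (Nat.ltb_spec n n), (Nat.ltb_spec n (S n)); lia.
  - destruct (Nat.ltb_spec m n), (Nat.ltb_spec m (S n)); lia.
Qed.

Lemma fmul_fX (m : nat) (a : fps) : fmul (fX m) a = fshift m a.
Proof.
  extensionality n; unfold fmul, fX, fshift.
  rewrite (Zsum_ext _ (fun i => if Nat.eqb i m then a (n - i)%nat else 0%Z)).
  - rewrite (Zsum_single (fun i => a (n - i)%nat)); destruct (Nat.ltb_spec m (S n)), (Nat.leb_spec m n); lia.
  - intros i _; destruct (Nat.eqb i m); ring.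
Qed.

Lemma one_minus_X_geom (m : nat) : (0 < m)%nat -> fmul (one_minus_X m) (fgeom m) = fone.
Proof.
  intros Hm; unfold one_minus_X.
  replace (fmul (fsub fone (fX m)) (fgeom m)) with (fsub (fgeom m) (fmul (fX m) (fgeom m))) by ring.
  rewrite fmul_fX; extensionality n; unfold fsub, fshift, fgeom, fone.
  destruct (Nat.leb_spec m n) as [H|H].
  - replace (n mod m)%nat with ((n - m) mod m)%nat.
    + destruct n; [lia|]; cbn [Nat.eqb]; ring.
    + rewrite <- (Nat.Div0.mod_add (n - m) 1 m); f_equal; lia.
  - rewrite Nat.mod_small by exact H; ring.
Qed.

Fixpoint euler_part (L : nat) : fps :=
  match L with O => fone | S k => fmul (euler_part k) (one_minus_X (S k)) end.
Fixpoint partition_part (L : nat) : fps :=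
  match L with O => fone | S k => fmul (partition_part k) (fgeom (S k)) end.

Definition euler : fps := fun n => euler_part n n.
Definition partitions : fps := fun n => partition_part n n.

Lemma fmul_first (a b : fps) (n : nat) : b 0%nat = 1%Z ->
  (forall j, (0 < j <= n)%nat -> b j = 0%Z) -> fmul a b n = a n.
Proof.
  intros H0 H; rewrite fmul_comm; unfold fmul; rewrite Zsum_shift, H0, Nat.sub_0_r.
  rewrite (Zsum_ext _ (fun _ => 0%Z)); [rewrite Zsum_zero; ring|].
  intros i Hi; rewrite H by lia; ring.
Qed.

Lemma one_minus_X_low (m j : nat) : (0 < j < m)%nat -> one_minus_X m j = 0%Z.
Proof.
  intros Hj; unfold one_minus_X, fsub, fone, fX.
  destruct (Nat.eqb_spec j 0), (Nat.eqb_spec j m); lia.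
Qed.

Lemma fgeom_low (m j : nat) : (0 < j < m)%nat -> fgeom m j = 0%Z.
Proof.
  intros Hj; unfold fgeom; rewrite Nat.mod_small by lia; destruct (Nat.eqb_spec j 0); lia.
Qed.

Lemma euler_part_stable (L n : nat) : (n <= L)%nat -> euler_part L n = euler n.
Proof.
  intros H; unfold euler; induction H as [|L H IH]; [reflexivity|].
  rewrite <- IH; simpl; apply fmul_first; [reflexivity|].
  intros j Hj; apply one_minus_X_low; lia.
Qed.

Lemma partition_part_stable (L n : nat) : (n <= L)%nat -> partition_part L n = partitions n.
Proof.
  intros H; unfold partitions; induction H as [|L H IH]; [reflexivity|].
  rewrite <- IH; simpl; apply fmul_first; [|intros j Hj; apply fgeom_low; lia].
  unfold fgeom; rewrite Nat.Div0.mod_0_l; reflexivity.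
Qed.

Lemma fmul_local (a a' b b' : fps) (n : nat) :
  (forall i, (i <= n)%nat -> a i = a' i) -> (forall i, (i <= n)%nat -> b i = b' i) ->
  fmul a b n = fmul a' b' n.
Proof. intros Ha Hb; unfold fmul; apply Zsum_ext; intros i Hi; rewrite Ha, Hb by lia; reflexivity. Qed.

Lemma euler_partitions : fmul euler partitions = fone.
Proof.
  assert (H : forall L, fmul (euler_part L) (partition_part L) = fone).
  { induction L as [|L IH]; simpl; [ring|].
    transitivity (fmul (fmul (euler_part L) (partition_part L)) (fmul (one_minus_X (S L)) (fgeom (S L)))); [ring|].
    rewrite IH, one_minus_X_geom by lia; ring. }
  extensionality n; rewrite <- (H n); apply fmul_local; intros i Hi; symmetry.
  - now apply euler_part_stable.
  - now apply partition_part_stable.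
Qed.

Lemma Zsum_nonneg (f : nat -> Z) (n : nat) : (forall i, (i < n)%nat -> (0 <= f i)%Z) -> (0 <= Zsum f n)%Z.
Proof. induction n as [|n IH]; intros H; simpl; [lia|]. specialize (IH ltac:(auto)); specialize (H n ltac:(lia)); lia. Qed.

Lemma Zsum_le (f g : nat -> Z) (n : nat) : (forall i, (i < n)%nat -> (f i <= g i)%Z) -> (Zsum f n <= Zsum g n)%Z.
Proof. induction n as [|n IH]; intros H; simpl; [lia|]. specialize (IH ltac:(auto)); specialize (H n ltac:(lia)); lia. Qed.

Lemma Zsum_abs (f : nat -> Z) (n : nat) : (Z.abs (Zsum f n) <= Zsum (fun i => Z.abs (f i)) n)%Z.
Proof. induction n as [|n IH]; simpl; lia. Qed.

Lemma fmul_abs_le (a b A B : fps) (n : nat) :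
  (forall i, (Z.abs (a i) <= A i)%Z) -> (forall i, (Z.abs (b i) <= B i)%Z) ->
  (Z.abs (fmul a b n) <= fmul A B n)%Z.
Proof.
  intros HA HB; unfold fmul; eapply Z.le_trans; [apply Zsum_abs|]; apply Zsum_le; intros i _.
  rewrite Z.abs_mul; apply Z.mul_le_mono_nonneg; auto using Z.abs_nonneg.
Qed.

Lemma fgeom_nonneg (m n : nat) : (0 <= fgeom m n)%Z.
Proof. unfold fgeom; destruct (Nat.eqb _ _); lia. Qed.

Lemma partition_part_nonneg (L n : nat) : (0 <= partition_part L n)%Z.
Proof.
  revert n; induction L as [|L IH]; intros n; simpl.
  - unfold fone; destruct (Nat.eqb n 0); lia.
  - unfold fmul; apply Zsum_nonneg; intros i _; apply Z.mul_nonneg_nonneg; auto using fgeom_nonneg.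
Qed.

Lemma partition_part_mono (L n : nat) : (partition_part L n <= partition_part (S L) n)%Z.
Proof.
  simpl; unfold fmul; cbn [Zsum]; rewrite Nat.sub_diag.
  assert (E : fgeom (S L) 0%nat = 1%Z) by (unfold fgeom; rewrite Nat.Div0.mod_0_l; reflexivity).
  rewrite E.
  assert (0 <= Zsum (fun i => partition_part L i * fgeom (S L) (n - i)%nat) n)%Z; [|lia].
  apply Zsum_nonneg; intros i _; apply Z.mul_nonneg_nonneg; auto using fgeom_nonneg, partition_part_nonneg.
Qed.

Lemma partition_part_le (L n : nat) : (partition_part L n <= partitions n)%Z.
Proof.
  rewrite <- (partition_part_stable (L + n) n) by lia.
  generalize n at 2 as m; intros m; induction m as [|m IH]; [rewrite Nat.add_0_r; lia|].
  rewrite Nat.add_succ_r; pose proof (partition_part_mono (L + m) n); lia.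
Qed.

(** Coefficientwise [1 - X^m] is dominated by [1 / (1 - X^m)]; hence every bound for the partition
    series serves Euler's product too. *)
Lemma euler_part_le (L n : nat) : (Z.abs (euler_part L n) <= partition_part L n)%Z.
Proof.
  revert n; induction L as [|L IH]; intros n; simpl.
  - unfold fone; destruct (Nat.eqb n 0); lia.
  - apply fmul_abs_le; auto; intros i; unfold one_minus_X, fsub, fone, fX, fgeom.
    destruct (Nat.eqb_spec i 0) as [->|H0].
    + rewrite Nat.Div0.mod_0_l; simpl; lia.
    + destruct (Nat.eqb_spec i (S L)) as [->|H1].
      * rewrite Nat.Div0.mod_same; simpl; lia.
      * destruct (Nat.eqb _ _); lia.
Qed.

Lemma Rsum_plus (f g : nat -> R) (n : nat) :
  Rsum (fun i => f i + g i)%R n = (Rsum f n + Rsum g n)%R.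
Proof. induction n as [|n IH]; simpl; [ring|rewrite IH; ring]. Qed.

Definition abs_sum (a : fps) (r : R) (N : nat) : R := Rsum (fun i => Cmod (injC a i) * r ^ i)%R N.

Lemma Cmod_injC (a : fps) (n : nat) : Cmod (injC a n) = IZR (Z.abs (a n)).
Proof. unfold injC; rewrite Cmod_R, abs_IZR; reflexivity. Qed.

Lemma abs_sum_nonneg (a : fps) (r : R) (N : nat) : (0 <= r)%R -> (0 <= abs_sum a r N)%R.
Proof. intros Hr; apply Rsum_nonneg; now apply summable_nonneg_term. Qed.

Lemma abs_sum_mul (a b : fps) (r : R) (N : nat) : (0 <= r)%R ->
  (abs_sum (fmul a b) r N <= abs_sum a r N * abs_sum b r N)%R.
Proof.
  intros Hr.
  assert (H : (abs_sum (fmul a b) r N <= Rsum (fun i => Cmod (injC a i) * r ^ i * abs_sum b r (N - i)) N)%R).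
  { unfold abs_sum; induction N as [|N IH]; [simpl; lra|].
    cbn [Rsum].
    rewrite (Rsum_ext (fun i => Cmod (injC a i) * r ^ i * Rsum _ (S N - i))%R
      (fun i => Cmod (injC a i) * r ^ i * Rsum (fun j => Cmod (injC b j) * r ^ j)%R (N - i) +
         r ^ N * (Cmod (injC a i) * Cmod (injC b (N - i)%nat)))%R).
    - rewrite (Rsum_plus (fun i => Cmod (injC a i) * r ^ i * Rsum (fun j => Cmod (injC b j) * r ^ j)%R (N - i))%R), Rsum_scal.
      replace (S N - N)%nat with 1%nat by lia; cbn [Rsum pow].
      assert (Hc : (Cmod (injC (fmul a b) N) <= Rsum (fun i => Cmod (injC a i) * Cmod (injC b (N - i)%nat))%R (S N))%R).
      { rewrite injC_fmul; unfold cmul; apply Csum_le; intros i _; rewrite Cmod_mult; lra. }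
      cbn [Rsum] in Hc; rewrite Nat.sub_diag in Hc.
      pose proof (pow_le r N Hr). nra.
    - intros i Hi; replace (S N - i)%nat with (S (N - i)) by lia; cbn [Rsum].
      replace (r ^ N)%R with (r ^ i * r ^ (N - i))%R by (rewrite <- pow_add; f_equal; lia). ring. }
  eapply Rle_trans; [exact H|].
  rewrite Rmult_comm; change (abs_sum a r N) with (Rsum (fun i => Cmod (injC a i) * r ^ i)%R N).
  rewrite <- Rsum_scal; apply Rsum_le; intros i Hi.
  rewrite Rmult_comm; apply Rmult_le_compat_r; [now apply summable_nonneg_term|].
  apply Rsum_mono; [now apply summable_nonneg_term|lia].
Qed.

(** Among the first [m] terms only the constant one is nonzero, and the rest repeats the series with
    a factor [r^m]. So the partial sum [x] satisfies [x <= 1 + r^m x], which is solved for [x]. *)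
Lemma fgeom_abs_sum (m N : nat) (r : R) : (0 < m)%nat -> (0 <= r < 1)%R ->
  (abs_sum (fgeom m) r N <= / (1 - r ^ m))%R.
Proof.
  intros Hm Hr.
  assert (Hrm : (0 <= r ^ m < 1)%R).
  { split; [apply pow_le; lra|]; destruct m; [lia|]; apply pow_lt_1_compat; [lra|lia]. }
  assert (Hsmall : forall N, (N <= m)%nat -> (abs_sum (fgeom m) r N <= 1)%R).
  { intros [|n] Hn; [unfold abs_sum; simpl; lra|].
    unfold abs_sum; rewrite Rsum_shift, (Rsum_ext _ (fun _ => 0 * 0)%R), Rsum_scal.
    - rewrite Cmod_injC; unfold fgeom; rewrite Nat.Div0.mod_0_l; simpl; lra.
    - intros i Hi; rewrite Cmod_injC, fgeom_low by lia; simpl; ring. }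
  assert (Hrec : (abs_sum (fgeom m) r N <= 1 + r ^ m * abs_sum (fgeom m) r N)%R).
  { pose proof (abs_sum_nonneg (fgeom m) r N ltac:(lra)).
    destruct (Nat.le_gt_cases N m) as [HN|HN]; [specialize (Hsmall N HN); nra|].
    assert (Hle : (abs_sum (fgeom m) r (N - m) <= abs_sum (fgeom m) r N)%R).
    { apply Rsum_mono; [apply summable_nonneg_term; lra|lia]. }
    assert (E : abs_sum (fgeom m) r N = (abs_sum (fgeom m) r m + r ^ m * abs_sum (fgeom m) r (N - m))%R).
    { unfold abs_sum; replace N with (m + (N - m))%nat at 1 by lia.
      rewrite Rsum_add, <- Rsum_scal; f_equal; apply Rsum_ext; intros i _.
      rewrite !Cmod_injC, pow_add; unfold fgeom.
      replace (m + i)%nat with (i + 1 * m)%nat by lia; rewrite Nat.Div0.mod_add; ring. }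
    rewrite E at 1; specialize (Hsmall m ltac:(lia)); nra. }
  apply (Rmult_le_reg_l (1 - r ^ m)); [lra|]; rewrite Rinv_r by lra; lra.
Qed.

(** For [x = r^m] one has [1 / (1 - x) = 1 + x / (1 - x) <= exp (x / (1 - r))]. The exponents add up
    to a geometric sum, so the bound stays finite as [L] grows. *)
Lemma partition_part_abs_sum (L N : nat) (r : R) : (0 <= r < 1)%R ->
  (abs_sum (partition_part L) r N <= exp (/ (1 - r) * Rsum (fun i => r ^ S i) L))%R.
Proof.
  intros Hr; induction L as [|L IH].
  - simpl Rsum; rewrite Rmult_0_r, exp_0; unfold abs_sum.
    destruct N as [|N]; [simpl; lra|].
    rewrite Rsum_shift, (Rsum_ext _ (fun _ => 0%R)).
    + rewrite Cmod_injC; simpl; assert (Hz : forall n, Rsum (fun _ => 0%R) n = 0%R) by (induction n; simpl; lra).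
      rewrite Hz; lra.
    + intros i _; rewrite Cmod_injC; simpl; ring.
  - cbn [partition_part Rsum]; rewrite Rmult_plus_distr_l, exp_plus.
    eapply Rle_trans; [apply abs_sum_mul; lra|].
    apply Rmult_le_compat; try (apply abs_sum_nonneg; lra); [exact IH|].
    eapply Rle_trans; [apply fgeom_abs_sum; [lia|lra]|].
    set (x := (r ^ S L)%R).
    assert (Hx : (0 <= x <= r)%R).
    { unfold x; split; [apply pow_le; lra|]; simpl.
      assert (r ^ L <= 1)%R by (rewrite <- (pow1 L); apply pow_incr; lra). 
      pose proof (pow_le r L ltac:(lra)); nra. }
    eapply Rle_trans; [|apply exp_ineq1_le].
    assert (Hi : (/ (1 - x) <= / (1 - r))%R) by (apply Rinv_le_contravar; lra).
    replace (/ (1 - x))%R with (1 + / (1 - x) * x)%R by (field; lra). nra.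
Qed.

Lemma conv_bounded (a : fps) : (forall r, (0 <= r < 1)%R -> exists B, forall n, (abs_sum a r n <= B)%R) -> conv a.
Proof. intros H r Hr; split; [apply summable_nonneg_term; lra|apply H, Hr]. Qed.

Lemma abs_sum_le (a b : fps) (r : R) (N : nat) : (0 <= r)%R ->
  (forall i, (i < N)%nat -> (Z.abs (a i) <= Z.abs (b i))%Z) -> (abs_sum a r N <= abs_sum b r N)%R.
Proof.
  intros Hr H; apply Rsum_le; intros i Hi; rewrite !Cmod_injC.
  apply Rmult_le_compat_r; [apply pow_le; lra|apply IZR_le; auto].
Qed.

Lemma conv_dominated (a b : fps) : (forall i, (Z.abs (a i) <= Z.abs (b i))%Z) -> conv b -> conv a.
Proof.
  intros H Hb; apply conv_bounded; intros r Hr; destruct (Hb r Hr) as [_ [B HB]].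
  exists B; intros n; eapply Rle_trans; [apply abs_sum_le; [lra|intros; apply H]|apply HB].
Qed.

Lemma conv_partitions : conv partitions.
Proof.
  apply conv_bounded; intros r Hr; exists (exp (/ (1 - r) * / (1 - r))); intros n.
  eapply Rle_trans; [apply (abs_sum_le _ (partition_part n)); [lra|]|].
  - intros i Hi; rewrite (partition_part_stable n i) by lia; lia.
  - eapply Rle_trans; [apply partition_part_abs_sum, Hr|]; apply exp_mono.
    assert (Hp : (0 < / (1 - r))%R) by (apply Rinv_0_lt_compat; lra).
    apply Rmult_le_compat_l; [lra|].
    eapply Rle_trans; [|apply (Rsum_geom r (S n) Hr)].
    rewrite Rsum_shift; simpl; lra.
Qed.

Lemma partitions_nonneg (n : nat) : (0 <= partitions n)%Z.
Proof. apply partition_part_nonneg. Qed.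

Lemma euler_part_le_partitions (L n : nat) : (Z.abs (euler_part L n) <= Z.abs (partitions n))%Z.
Proof.
  pose proof (euler_part_le L n); pose proof (partition_part_le L n); pose proof (partitions_nonneg n); lia.
Qed.

Lemma conv_euler : conv euler.
Proof.
  apply (conv_dominated _ partitions); [|apply conv_partitions].
  intros i; apply euler_part_le_partitions.
Qed.

Lemma ev_fX (m : nat) (q : C) : ev (fX m) q (q ^ m).
Proof.
  pose proof (ev_shift m fone q 1 (ev_one q)) as H; rewrite <- fmul_fX in H.
  replace (fmul (fX m) fone) with (fX m) in H by ring; now rewrite Cmult_1_r in H.
Qed.

Lemma ev_one_minus_X (m : nat) (q : C) : (0 < m)%nat -> ev (one_minus_X m) q (1 - q ^ m).
Proof.
  intros Hm.
  pose proof (ev_add _ _ _ _ _ (ev_one q) (ev_fscal (-1) _ _ _ (ev_fX m q))) as H.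
  eapply Ccv_eq; [|eapply Ccv_ext; [|exact H]].
  - replace (RtoC (IZR (-1))) with (- (1)) by (rewrite <- RtoC_opp; f_equal; lra); ring.
  - intros n; apply Csum_ext; intros i _; unfold injC, one_minus_X, fadd, fsub; do 3 f_equal; lia.
Qed.

Lemma conv_one_minus_X (m : nat) : (0 < m)%nat -> conv (one_minus_X m).
Proof. intros Hm; apply conv_of_ev; intros q _; eexists; now apply ev_one_minus_X. Qed.

Lemma conv_euler_part (L : nat) : conv (euler_part L).
Proof. induction L; simpl; [apply conv_one|apply conv_mul; auto; apply conv_one_minus_X; lia]. Qed.

Lemma ev_euler_part (L : nat) (q : C) : (Cmod q < 1)%R ->
  ev (euler_part L) q (Cprod (fun i => 1 - q ^ S i) L).
Proof.
  intros Hq; induction L as [|L IH]; [apply ev_one|].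
  cbn [euler_part Cprod]; apply ev_mul; auto using conv_euler_part.
  - apply conv_one_minus_X; lia.
  - apply ev_one_minus_X; lia.
Qed.

(** Links the formal series with the analytic product: [euler_part L] and [euler] agree below [L]
    and are both dominated by [partitions] above, so their values differ by at most twice a tail. *)
Lemma ev_euler (q v : C) : (Cmod q < 1)%R -> ev euler q v -> eulerP q v.
Proof.
  intros Hq Hv eps Heps.
  pose proof (Cmod_ge_0 q) as Hq0.
  destruct (conv_partitions (Cmod q) ltac:(lra)) as [Hp HB].
  destruct (summable_cauchy _ (conj Hp HB) (eps / 4)%R) as [N HN]; [lra|].
  exists N; intros L HL.
  pose proof (ev_euler_part L q Hq) as HE.
  apply Rle_lt_trans with (eps / 2)%R; [|lra].
  apply (Ccv_le (fun n => Csum (fun i => injC (euler_part L) i * q ^ i) n - Csum (fun i => injC euler i * q ^ i) n) _ _ L).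
  - apply Ccv_minus; [exact HE|exact Hv].
  - intros n Hn.
    assert (Hb : (Cmod (Csum (fun i => (injC (euler_part L) i * q ^ i)%C) n - Csum (fun i => (injC euler i * q ^ i)%C) n) <=
      2 * (abs_sum partitions (Cmod q) n - abs_sum partitions (Cmod q) L))%R).
    { induction Hn as [|n Hn IH].
      - rewrite (Csum_ext (fun i => injC (euler_part L) i * q ^ i) (fun i => injC euler i * q ^ i)).
        + unfold Cminus; rewrite Cplus_opp_r, Cmod_0; lra.
        + intros i Hi; unfold injC; rewrite euler_part_stable by lia; reflexivity.
      - cbn [Csum]; unfold abs_sum at 1; cbn [Rsum]; fold (abs_sum partitions (Cmod q) n).
        match goal with |- (Cmod (?a + ?b - (?c + ?d)) <= _)%R => replace (a + b - (c + d)) with ((a - c) + (b - d)) by ring end.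
        eapply Rle_trans; [apply Cmod_triangle|].
        assert (Hd : forall K, (Cmod (injC (euler_part K) n * q ^ n) <= Cmod (injC partitions n) * Cmod q ^ n)%R).
        { intros K; rewrite Cmod_mult, Cmod_pow, !Cmod_injC; apply Rmult_le_compat_r; [apply pow_le; lra|].
          apply IZR_le, euler_part_le_partitions. }
        pose proof (Cmod_minus_le (injC (euler_part L) n * q ^ n) (injC euler n * q ^ n)).
        pose proof (Hd L); pose proof (Hd n) as Hdn; change (injC (euler_part n) n) with (injC euler n) in Hdn. lra. }
    specialize (HN L n HL Hn); unfold abs_sum in Hb; lra.
Qed.

(** * Roots of unity, [U_p] and [q -> q^p] *)

Lemma nome_IZR (z : Z) : nome (IZR z) = 1.
Proof.
  assert (Hn : forall n : nat, nome (INR n) = 1).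
  { intros n; replace (RtoC (INR n)) with (INR n * 1) by ring; rewrite <- nome_pow, nome_1; apply Cpow_1_l. }
  destruct (Z.le_ge_cases 0 z) as [H|H].
  - rewrite <- (Z2Nat.id z H), <- INR_IZR_INZ; apply Hn.
  - replace (RtoC (IZR z)) with (- INR (Z.to_nat (- z))).
    + rewrite nome_opp, Hn; field.
    + rewrite INR_IZR_INZ, Z2Nat.id, opp_IZR, RtoC_opp by lia; ring.
Qed.

Lemma nome_frac_neq_1 (u : R) : (0 < u < 1)%R -> nome u <> 1.
Proof.
  intros Hu E; apply (f_equal fst) in E; unfold nome, Cexp in E; simpl in E.
  replace (((2 * PI - 0 * 0) * 0 - (2 * 0 + 0 * PI) * 1) * u -
      ((2 * PI - 0 * 0) * 1 + (2 * 0 + 0 * PI) * 0) * 0)%R with 0%R in E by ring.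
  replace (((2 * PI - 0 * 0) * 0 - (2 * 0 + 0 * PI) * 1) * 0 +
      ((2 * PI - 0 * 0) * 1 + (2 * 0 + 0 * PI) * 0) * u)%R with (2 * (PI * u))%R in E by ring.
  rewrite exp_0, Rmult_1_l, cos_2a_sin in E.
  assert (Hs : (0 < sin (PI * u))%R) by (apply sin_gt_0; pose proof PI_RGT_0; nra).
  nra.
Qed.

Lemma Csum_geom (x : C) (n : nat) : (1 - x) * Csum (fun b => x ^ b) n = 1 - x ^ n.
Proof. induction n as [|n IH]; simpl; [ring|rewrite Cmult_plus_distr_l, IH; ring]. Qed.

Lemma root_sum (N : nat) (z : Z) : (0 < N)%nat ->
  Csum (fun b => nome (INR b * (IZR z / INR N))) N =
  if Z.eqb (z mod Z.of_nat N) 0 then RtoC (INR N) else 0.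
Proof.
  intros HN.
  assert (HN0 : RtoC (INR N) <> 0) by (apply RtoC_neq_0, not_0_INR; lia).
  set (x := nome (IZR z / INR N)).
  rewrite (Csum_ext _ (fun b => x ^ b)) by (intros b _; unfold x; rewrite nome_pow; reflexivity).
  assert (HxN : x ^ N = 1).
  { unfold x; rewrite nome_pow; replace (INR N * (IZR z / INR N)) with (RtoC (IZR z)) by (field; auto); apply nome_IZR. }
  assert (Hx : x = nome (IZR (z mod Z.of_nat N) / INR N)).
  { unfold x; rewrite (Z.div_mod z (Z.of_nat N)) at 1 by lia.
    rewrite plus_IZR, mult_IZR, <- INR_IZR_INZ, RtoC_plus, RtoC_mult.
    replace ((INR N * IZR (z / Z.of_nat N) + IZR (z mod Z.of_nat N)) / INR N)
      with (IZR (z / Z.of_nat N) + IZR (z mod Z.of_nat N) / INR N) by (field; auto).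
    rewrite nome_plus, nome_IZR; ring. }
  destruct (Z.eqb_spec (z mod Z.of_nat N) 0) as [E|E].
  - assert (Hx1 : x = 1).
    { rewrite Hx, E; replace (IZR 0 / INR N) with (RtoC (IZR 0)) by (field; auto); apply nome_IZR. }
    rewrite Hx1; clear; induction N as [|N IH]; [reflexivity|].
    cbn [Csum]; rewrite IH, S_INR, RtoC_plus, Cpow_1_l; reflexivity.
  - assert (Hx1 : x <> 1).
    { rewrite Hx, <- RtoC_div by (apply not_0_INR; lia); apply nome_frac_neq_1.
      pose proof (Z.mod_pos_bound z (Z.of_nat N) ltac:(lia)) as Hb.
      assert (Hp : (0 < INR N)%R) by (apply lt_0_INR; lia).
      split; [apply Rdiv_lt_0_compat; auto; apply IZR_lt; lia|].
      apply (Rmult_lt_reg_r (INR N)); auto; unfold Rdiv; rewrite Rmult_assoc, Rinv_l, Rmult_1_r, Rmult_1_l by lra.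
      rewrite INR_IZR_INZ; apply IZR_lt; lia. }
    pose proof (Csum_geom x N) as G; rewrite HxN in G.
    assert (H1 : 1 - x <> 0) by (apply Cminus_neq_0; auto).
    replace (Csum (fun b => x ^ b) N) with ((1 - x) * Csum (fun b => x ^ b) N / (1 - x)) by (field; auto).
    rewrite G; field; auto.
Qed.

Definition fU (p : nat) (a : fps) : fps := fun n => a (p * n)%nat.
Definition fspread (p : nat) (a : fps) : fps :=
  fun n => if Nat.eqb (n mod p) 0 then a (n / p)%nat else 0%Z.

Lemma Csum_multiples (p : nat) (f : nat -> C) : (0 < p)%nat ->
  (forall n, (n mod p <> 0)%nat -> f n = 0) ->
  forall k j, (j < p)%nat ->
    Csum f (p * k + j) = Csum (fun n => f (p * n)%nat) (k + (if Nat.eqb j 0 then 0 else 1)).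
Proof.
  intros Hp Hf.
  assert (Hstep : forall k j, (j < p)%nat -> Csum f (p * k) = Csum (fun n => f (p * n)%nat) k ->
    Csum f (p * k + S j) = Csum (fun n => f (p * n)%nat) (k + 1)).
  { intros k j Hj H0; induction j as [|j IHj].
    - rewrite !Nat.add_1_r; cbn [Csum]; rewrite H0; reflexivity.
    - rewrite Nat.add_succ_r; cbn [Csum]; rewrite IHj by lia.
      rewrite (Hf (p * k + S j)%nat); [ring|].
      replace (p * k + S j)%nat with (S j + k * p)%nat by lia.
      rewrite Nat.Div0.mod_add, Nat.mod_small by lia; lia. }
  assert (H0 : forall k, Csum f (p * k) = Csum (fun n => f (p * n)%nat) k).
  { induction k as [|k IH]; [rewrite Nat.mul_0_r; reflexivity|].
    replace (p * S k)%nat with (p * k + S (p - 1))%nat by lia.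
    rewrite (Hstep k (p - 1)%nat ltac:(lia) IH), Nat.add_1_r; reflexivity. }
  intros k [|j] Hj.
  - simpl Nat.eqb; rewrite !Nat.add_0_r; apply H0.
  - simpl Nat.eqb; apply Hstep; [lia|apply H0].
Qed.

Lemma ev_spread (p : nat) (a : fps) (q v : C) : (0 < p)%nat ->
  ev a (q ^ p) v -> ev (fspread p a) q v.
Proof.
  intros Hp H eps Heps; destruct (H eps Heps) as [N HN]; exists (p * N)%nat; intros n Hn.
  rewrite (Nat.div_mod_eq n p).
  rewrite (Csum_multiples p _ Hp).
  - rewrite (Csum_ext _ (fun i => injC a i * (q ^ p) ^ i)).
    + apply HN; assert (N <= n / p)%nat by (apply Nat.div_le_lower_bound; lia); lia.
    + intros i _; unfold injC, fspread.
      rewrite (Nat.mul_comm p i), Nat.Div0.mod_mul, Nat.div_mul, Nat.mul_comm, Cpow_mult_r by lia; reflexivity.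
  - intros i Hi; unfold injC, fspread; destruct (Nat.eqb_spec (i mod p) 0); [lia|ring].
  - apply Nat.mod_upper_bound; lia.
Qed.

Lemma conv_spread (p : nat) (a : fps) : (0 < p)%nat -> conv a -> conv (fspread p a).
Proof.
  intros Hp Ha; apply conv_of_ev; intros q Hq.
  destruct (conv_ev a (q ^ p) Ha) as [v Hv].
  - rewrite Cmod_pow; pose proof (Cmod_ge_0 q); destruct p; [lia|]; apply pow_lt_1_compat; [lra|lia].
  - exists v; now apply ev_spread.
Qed.

Lemma Ccv_Csum (u : nat -> nat -> C) (v : nat -> C) (p : nat) :
  (forall b, (b < p)%nat -> Ccv (u b) (v b)) -> Ccv (fun n => Csum (fun b => u b n) p) (Csum v p).
Proof.
  induction p as [|p IH]; intros H; simpl; [apply Ccv_const|apply Ccv_plus; auto].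
Qed.

(** Averaging over the [p]-th roots of unity keeps exactly the exponents divisible by [p]. The
    partial sums are read off at multiples of [p], where they correspond to partial sums of
    [fU p a]. *)
Lemma ev_U (p : nat) (a : fps) (Q : C) (v : nat -> C) : (0 < p)%nat ->
  (forall b, (b < p)%nat -> ev a (nome (INR b / INR p) * Q) (v b)) ->
  ev (fU p a) (Q ^ p) (/ INR p * Csum v p).
Proof.
  intros Hp H.
  assert (Hp0 : RtoC (INR p) <> 0) by (apply RtoC_neq_0, not_0_INR; lia).
  pose proof (Ccv_Csum _ _ p H) as HS; cbv beta in HS.
  apply (Ccv_ext (fun n => / INR p * Csum (fun b => Csum (fun i => injC a i * (nome (INR b / INR p) * Q) ^ i) (p * n)) p)).
  - intros n; rewrite <- Csum_swap.
    rewrite (Csum_ext _ (fun i => (if Nat.eqb (i mod p) 0 then RtoC (INR p) else 0) * (injC a i * Q ^ i))).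
    + pose proof (Csum_multiples p (fun i => (if Nat.eqb (i mod p) 0 then RtoC (INR p) else 0) * (injC a i * Q ^ i)) Hp) as M.
      specialize (M ltac:(intros i Hi; cbv beta; destruct (Nat.eqb_spec (i mod p) 0); [lia|ring]) n 0%nat Hp).
      simpl Nat.eqb in M; rewrite !Nat.add_0_r in M; rewrite M, <- Csum_scal; apply Csum_ext; intros i _.
      rewrite (Nat.mul_comm p i), Nat.Div0.mod_mul; simpl Nat.eqb; unfold injC, fU.
      rewrite (Nat.mul_comm i p), Cpow_mult_r; field; auto.
    + intros i _.
      rewrite (Csum_ext _ (fun b => (injC a i * Q ^ i) * nome (INR b * (IZR (Z.of_nat i) / INR p)))).
      * rewrite Csum_scal, root_sum by exact Hp.
        rewrite <- Nat2Z.inj_mod; destruct (Z.eqb_spec (Z.of_nat (i mod p)) 0), (Nat.eqb_spec (i mod p) 0); try lia; ring.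
      * intros b _; rewrite Cpow_mult_l, nome_pow, <- INR_IZR_INZ.
        replace (INR i * (INR b / INR p)) with (INR b * (INR i / INR p)) by (field; auto); ring.
  - apply Ccv_scal; apply (Ccv_subseq (fun n => Csum (fun b => Csum (fun i => injC a i * (nome (INR b / INR p) * Q) ^ i) n) p) (fun n => p * n)%nat); [|exact HS].
    intros n; nia.
Qed.

(** * Vanishing of modular functions that vanish at the cusp *)

Lemma nome_surj (r : R) : (0 < r < 1)%R -> exists t, (0 < Im t)%R /\ nome t = RtoC r.
Proof.
  intros Hr; pose proof PI_RGT_0 as HPI.
  assert (Hln : (ln r < 0)%R) by (rewrite <- ln_1; apply ln_increasing; lra).
  exists (0, - ln r / (2 * PI))%R; split.
  - simpl; apply Rdiv_lt_0_compat; lra.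
  - unfold nome, Cexp; simpl.
    match goal with |- ((exp ?u * cos ?v)%R, _) = _ =>
      replace u with (ln r) by (field; lra); replace v with 0%R by ring end.
    rewrite exp_ln, cos_0, sin_0 by lra; unfold RtoC; f_equal; ring.
Qed.

Lemma Im_S_inv (t : C) : t <> 0 -> Im (- (1) / t) = (Im t / (Cmod t * Cmod t))%R.
Proof.
  intros Ht; rewrite Cmod_sqr.
  assert (Hp : (0 < Re t * Re t + Im t * Im t)%R).
  { rewrite <- Cmod_sqr; assert (0 < Cmod t)%R by (apply Cmod_gt_0; auto); nra. }
  destruct t as [a b]; simpl in *; field; lra.
Qed.

(** Translate to [|Re t| <= 1/2]. If still [Im t < 1/2], then [|t|^2 <= 1/2] and inversion at least
    doubles the imaginary part, so finitely many rounds suffice. *)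
Lemma reduce_to_half (f : C -> C) :
  (forall t, (0 < Im t)%R -> f (- (1) / t) = f t) ->
  (forall t (n : Z), (0 < Im t)%R -> f (t + IZR n) = f t) ->
  forall t, (0 < Im t)%R -> exists t', (1 / 2 <= Im t')%R /\ f t' = f t.
Proof.
  intros HS HT.
  assert (H : forall k t, (0 < Im t)%R -> (1 / 2 <= 2 ^ k * Im t)%R -> exists t', (1 / 2 <= Im t')%R /\ f t' = f t).
  { induction k as [|k IH]; intros t Ht Hk.
    - exists t; simpl in Hk; split; [lra|reflexivity].
    - destruct (Rle_dec (1 / 2) (Im t)) as [Hl|Hl]; [exists t; split; auto|].
      (* [up (x - 1/2)] is an integer nearest to [x]. *)
      destruct (archimed (Re t - 1 / 2)) as [Ha Hb].
      set (n := up (Re t - 1 / 2)) in *.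
      set (t1 := t + IZR (- n)).
      assert (Hi : Im t1 = Im t) by (unfold t1; destruct t; simpl; ring).
      assert (Hr : Re t1 = (Re t - IZR n)%R) by (unfold t1; rewrite opp_IZR; destruct t; simpl; ring).
      assert (Hc : (Cmod t1 * Cmod t1 <= 1 / 2)%R) by (rewrite Cmod_sqr, Hi, Hr; nra).
      assert (Ht1 : t1 <> 0) by (apply upper_neq_0; lra).
      assert (Hcp : (0 < Cmod t1 * Cmod t1)%R) by (assert (0 < Cmod t1)%R by (apply Cmod_gt_0; auto); nra).
      assert (Hd : (2 * Im t <= Im (- (1) / t1))%R).
      { rewrite Im_S_inv, Hi by auto.
        set (X := (Cmod t1 * Cmod t1)%R) in *.
        apply (Rmult_le_reg_r X); auto.
        replace (Im t / X * X)%R with (Im t) by (field; lra); nra. }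
      destruct (IH (- (1) / t1)) as [t' [H1 H2]].
      + lra.
      + simpl in Hk; pose proof (pow_lt 2 k ltac:(lra)); nra.
      + exists t'; split; auto; rewrite H2, HS by lra; apply HT; auto. }
  intros t Ht.
  destruct (Pow_x_infinity 2 ltac:(rewrite Rabs_pos_eq; lra) (1 / 2 / Im t)%R) as [k Hk].
  specialize (Hk k ltac:(lia)); rewrite Rabs_pos_eq in Hk by (apply pow_le; lra).
  apply (H k t Ht).
  apply Rge_le in Hk; apply (Rmult_le_compat_r (Im t)) in Hk; [|lra].
  unfold Rdiv in *; rewrite Rmult_assoc, Rinv_l in Hk by lra; lra.
Qed.

Lemma le_of_le_plus_eps (x y : R) : (forall e, (0 < e)%R -> (x <= y + e)%R) -> (x <= y)%R.
Proof. intros H; apply Rnot_lt_le; intros Hlt; specialize (H ((x - y) / 2)%R ltac:(lra)); lra. Qed.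

Section Cauchy.

Context (f : C -> C) (a : nat -> C)
  (Hf : forall t, (0 < Im t)%R -> cev a (nome t) (f t)).

(** Purely imaginary [t] give nomes of every radius in [(0, 1)], which is enough for absolute
    convergence in the whole disc. *)
Lemma expansion_cconv : cconv a.
Proof.
  apply cconv_of_cev; intros r Hr; destruct (nome_surj r Hr) as [t [Ht E]].
  exists (f t); rewrite <- E; auto.
Qed.

Lemma expansion_T (t : C) (n : Z) : (0 < Im t)%R -> f (t + IZR n) = f t.
Proof.
  intros Ht; apply (cev_unique a (nome t)); [|auto].
  replace (nome t) with (nome (t + IZR n)) by (rewrite nome_plus, nome_IZR; ring).
  apply Hf; destruct t; simpl in *; lra.
Qed.

Lemma tail_bound (q v : C) (N : nat) (e : R) : cev a q v ->
  (forall m, (N <= m)%nat -> (Rsum (fun i => Cmod (a i) * Cmod q ^ i) m - Rsum (fun i => Cmod (a i) * Cmod q ^ i) N <= e)%R) ->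
  (Cmod (v - Csum (fun i => a i * q ^ i)%C N) <= e)%R.
Proof.
  intros Hv He.
  apply (Ccv_le (fun n => Csum (fun i => a i * q ^ i) n - Csum (fun i => a i * q ^ i) N) _ _ N).
  - apply Ccv_minus; [exact Hv|apply Ccv_const].
  - intros m Hm; eapply Rle_trans; [|apply (He m Hm)].
    clear He; induction Hm as [|m Hm IH].
    + unfold Cminus; rewrite Cplus_opp_r, Cmod_0; lra.
    + cbn [Csum Rsum].
      match goal with |- (Cmod (?a + ?b - ?c) <= _)%R => replace (a + b - c) with ((a - c) + b) by ring end.
      eapply Rle_trans; [apply Cmod_triangle|]; rewrite Cmod_mult, Cmod_pow; lra.
Qed.

Lemma Csum_indicator (g : nat -> C) (n N : nat) : (n < N)%nat ->
  Csum (fun l => if Nat.eqb l n then g l else 0) N = g n.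
Proof.
  intros HN; induction HN as [|N HN IH]; cbn [Csum].
  - rewrite Nat.eqb_refl, (Csum_ext _ (fun _ => 0)), Csum_zero; [ring|].
    intros i Hi; destruct (Nat.eqb_spec i n); [lia|reflexivity].
  - rewrite IH; destruct (Nat.eqb_spec N n); [lia|ring].
Qed.

(** Cauchy's estimate with the integral replaced by a mean over [N] equidistant points of the
    circle. [N] is chosen so large that the tail is below [e], and larger than [n], so that among
    the exponents below [N] only [n] survives the averaging. *)
Lemma coef_bound_radius (B : R) (n : nat) (r : R) : (0 < r < 1)%R ->
  (forall t, (0 < Im t)%R -> (Cmod (f t) <= B)%R) -> (Cmod (a n) * r ^ n <= B)%R.
Proof.
  intros Hr HB; apply le_of_le_plus_eps; intros e He.
  destruct (nome_surj r Hr) as [t [Ht Et]].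
  destruct (summable_cauchy _ (expansion_cconv r ltac:(lra)) e He) as [N0 HN0].
  set (N := (N0 + S n)%nat).
  assert (HNp : (0 < INR N)%R) by (apply lt_0_INR; unfold N; lia).
  assert (HN0c : RtoC (INR N) <> 0) by (apply RtoC_neq_0; lra).
  set (tb := fun b => t + RtoC (INR b / INR N)).
  assert (Htb : forall b, (0 < Im (tb b))%R) by (intros b; unfold tb; destruct t; simpl in *; lra).
  assert (Hq : forall b, nome (tb b) = r * nome (INR b / INR N)).
  { intros b; unfold tb; rewrite nome_plus, Et, RtoC_div by lra; reflexivity. }
  assert (Hone : forall b, Cmod (nome (RtoC (INR b) / INR N)) = 1%R).
  { intros b; rewrite <- RtoC_div, Cmod_nome by lra; simpl; rewrite Rmult_0_r, Ropp_0; apply exp_0. }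
  assert (Hmod : forall b, Cmod (nome (tb b)) = r).
  { intros b; rewrite Hq, Cmod_mult, Hone, Cmod_R, Rabs_pos_eq by lra; ring. }
  set (part := fun b => Csum (fun i => a i * nome (tb b) ^ i) N).
  assert (Hpart : forall b, (Cmod (part b) <= B + e)%R).
  { intros b; pose proof (tail_bound (nome (tb b)) (f (tb b)) N e (Hf _ (Htb b))) as Ht1.
    rewrite Hmod in Ht1; specialize (Ht1 ltac:(intros m Hm; left; apply HN0; [unfold N; lia|exact Hm])).
    fold (part b) in Ht1.
    pose proof (Cmod_le_plus (part b) (f (tb b))) as H2; rewrite (Cmod_sym (part b)) in H2.
    specialize (HB _ (Htb b)); lra. }
  (* the discrete Fourier coefficient of the partial sum *)
  assert (Havg : Csum (fun b => part b * nome (INR b * (IZR (- Z.of_nat n) / INR N))) N = INR N * (a n * r ^ n)).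
  { transitivity (Csum (fun l => a l * r ^ l * (if Nat.eqb l n then RtoC (INR N) else 0)) N).
    - unfold part.
      rewrite (Csum_ext _ (fun b => Csum (fun l => a l * r ^ l * nome (INR b * (IZR (Z.of_nat l - Z.of_nat n) / INR N))) N)).
      + rewrite Csum_swap; apply Csum_ext; intros l Hl.
        rewrite Csum_scal, root_sum by (unfold N; lia); f_equal.
        destruct (Nat.eqb_spec l n) as [->|Hne].
        * rewrite Z.sub_diag, Z.mod_0_l by lia; reflexivity.
        * destruct (Z.eqb_spec ((Z.of_nat l - Z.of_nat n) mod Z.of_nat N) 0) as [E|E]; [|reflexivity].
          exfalso; apply Z.mod_divide in E; [|lia]; destruct E as [k Hk].
          assert (Hn : (n < N)%nat) by (unfold N; lia).
          destruct (Z.eq_dec k 0) as [->|]; [lia|nia].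
      + intros b _; rewrite Cmult_comm, <- Csum_scal; apply Csum_ext; intros l _.
        rewrite Hq, Cpow_mult_l, nome_pow.
        replace (Z.of_nat l - Z.of_nat n)%Z with (- Z.of_nat n + Z.of_nat l)%Z by lia.
        rewrite plus_IZR, RtoC_plus, <- (INR_IZR_INZ l).
        replace (INR b * ((IZR (- Z.of_nat n) + INR l) / INR N))
          with (INR b * (IZR (- Z.of_nat n) / INR N) + INR l * (INR b / INR N)) by (field; auto).
        rewrite nome_plus; ring.
    - rewrite (Csum_ext _ (fun l => if Nat.eqb l n then a l * r ^ l * INR N else 0)).
      + rewrite (Csum_indicator (fun l => a l * r ^ l * INR N)) by (unfold N; lia); ring.
      + intros l _; destruct (Nat.eqb l n); ring. }
  assert (Hbd : (Cmod (INR N * (a n * r ^ n)) <= INR N * (B + e))%R).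
  { rewrite <- Havg; eapply Rle_trans; [apply (Csum_le _ (fun _ => (B + e) * 1)%R)|].
    - intros b _; rewrite Cmod_mult.
      replace (Cmod (nome _)) with 1%R; [specialize (Hpart b); lra|].
      rewrite <- RtoC_div, <- RtoC_mult, Cmod_nome by lra; simpl; rewrite Rmult_0_r, Ropp_0, exp_0; reflexivity.
    - rewrite Rsum_scal; replace (Rsum (fun _ => 1%R) N) with (INR N); [lra|].
      clear; induction N as [|N IH]; [reflexivity|rewrite S_INR, IH; reflexivity]. }
  rewrite !Cmod_mult, Cmod_pow, !Cmod_R, !Rabs_pos_eq in Hbd by lra.
  apply (Rmult_le_reg_l (INR N)); auto.
Qed.

(** The radius tends to 1; Bernoulli's inequality shows that [1 - d] with [d] of order [e] already
    loses at most [e]. *)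
Lemma coef_bound (B : R) (n : nat) :
  (forall t, (0 < Im t)%R -> (Cmod (f t) <= B)%R) -> (Cmod (a n) <= B)%R.
Proof.
  intros HB; apply le_of_le_plus_eps; intros e He.
  pose proof (Cmod_ge_0 (a n)) as H0; pose proof (pos_INR n) as Hn.
  set (K := (Cmod (a n) * INR n + e + 1)%R).
  assert (HK0 : (0 <= Cmod (a n) * INR n)%R) by (apply Rmult_le_pos; auto).
  assert (HK : (0 < K)%R) by (unfold K; lra).
  set (d := (e / (2 * K))%R).
  assert (Hd : (0 < d < 1)%R).
  { unfold d; split; [apply Rdiv_lt_0_compat; lra|].
    apply (Rmult_lt_reg_r (2 * K)); [lra|]; unfold Rdiv; rewrite Rmult_assoc, Rinv_l by lra; unfold K; lra. }
  pose proof (coef_bound_radius B n (1 - d) ltac:(lra) HB) as H1.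
  assert (Hb : forall m, (1 - INR m * d <= (1 - d) ^ m)%R).
  { clearbody d; induction m as [|m IH]; [simpl; lra|].
    rewrite S_INR; cbn [pow]; pose proof (pos_INR m).
    apply (Rmult_le_compat_l (1 - d)) in IH; [|lra].
    assert (0 <= INR m * (d * d))%R by (apply Rmult_le_pos; nra). lra. }
  assert (Hnd : (Cmod (a n) * INR n * d <= e)%R).
  { unfold d; apply (Rmult_le_reg_r (2 * K)); [lra|].
    replace (Cmod (a n) * INR n * (e / (2 * K)) * (2 * K))%R with (Cmod (a n) * INR n * e)%R by (field; lra).
    unfold K; nra. }
  specialize (Hb n); apply (Rmult_le_compat_l (Cmod (a n))) in Hb; [|lra]; lra.
Qed.

Lemma value_bound (B : R) (t : C) : a 0%nat = 0 -> (0 <= B)%R ->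
  (forall n, (Cmod (a n) <= B)%R) -> (1 / 2 <= Im t)%R -> (Cmod (f t) <= B / 2)%R.
Proof.
  intros H0 HB Ha Ht.
  (* On [Im t >= 1/2] one has [|q| <= exp (-PI) <= 1 / (1 + PI)], and [PI > 3]. *)
  assert (Hr : (Cmod (nome t) <= / 4)%R).
  { rewrite Cmod_nome, exp_Ropp; pose proof PI2_3_2 as Hpi; unfold PI2 in Hpi.
    apply Rinv_le_contravar; [lra|].
    apply Rle_trans with (exp PI); [pose proof (exp_ineq1_le PI); lra|apply exp_mono; nra]. }
  pose proof (Cmod_ge_0 (nome t)) as Hr0; set (r := Cmod (nome t)) in *.
  apply (Ccv_le _ _ _ 1 (Hf t ltac:(lra))); intros n Hn.
  eapply Rle_trans; [apply (Csum_le _ (fun i => Cmod (a i) * r ^ i)%R)|].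
  - intros i _; rewrite Cmod_mult, Cmod_pow; fold r; lra.
  - destruct n as [|n]; [lia|]; rewrite Rsum_shift, H0, Cmod_0, Rmult_0_l, Rplus_0_l.
    apply Rle_trans with (Rsum (fun i => (B * r) * r ^ i)%R n).
    + apply Rsum_le; intros i _; simpl; rewrite Rmult_assoc; apply Rmult_le_compat_r; auto.
      apply Rmult_le_pos; auto; apply pow_le; auto.
    + rewrite Rsum_scal.
      pose proof (Rsum_geom r n ltac:(lra)) as Hg.
      assert (Hi : (/ (1 - r) <= 2)%R).
      { replace 2%R with (/ (1 / 2))%R by field; apply Rinv_le_contravar; lra. }
      pose proof (Rsum_nonneg (fun i => r ^ i)%R n ltac:(intros; apply pow_le; auto)).
      assert (B * r * Rsum (fun i => r ^ i)%R n <= B * r * 2)%R by (apply Rmult_le_compat_l; [nra|lra]).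
      assert (B * r <= B * / 4)%R by (apply Rmult_le_compat_l; lra).
      eapply Rle_trans; [exact H1|lra].
Qed.

Theorem vanishing : (forall t, (0 < Im t)%R -> f (- (1) / t) = f t) -> a 0%nat = 0 -> forall n, a n = 0.
Proof.
  intros HS H0.
  (* Every orbit meets the disc [|q| <= 1/4], on which absolute convergence bounds [f]; this starts
     the halving. *)
  assert (Hinit : exists B, (0 <= B)%R /\ forall t, (0 < Im t)%R -> (Cmod (f t) <= B)%R).
  { destruct (expansion_cconv (/ 4)%R ltac:(lra)) as [Hp [B HB]].
    exists B; split; [specialize (HB 0%nat); simpl in HB; lra|].
    intros t Ht; destruct (reduce_to_half f HS expansion_T t Ht) as [t' [Ht' <-]].
    assert (Hr : (Cmod (nome t') <= / 4)%R).
    { rewrite Cmod_nome, exp_Ropp; pose proof PI2_3_2 as Hpi; unfold PI2 in Hpi.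
      apply Rinv_le_contravar; [lra|].
      apply Rle_trans with (exp PI); [pose proof (exp_ineq1_le PI); lra|apply exp_mono; nra]. }
    apply (Ccv_le _ _ _ 0 (Hf t' ltac:(lra))); intros n _; eapply Rle_trans; [|apply (HB n)].
    apply Csum_le; intros i _; rewrite Cmod_mult, Cmod_pow; apply Rmult_le_compat_l; [apply Cmod_ge_0|].
    apply pow_incr; split; [apply Cmod_ge_0|exact Hr]. }
  destruct Hinit as [B [HB0 HB]].
  assert (Hk : forall k t, (0 < Im t)%R -> (Cmod (f t) <= B / 2 ^ k)%R).
  { induction k as [|k IH]; intros t Ht; [simpl; unfold Rdiv; rewrite Rinv_1, Rmult_1_r; auto|].
    destruct (reduce_to_half f HS expansion_T t Ht) as [t' [Ht' <-]].
    pose proof (pow_lt 2 k ltac:(lra)).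
    replace (B / 2 ^ S k)%R with (B / 2 ^ k / 2)%R by (simpl; field; lra).
    apply value_bound; auto.
    - apply Rcomplements.Rdiv_le_0_compat; lra.
    - intros n; now apply coef_bound. }
  intros n; apply Cmod_eq_0, Rle_antisym; [|apply Cmod_ge_0].
  apply (is_lim_seq_le (fun _ => Cmod (a n)) (fun k => B / 2 ^ S k)%R (Cmod (a n)) 0%R).
  - intros k; apply coef_bound; auto.
  - apply is_lim_seq_const.
  - apply is_lim_seq_div_pow2.
Qed.

End Cauchy.

(** * Hecke operators *)

(** A total function obtained from [Lim_seq]; it is meaningful where the series converges, which
    [val_unique] and [val_ev] express. *)
Definition val (a : fps) (q : C) : C :=
  (real (Lim_seq (fun n => Re (Csum (fun i => injC a i * q ^ i) n))),
   real (Lim_seq (fun n => Im (Csum (fun i => injC a i * q ^ i) n)))).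

Lemma Ccv_part (g : C -> R) (u : nat -> C) (l : C) :
  (forall x y, (Rabs (g x - g y) <= Cmod (x - y))%R) -> Ccv u l -> Lim_seq (fun n => g (u n)) = Finite (g l).
Proof.
  intros Hg H; apply is_lim_seq_unique, is_lim_seq_spec; intros [eps Heps]; simpl.
  destruct (H eps Heps) as [N HN]; exists N; intros n Hn.
  eapply Rle_lt_trans; [apply Hg|now apply HN].
Qed.

Lemma val_unique (a : fps) (q v : C) : ev a q v -> val a q = v.
Proof.
  intros H; unfold val.
  rewrite (Ccv_part Re _ v), (Ccv_part Im _ v); [destruct v; reflexivity| |exact H| |exact H].
  - intros x y; replace (Im x - Im y)%R with (Im (x - y)) by reflexivity.
    eapply Rle_trans; [|apply Rmax_Cmod]; apply Rmax_r.
  - intros x y; replace (Re x - Re y)%R with (Re (x - y)) by reflexivity; apply re_le_Cmod.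
Qed.

Lemma val_ev (a : fps) (q : C) : conv a -> (Cmod q < 1)%R -> ev a q (val a q).
Proof. intros Ha Hq; destruct (conv_ev a q Ha Hq) as [v Hv]; rewrite (val_unique a q v Hv); exact Hv. Qed.

Definition discr (t : C) : C := nome t * val euler (nome t) ^ 24.

Lemma euler_partitions_val (q : C) : (Cmod q < 1)%R -> val euler q * val partitions q = 1.
Proof.
  intros Hq; apply (cev_unique (injC fone) q); [|apply ev_one].
  rewrite <- euler_partitions; apply ev_mul; auto using conv_euler, conv_partitions, val_ev.
Qed.

Lemma val_euler_neq_0 (q : C) : (Cmod q < 1)%R -> val euler q <> 0.
Proof.
  intros Hq E; apply C1_nz; rewrite <- (euler_partitions_val q Hq), E; ring.
Qed.

Lemma val_partitions (q : C) : (Cmod q < 1)%R -> val partitions q = / val euler q.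
Proof.
  intros Hq; pose proof (val_euler_neq_0 q Hq) as H0.
  replace (val partitions q) with (val euler q * val partitions q / val euler q) by (field; auto).
  rewrite euler_partitions_val by auto; field; auto.
Qed.

Lemma discr_neq_0 (t : C) : (0 < Im t)%R -> discr t <> 0.
Proof.
  intros Ht; apply Cmult_neq_0; [apply nome_neq_0|apply Cpow_nz, val_euler_neq_0, nome_lt_1, Ht].
Qed.

Lemma discr_T (t : C) (n : Z) : discr (t + IZR n) = discr t.
Proof. unfold discr; rewrite nome_plus, nome_IZR, Cmult_1_r; reflexivity. Qed.

Lemma discr_S (t : C) : (0 < Im t)%R -> discr (- (1) / t) = t ^ 12 * discr t.
Proof.
  intros Ht; unfold discr; apply discriminant_S; auto.
  - apply ev_euler; [|apply val_ev; [apply conv_euler|]]; apply nome_lt_1; auto.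
  - apply ev_euler; [|apply val_ev; [apply conv_euler|]]; apply nome_lt_1, Im_S; auto.
Qed.

(** * From the two generators to the whole modular group *)

Lemma moebius_den (a b c d : Z) (t : C) : (a * d - b * c = 1)%Z -> (0 < Im t)%R ->
  IZR c * t + IZR d <> 0.
Proof.
  intros H Ht E.
  destruct (Z.eq_dec c 0) as [->|Hc].
  - assert (Hd : d <> 0%Z) by lia; apply (RtoC_neq_0 (IZR d)); [apply not_0_IZR; exact Hd|].
    rewrite <- E; ring.
  - apply (f_equal Im) in E; destruct t as [x y]; simpl in *.
    assert (HI : IZR c <> 0%R) by (apply not_0_IZR; exact Hc).
    assert (IZR c * y = 0)%R by lra; apply Rmult_integral in H0; lra.
Qed.

Lemma moebius_Im (a b c d : Z) (t : C) : (a * d - b * c = 1)%Z -> (0 < Im t)%R ->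
  (0 < Im ((IZR a * t + IZR b) / (IZR c * t + IZR d)))%R.
Proof.
  intros H Ht; pose proof (moebius_den a b c d t H Ht) as Hden.
  assert (Hp : (0 < Cmod (IZR c * t + IZR d) * Cmod (IZR c * t + IZR d))%R).
  { assert (0 < Cmod (IZR c * t + IZR d))%R by (apply Cmod_gt_0; auto); nra. }
  rewrite Cmod_sqr in Hp; destruct t as [x y]; simpl in *.
  apply (f_equal IZR) in H; rewrite minus_IZR, !mult_IZR in H.
  set (A := IZR a) in *; set (B := IZR b) in *; set (C' := IZR c) in *; set (D := IZR d) in *.
  set (n := ((C' * x - 0 * y + D) * (C' * x - 0 * y + D) + (C' * y + 0 * x + 0) * (C' * y + 0 * x + 0))%R) in *.
  match goal with |- (0 < ?E)%R => replace E with ((A * D - B * C') * y / n)%R by (unfold n in *; field; lra) end.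
  rewrite H; apply Rdiv_lt_0_compat; lra.
Qed.

Lemma Cpow12_opp (z : C) (r : nat) : (- z) ^ (12 * r) = z ^ (12 * r).
Proof. rewrite !Cpow_mult_r; f_equal; ring. Qed.

(** Euclid's algorithm on the first column: translation by [s = a / c] replaces [a] by the remainder
    [a'], and inversion brings [a'] to the place of [c]. The weight is even, so the sign of the
    matrix does not matter. *)
Lemma weight_of_generators (g : C -> C) (r : nat) :
  (forall t (n : Z), (0 < Im t)%R -> g (t + IZR n) = g t) ->
  (forall t, (0 < Im t)%R -> g (- (1) / t) = t ^ (12 * r) * g t) ->
  forall a b c d : Z, (a * d - b * c = 1)%Z -> forall t, (0 < Im t)%R ->
    g ((IZR a * t + IZR b) / (IZR c * t + IZR d)) = (IZR c * t + IZR d) ^ (12 * r) * g t.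
Proof.
  intros HT HS.
  assert (H : forall N a b c d : Z, (0 <= N)%Z -> (Z.abs c <= N)%Z -> (a * d - b * c = 1)%Z -> forall t, (0 < Im t)%R ->
    g ((IZR a * t + IZR b) / (IZR c * t + IZR d)) = (IZR c * t + IZR d) ^ (12 * r) * g t).
  2:{ intros a b c d; apply (H (Z.abs c)); lia. }
  intros N a b c d HN; revert a b c d; pattern N; apply Zlt_0_ind; [clear N HN|exact HN].
  intros N IH HN a b c d Hc Hdet t Ht.
  destruct (Z.eq_dec c 0) as [->|Hc0].
  - assert (Had : (a = 1 /\ d = 1 \/ a = -1 /\ d = -1)%Z).
    { assert (Ha : (a * d = 1)%Z) by lia; apply Z.eq_mul_1 in Ha as Ha1; destruct Ha1 as [->| ->]; lia. }
    destruct Had as [[-> ->]|[-> ->]].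
    + rewrite <- (HT t b Ht); replace ((IZR 1 * t + IZR b) / (IZR 0 * t + IZR 1)) with (t + IZR b) by (field; apply C1_nz).
      replace (IZR 0 * t + IZR 1) with (RtoC 1) by ring; rewrite Cpow_1_l; ring.
    + rewrite <- (HT t (- b)%Z Ht).
      assert (Em : RtoC (IZR (-1)) = - (1)) by (rewrite <- RtoC_opp; f_equal; lra).
      rewrite Em, opp_IZR, RtoC_opp.
      replace ((- (1) * t + IZR b) / (IZR 0 * t + - (1))) with (t + - IZR b) by (field; rewrite <- Em; apply RtoC_neq_0; lra).
      replace (IZR 0 * t + - (1)) with (- (1)) by ring; rewrite Cpow12_opp, Cpow_1_l; ring.
  - set (s := (a / c)%Z); set (a' := (a mod c)%Z); set (b' := (b - d * s)%Z).
    assert (Ea : (a = c * s + a')%Z) by (apply Z.div_mod; exact Hc0).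
    assert (Ha' : (Z.abs a' < Z.abs c)%Z) by (apply Z.mod_bound_abs; exact Hc0).
    assert (Hdet' : (a' * d - b' * c = 1)%Z) by (unfold b'; rewrite <- Hdet, Ea; ring).
    assert (Hdet2 : ((- c) * b' - (- d) * a' = 1)%Z) by (rewrite <- Hdet'; ring).
    pose proof (moebius_den a b c d t Hdet Ht) as Hden.
    pose proof (moebius_den _ _ _ _ t Hdet2 Ht) as Hden2.
    pose proof (moebius_Im _ _ _ _ t Hdet2 Ht) as Him2.
    pose proof (moebius_Im _ _ _ _ t Hdet' Ht) as Him'.
    replace ((IZR a * t + IZR b) / (IZR c * t + IZR d)) with ((IZR a' * t + IZR b') / (IZR c * t + IZR d) + IZR s).
    2:{ unfold b'; rewrite Ea, plus_IZR, mult_IZR, minus_IZR, mult_IZR, RtoC_plus, RtoC_minus, !RtoC_mult; field; auto. }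
    rewrite HT by exact Him'.
    set (sg := (IZR (- c) * t + IZR (- d)) / (IZR a' * t + IZR b')) in *.
    assert (Hsg : sg = - ((IZR c * t + IZR d) / (IZR a' * t + IZR b'))).
    { unfold sg; rewrite !opp_IZR, !RtoC_opp; field; auto. }
    replace ((IZR a' * t + IZR b') / (IZR c * t + IZR d)) with (- (1) / sg).
    2:{ rewrite Hsg; field; auto. }
    rewrite HS by exact Him2.
    unfold sg at 2; rewrite (IH (Z.abs a')) by (auto; lia).
    rewrite Hsg, Cpow12_opp, Cmult_assoc, <- Cpow_mult_l; f_equal; f_equal; field; auto.
Qed.

(** An explicit list instead of primality: the permutation in [hecke_S] and the identity in
    [one_minus_X_frobenius] are then settled prime by prime by computation. *)
Definition hecke_primes (p : nat) : Prop := p = 2%nat \/ p = 3%nat \/ p = 5%nat \/ p = 7%nat \/ p = 11%nat.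

(** This is [p] times the usual operator [T_p] in weight [12 r]. *)
Definition hecke (p r : nat) (g : C -> C) (t : C) : C :=
  INR p ^ (12 * r) * g (INR p * t) + Csum (fun b => g ((t + INR b) / INR p)) p.

(** The matrix with rows [(b, -m)] and [(p, -b')] has determinant 1 and sends [(t + b') / p] to
    [(-1/t + b) / p], with automorphy factor [t]. *)
Lemma hecke_term (p r b b' m : nat) (g : C -> C) (t : C) : (0 < p)%nat ->
  (forall a b c d : Z, (a * d - b * c = 1)%Z -> forall t, (0 < Im t)%R ->
    g ((IZR a * t + IZR b) / (IZR c * t + IZR d)) = (IZR c * t + IZR d) ^ (12 * r) * g t) ->
  (b * b' + 1 = p * m)%nat -> (0 < Im t)%R ->
  g ((- (1) / t + INR b) / INR p) = t ^ (12 * r) * g ((t + INR b') / INR p).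
Proof.
  intros Hp Hg Hb Ht.
  assert (Hp0 : RtoC (INR p) <> 0) by (apply RtoC_neq_0, not_0_INR; lia).
  pose proof (upper_neq_0 t Ht) as Ht0.
  pose proof (Hg (Z.of_nat b) (- Z.of_nat m)%Z (Z.of_nat p) (- Z.of_nat b')%Z ltac:(nia) ((t + INR b') / INR p)) as H.
  rewrite !opp_IZR, <- !INR_IZR_INZ, !RtoC_opp in H.
  assert (HI : (0 < Im ((t + INR b') / INR p))%R).
  { replace ((t + INR b') / INR p) with (RtoC (/ INR p) * (t + INR b')) by (rewrite RtoC_inv by (apply not_0_INR; lia); field; auto).
    assert (0 < / INR p)%R by (apply Rinv_0_lt_compat, lt_0_INR; lia).
    destruct t; simpl in *; nra. }
  specialize (H HI).
  replace (INR p * ((t + INR b') / INR p) + - INR b') with t in H by (field; auto).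
  rewrite <- H; f_equal.
  apply (f_equal INR) in Hb; rewrite plus_INR, !mult_INR in Hb; simpl INR in Hb.
  assert (Hm : RtoC (INR m) = (INR b * INR b' + 1) / INR p).
  { rewrite <- RtoC_mult, <- RtoC_plus, Hb, RtoC_mult; field; auto. }
  rewrite Hm; field; auto.
Qed.

(** Inversion permutes the summands: the term in [p t] is exchanged with the one for [b = 0], and
    any other [b] goes to the [b'] with [b b' = -1] modulo [p]. *)
Lemma hecke_S (p r : nat) (g : C -> C) (t : C) : hecke_primes p ->
  (forall a b c d : Z, (a * d - b * c = 1)%Z -> forall t, (0 < Im t)%R ->
    g ((IZR a * t + IZR b) / (IZR c * t + IZR d)) = (IZR c * t + IZR d) ^ (12 * r) * g t) ->
  (0 < Im t)%R -> hecke p r g (- (1) / t) = t ^ (12 * r) * hecke p r g t.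
Proof.
  intros Hpr Hg Ht.
  assert (Hp : (0 < p)%nat) by (unfold hecke_primes in Hpr; lia).
  assert (Hp0 : RtoC (INR p) <> 0) by (apply RtoC_neq_0, not_0_INR; lia).
  pose proof (upper_neq_0 t Ht) as Ht0.
  assert (HgS : forall s, (0 < Im s)%R -> g (- (1) / s) = s ^ (12 * r) * g s).
  { intros s Hs; pose proof (Hg 0 (-1) 1 0 ltac:(lia) s Hs)%Z as H.
    replace (IZR 1 * s + IZR 0) with s in H by ring; rewrite <- H; f_equal; f_equal.
    replace (RtoC (IZR (-1))) with (- (1)) by (rewrite <- RtoC_opp; f_equal; lra); ring. }
  assert (Hpos : (0 < INR p)%R) by (apply lt_0_INR; lia).
  assert (Hpi : (0 < / INR p)%R) by (apply Rinv_0_lt_compat; exact Hpos).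
  assert (Hd : forall z : C, z / INR p = RtoC (/ INR p) * z) by (intros z; rewrite RtoC_inv by lra; field; auto).
  assert (I1 : (0 < Im (t / INR p))%R) by (rewrite Hd; destruct t; simpl in *; nra).
  assert (I2 : (0 < Im (INR p * t))%R) by (destruct t; simpl in *; nra).
  assert (E1 : g (INR p * (- (1) / t)) = (t / INR p) ^ (12 * r) * g ((t + INR 0) / INR p)).
  { replace (INR p * (- (1) / t)) with (- (1) / (t / INR p)) by (field; auto).
    rewrite HgS by auto; simpl INR; rewrite Cplus_0_r; reflexivity. }
  assert (E2 : g ((- (1) / t + INR 0) / INR p) = (INR p * t) ^ (12 * r) * g (INR p * t)).
  { rewrite <- HgS by auto; f_equal; simpl INR; field; auto. }
  assert (E3 : forall b b' m, (b * b' + 1 = p * m)%nat ->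
    g ((- (1) / t + INR b) / INR p) = t ^ (12 * r) * g ((t + INR b') / INR p)).
  { intros b b' m Hb; now apply (hecke_term p r b b' m). }
  unfold hecke; rewrite E1.
  assert (Hpow : INR p ^ (12 * r) * ((t / INR p) ^ (12 * r) * g ((t + INR 0) / INR p)) =
    t ^ (12 * r) * g ((t + INR 0) / INR p)).
  { rewrite Cmult_assoc, <- Cpow_mult_l; f_equal; f_equal; field; auto. }
  rewrite Hpow; clear Hpow E1.
  rewrite Cpow_mult_l in E2.
  generalize dependent (g (INR p * t)); intros G0 E2.
  set (h := fun b : nat => g ((t + INR b) / INR p)).
  set (h' := fun b : nat => g ((- (1) / t + INR b) / INR p)).
  assert (E3' : forall b b' m, (b * b' + 1 = p * m)%nat -> h' b = t ^ (12 * r) * h b') by exact E3.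
  assert (E2' : h' 0%nat = INR p ^ (12 * r) * t ^ (12 * r) * G0) by exact E2.
  change (g ((t + INR 0) / INR p)) with (h 0%nat).
  change (fun b : nat => g ((- (1) / t + INR b) / INR p)) with h'.
  change (fun b : nat => g ((t + INR b) / INR p)) with h.
  generalize dependent (INR p ^ (12 * r)); intros P _ E2'.
  clear E3 HgS Hg Hd; clearbody h h'.
  (* Each triple lists [b], its partner [b'] and the quotient [m = (b b' + 1) / p]. *)
  destruct Hpr as [->|[->|[->|[->| ->]]]]; cbn [Csum]; rewrite E2'.
  - rewrite (E3' 1 1 1)%nat by lia; ring.
  - rewrite (E3' 1 2 1)%nat, (E3' 2 1 1)%nat by lia; ring.
  - rewrite (E3' 1 4 1)%nat, (E3' 2 2 1)%nat, (E3' 3 3 2)%nat, (E3' 4 1 1)%nat by lia; ring.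
  - rewrite (E3' 1 6 1)%nat, (E3' 2 3 1)%nat, (E3' 3 2 1)%nat, (E3' 4 5 3)%nat,
      (E3' 5 4 3)%nat, (E3' 6 1 1)%nat by lia; ring.
  - rewrite (E3' 1 10 1)%nat, (E3' 2 5 1)%nat, (E3' 3 7 2)%nat, (E3' 4 8 3)%nat,
      (E3' 5 2 1)%nat, (E3' 6 9 5)%nat, (E3' 7 3 2)%nat, (E3' 8 4 3)%nat,
      (E3' 9 6 5)%nat, (E3' 10 1 1)%nat by lia; ring.
Qed.

(* [q^r] times the Hecke transform of [f discr^r], divided by [discr^r], where
   [q^k f = sum a_n q^n]. *)
Definition hecke_source (r k : nat) (a : fps) : fps :=
  fshift (r - k) (fmul a (fpow euler (24 * r))).

Definition hecke_series (p r k : nat) (a : fps) : fps :=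
  fmul (fpow partitions (24 * r))
    (fadd (fun n => Z.of_nat p ^ Z.of_nat (12 * r - 1) * fspread p (hecke_source r k a) n)%Z
          (fU p (hecke_source r k a))).

Lemma conv_fscal (c : Z) (a : fps) : conv a -> conv (fun n => c * a n)%Z.
Proof.
  intros Ha; apply conv_of_ev; intros q Hq; destruct (conv_ev a q Ha Hq) as [u Hu].
  eexists; apply ev_fscal, Hu.
Qed.

Lemma conv_of_upper (a : fps) (f : C -> C) :
  (forall t, (0 < Im t)%R -> ev a (nome t) (f t)) -> conv a.
Proof. exact (expansion_cconv f (injC a)). Qed.

Lemma hecke_modular (p r k : nat) (f : C -> C) (a : fps) :
  hecke_primes p -> (0 < r)%nat -> (k <= r)%nat -> SL2Z_invariant f ->
  (forall t, (0 < Im t)%R -> ev a (nome t) (nome t ^ k * f t)) ->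
  exists F : C -> C,
    (forall t, (0 < Im t)%R -> F (- (1) / t) = F t) /\
    (forall t, (0 < Im t)%R -> ev (hecke_series p r k a) (nome t) (nome t ^ r * F t)).
Proof.
  intros Hpr Hr Hk Hf Ha.
  assert (Hp : (0 < p)%nat) by (unfold hecke_primes in Hpr; lia).
  assert (Hp0 : RtoC (INR p) <> 0) by (apply RtoC_neq_0, not_0_INR; lia).
  assert (Hpos : (0 < INR p)%R) by (apply lt_0_INR; lia).
  assert (Hpi : (0 < / INR p)%R) by (apply Rinv_0_lt_compat; exact Hpos).
  pose proof (conv_of_upper a _ Ha) as Hca.
  set (g := fun t => f t * discr t ^ r).
  assert (HDel : forall a b c d : Z, (a * d - b * c = 1)%Z -> forall t, (0 < Im t)%R ->
    discr ((IZR a * t + IZR b) / (IZR c * t + IZR d)) = (IZR c * t + IZR d) ^ 12 * discr t).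
  { intros a0 b0 c0 d0 H0 t Ht; apply (weight_of_generators discr 1); auto using discr_T, discr_S. }
  assert (Hg : forall a b c d : Z, (a * d - b * c = 1)%Z -> forall t, (0 < Im t)%R ->
    g ((IZR a * t + IZR b) / (IZR c * t + IZR d)) = (IZR c * t + IZR d) ^ (12 * r) * g t).
  { intros a0 b0 c0 d0 H0 t Ht; unfold g; rewrite Hf, HDel, Cpow_mult_l, <- Cpow_mult_r by auto; ring. }
  set (G := hecke_source r k a).
  assert (HG : forall t, (0 < Im t)%R -> ev G (nome t) (g t)).
  { intros t Ht; pose proof (nome_lt_1 t Ht) as Hq.
    eapply Ccv_eq; [|apply ev_shift, ev_mul; [exact Hca|apply conv_pow, conv_euler|exact Hq|apply Ha, Ht|
      apply ev_pow; [apply conv_euler|exact Hq|apply val_ev; [apply conv_euler|exact Hq]]]].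
    unfold g, discr; rewrite Cpow_mult_l, <- Cpow_mult_r.
    replace (nome t ^ r) with (nome t ^ (r - k) * nome t ^ k) by (rewrite <- Cpow_add_r; f_equal; lia); ring. }
  pose proof (conv_of_upper G _ HG) as HcG.
  assert (Hd : forall z : C, z / INR p = RtoC (/ INR p) * z) by (intros z; rewrite RtoC_inv by lra; field; auto).
  (* The factor [1/p] turns the sum over [b] into [U_p] and leaves the integer [p^(12 r - 1)] in
     front of the other term. *)
  exists (fun t => / INR p * hecke p r g t / discr t ^ r); split.
  - intros t Ht; pose proof (upper_neq_0 t Ht) as Ht0.
    rewrite (hecke_S p r g t Hpr Hg Ht), discr_S, Cpow_mult_l, <- Cpow_mult_r by exact Ht.
    pose proof (Cpow_nz _ (12 * r) Ht0); pose proof (Cpow_nz _ r (discr_neq_0 t Ht)).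
    field; auto.
  - intros t Ht; pose proof (nome_lt_1 t Ht) as Hq.
    set (q := nome t) in *.
    assert (Hs : ev (fspread p G) q (g (INR p * t))).
    { apply ev_spread; auto; unfold q; rewrite nome_pow; apply HG; destruct t; simpl in *; nra. }
    assert (HU : ev (fU p G) q (/ INR p * Csum (fun b => g ((t + INR b) / INR p)) p)).
    { replace q with (nome (t / INR p) ^ p).
      - apply ev_U; auto; intros b _; rewrite <- nome_plus.
        replace (INR b / INR p + t / INR p) with ((t + INR b) / INR p) by (field; auto).
        apply HG; rewrite Hd; destruct t; simpl in *; nra.
      - rewrite nome_pow; unfold q; f_equal; field; auto. }
    eapply Ccv_eq; [|apply ev_mul; [apply conv_pow, conv_partitions| |exact Hq|
       apply ev_pow; [apply conv_partitions|exact Hq|apply val_ev; [apply conv_partitions|exact Hq]]|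
       apply ev_add; [apply ev_fscal, Hs|exact HU]]].
    + rewrite val_partitions by exact Hq.
      pose proof (val_euler_neq_0 q Hq) as He0; pose proof (nome_neq_0 t) as Hq0; fold q in Hq0.
      unfold hecke, discr; fold q.
      rewrite Cpow_mult_l, <- Cpow_mult_r, Cpow_inv by exact He0.
      replace (RtoC (IZR (Z.of_nat p ^ Z.of_nat (12 * r - 1)))) with (INR p ^ (12 * r) / INR p).
      * pose proof (Cpow_nz _ (24 * r) He0); pose proof (Cpow_nz _ r Hq0); field; auto.
      * rewrite <- pow_IZR, <- INR_IZR_INZ, RtoC_pow.
        replace (12 * r)%nat with (S (12 * r - 1)) at 1 by lia; rewrite Cpow_S; field; auto.
    + apply conv_add; [apply conv_fscal, conv_spread; auto|].
      apply conv_of_upper with (f := fun t => / INR p * Csum (fun b => g ((t + INR b) / INR p)) p).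
      intros s Hs'.
      replace (nome s) with (nome (s / INR p) ^ p).
      * apply ev_U; auto; intros b _; rewrite <- nome_plus.
        replace (INR b / INR p + s / INR p) with ((s + INR b) / INR p) by (field; auto).
        apply HG; rewrite Hd; destruct s; simpl in *; nra.
      * rewrite nome_pow; f_equal; field; auto.
Qed.

(** * A modular function with a simple pole at the cusp *)

(** The expansion of [q J]. The Hecke series is that of [q^2 J]; it starts at [q] because [U_2]
    halves the leading exponent of [Delta^2], whence the shift by one. *)
Definition jseries : fps := fun n => hecke_series 2 2 0 fone (S n).

Lemma cev_tail (a : nat -> C) (q v : C) : q <> 0 -> a 0%nat = 0 -> cev a q v ->
  cev (fun n => a (S n)) q (v / q).
Proof.
  intros Hq H0 H.
  apply (Ccv_ext (fun n => Csum (fun i => a i * q ^ i) (S n) / q)).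
  - intros n; rewrite Csum_shift, H0; unfold Cdiv; rewrite Cmult_0_l, Cplus_0_l, Cmult_comm, <- Csum_scal.
    apply Csum_ext; intros i _; rewrite Cpow_S; field; auto.
  - apply Ccv_div; auto using Ccv_const; apply (Ccv_subseq _ S); auto.
Qed.

Lemma fpow_0 (a : fps) (k : nat) : a 0%nat = 1%Z -> fpow a k 0%nat = 1%Z.
Proof.
  intros H; induction k as [|k IH]; [reflexivity|].
  simpl; unfold fmul; cbn [Zsum]; rewrite H; simpl Nat.sub; rewrite IH; reflexivity.
Qed.

Lemma hecke_series_2_0 : hecke_series 2 2 0 fone 0%nat = 0%Z.
Proof.
  unfold hecke_series, fmul; cbn [Zsum]; rewrite fpow_0 by reflexivity.
  unfold fadd, fspread, fU, hecke_source, fshift; simpl; ring.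
Qed.

Lemma jseries_0 : jseries 0%nat = 1%Z.
Proof.
  unfold jseries, hecke_series, fmul; cbn [Zsum]; rewrite fpow_0 by reflexivity.
  change (1 - 0)%nat with 1%nat; change (1 - 1)%nat with 0%nat.
  unfold fadd, fspread, fU, hecke_source.
  change (1 mod 2)%nat with 1%nat; change (0 mod 2)%nat with 0%nat; cbn [Nat.eqb].
  unfold fshift; change (2 - 0)%nat with 2%nat; change (2 * 1)%nat with 2%nat; change (0 / 2)%nat with 0%nat; change (2 * 0)%nat with 0%nat.
  cbn [Nat.leb]; change (2 - 2)%nat with 0%nat.
  unfold fmul; cbn [Zsum]; change (0 - 0)%nat with 0%nat.
  rewrite fpow_0 by reflexivity; unfold fone; cbn [Nat.eqb]; ring.
Qed.

Lemma j_exists : exists J : C -> C,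
  (forall t, (0 < Im t)%R -> J (- (1) / t) = J t) /\
  (forall t, (0 < Im t)%R -> ev jseries (nome t) (nome t * J t)).
Proof.
  destruct (hecke_modular 2 2 0 (fun _ => 1) fone) as [J [HS HJ]].
  - now left.
  - lia.
  - lia.
  - intros a b c d _ t _; reflexivity.
  - intros t Ht; eapply Ccv_eq; [|apply ev_one]; simpl; ring.
  - exists J; split; auto; intros t Ht; pose proof (nome_neq_0 t) as Hq.
    eapply Ccv_eq; [|apply (cev_tail (injC (hecke_series 2 2 0 fone)) (nome t) (nome t ^ 2 * J t) Hq); [|apply HJ, Ht]].
    + simpl; field; auto.
    + unfold injC; rewrite hecke_series_2_0; reflexivity.
Qed.

Lemma conv_jseries : conv jseries.
Proof. destruct j_exists as [J [_ HJ]]; exact (conv_of_upper _ _ HJ). Qed.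

Lemma congruent_0_plus (D : Z) (x y : C) : congruent_0_mod D x -> congruent_0_mod D y -> congruent_0_mod D (x + y).
Proof.
  intros [m ->] [n ->]; exists (m + n)%Z; rewrite <- RtoC_plus, <- plus_IZR; do 2 f_equal; ring.
Qed.

(** The coefficients are complex and no integrality is assumed beyond exponent 0: that all of them
    are integers is part of what is obtained. *)
Theorem principal_part_congruence (D : Z) (N : nat) (f : C -> C) (b : nat -> C) :
  (forall t, (0 < Im t)%R -> f (- (1) / t) = f t) ->
  (forall t, (0 < Im t)%R -> cev b (nome t) (nome t ^ N * f t)) ->
  (forall n, (n <= N)%nat -> congruent_0_mod D (b n)) ->
  forall n, congruent_0_mod D (b n).
Proof.
  destruct j_exists as [J [HJS HJ]].
  revert f b; induction N as [|N IH]; intros f b HS Hb Hp n.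
  - destruct n as [|n]; [apply Hp; lia|].
    (* With no pole left, [f - b 0] vanishes at the cusp and hence identically, so all later
       coefficients are 0. *)
    set (b' := fun n => match n with O => RtoC 0 | S k => b (S k) end).
    assert (Hb' : b' (S n) = 0).
    { apply (vanishing (fun t => f t - b 0%nat) b').
      - intros t Ht; specialize (Hb t Ht).
        eapply Ccv_eq; [|eapply Ccv_ext; [|apply Ccv_minus; [apply Hb|apply (cev_scal (b 0%nat) _ _ _ (ev_one (nome t)))]]].
        + simpl; ring.
        + intros m; cbv beta.
          replace (Csum (fun i => b i * nome t ^ i) m - _) with
            (Csum (fun i => b i * nome t ^ i) m + (- (1)) * Csum (fun i => b 0%nat * injC fone i * nome t ^ i) m) by ring.
          rewrite <- Csum_scal, <- Csum_plus; apply Csum_ext; intros [|i] _; unfold injC, fone, b'; cbn [Nat.eqb]; ring.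
      - intros t Ht; rewrite HS by auto; reflexivity.
      - reflexivity. }
    change (b (S n)) with (b' (S n)); rewrite Hb'; exists 0%Z; rewrite Z.mul_0_r; reflexivity.
  - destruct (Hp 0%nat ltac:(lia)) as [m Hm].
    destruct n as [|n]; [apply Hp; lia|].
    set (d := RtoC (IZR (D * m))) in *.
    (* Because [J] has leading coefficient 1, subtracting [d J^(N+1)] cancels the leading pole;
       because [D] divides [d], it changes nothing modulo [D]. *)
    set (b' := fun n => b n + (- d) * injC (fpow jseries (S N)) n).
    assert (Hj : forall n, congruent_0_mod D (- d * injC (fpow jseries (S N)) n)).
    { intros i; exists (- m * fpow jseries (S N) i)%Z; unfold d, injC.
      rewrite <- RtoC_opp, <- RtoC_mult, <- opp_IZR, <- mult_IZR; do 2 f_equal; ring. }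
    assert (H : congruent_0_mod D (b' (S n))).
    { apply (IH (fun t => f t - d * J t ^ S N) (fun n => b' (S n))).
      - intros t Ht; rewrite HS, HJS by auto; reflexivity.
      - intros t Ht; pose proof (nome_neq_0 t) as Hq; pose proof (nome_lt_1 t Ht) as Hq1.
        eapply Ccv_eq; [|apply (cev_tail b' (nome t)); [exact Hq| |
          apply cev_plus; [apply Hb, Ht|exact (cev_scal (- d) _ _ _ (ev_pow jseries (nome t) (nome t * J t) (S N) conv_jseries Hq1 (HJ t Ht)))]]].
        + rewrite Cpow_mult_l, Cpow_S; field; auto.
        + unfold b'; rewrite Hm; unfold injC; rewrite fpow_0 by apply jseries_0; ring.
      - intros i Hi; apply congruent_0_plus; [apply Hp; lia|apply Hj]. }
    replace (b (S n)) with (b' (S n) + d * injC (fpow jseries (S N)) (S n)) by (unfold b'; ring).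
    apply congruent_0_plus; [exact H|].
    exists (m * fpow jseries (S N) (S n))%Z; unfold d, injC; rewrite <- RtoC_mult, <- mult_IZR; do 2 f_equal; ring.
Qed.

(** * Congruences between power series *)

(** The truncated form is the one that finite lists can certify; rules are proved for it and carried
    over to [fcong] by [fcong_L]. *)
Definition fcongL (L : nat) (D : Z) (a b : fps) : Prop :=
  forall n, (n < L)%nat -> (D | a n - b n)%Z.
Definition fcong (D : Z) (a b : fps) : Prop := forall n, (D | a n - b n)%Z.

Lemma fcong_L (D : Z) (a b : fps) : fcong D a b <-> forall L, fcongL L D a b.
Proof. split; [intros H L n _; apply H|intros H n; apply (H (S n)); lia]. Qed.

Lemma Zsum_divide (D : Z) (f : nat -> Z) (n : nat) :
  (forall i, (i < n)%nat -> (D | f i)%Z) -> (D | Zsum f n)%Z.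
Proof. induction n as [|n IH]; intros H; simpl; [apply Z.divide_0_r|apply Z.divide_add_r; auto]. Qed.

Lemma Zmul_divide (D1 D2 x y : Z) : (D1 | x)%Z -> (D2 | y)%Z -> (D1 * D2 | x * y)%Z.
Proof. intros [u ->] [v ->]; exists (u * v)%Z; ring. Qed.

Lemma fmul_divide_L (L : nat) (D1 D2 : Z) (a b : fps) :
  (forall n, (n < L)%nat -> (D1 | a n)%Z) -> (forall n, (n < L)%nat -> (D2 | b n)%Z) ->
  forall n, (n < L)%nat -> (D1 * D2 | fmul a b n)%Z.
Proof. intros Ha Hb n Hn; apply Zsum_divide; intros i Hi; apply Zmul_divide; [apply Ha|apply Hb]; lia. Qed.

Lemma fcongL_refl (L : nat) (D : Z) (a : fps) : fcongL L D a a.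
Proof. intros n _; rewrite Z.sub_diag; apply Z.divide_0_r. Qed.

Lemma fcongL_sym (L : nat) (D : Z) (a b : fps) : fcongL L D a b -> fcongL L D b a.
Proof. intros H n Hn; replace (b n - a n)%Z with (- (a n - b n))%Z by ring; apply Z.divide_opp_r; auto. Qed.

Lemma fcongL_trans (L : nat) (D : Z) (a b c : fps) : fcongL L D a b -> fcongL L D b c -> fcongL L D a c.
Proof.
  intros H1 H2 n Hn; replace (a n - c n)%Z with ((a n - b n) + (b n - c n))%Z by ring.
  apply Z.divide_add_r; auto.
Qed.

Lemma fcongL_add (L : nat) (D : Z) (a b a' b' : fps) :
  fcongL L D a a' -> fcongL L D b b' -> fcongL L D (fadd a b) (fadd a' b').
Proof.
  intros H1 H2 n Hn; unfold fadd; replace (a n + b n - (a' n + b' n))%Z with ((a n - a' n) + (b n - b' n))%Z by ring.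
  apply Z.divide_add_r; auto.
Qed.

Lemma fcongL_mul (L : nat) (D : Z) (a b a' b' : fps) :
  fcongL L D a a' -> fcongL L D b b' -> fcongL L D (fmul a b) (fmul a' b').
Proof.
  intros H1 H2 n Hn.
  assert (E : (fmul a b n - fmul a' b' n = fmul (fsub a a') b n + fmul a' (fsub b b') n)%Z).
  { assert (E0 : fsub (fmul a b) (fmul a' b') = fadd (fmul (fsub a a') b) (fmul a' (fsub b b'))) by ring.
    exact (f_equal (fun g : fps => g n) E0). }
  rewrite E; apply Z.divide_add_r.
  - rewrite <- (Z.mul_1_r D); apply (fmul_divide_L L D 1); auto; intros; apply Z.divide_1_l.
  - rewrite <- (Z.mul_1_l D); apply (fmul_divide_L L 1 D); auto; intros; apply Z.divide_1_l.
Qed.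

Lemma fcongL_pow (L : nat) (D : Z) (a b : fps) (k : nat) :
  fcongL L D a b -> fcongL L D (fpow a k) (fpow b k).
Proof. intros H; induction k; simpl; [apply fcongL_refl|now apply fcongL_mul]. Qed.

Lemma fcong_mul (D : Z) (a b a' b' : fps) :
  fcong D a a' -> fcong D b b' -> fcong D (fmul a b) (fmul a' b').
Proof. rewrite !fcong_L; intros H1 H2 L; now apply fcongL_mul. Qed.

Lemma fcong_pow (D : Z) (a b : fps) (k : nat) : fcong D a b -> fcong D (fpow a k) (fpow b k).
Proof. rewrite !fcong_L; intros H1 L; now apply fcongL_pow. Qed.

Lemma fcong_trans (D : Z) (a b c : fps) : fcong D a b -> fcong D b c -> fcong D a c.
Proof. rewrite !fcong_L; intros H1 H2 L; eapply fcongL_trans; eauto. Qed.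

Lemma fcong_refl (D : Z) (a : fps) : fcong D a a.
Proof. rewrite fcong_L; intros L; apply fcongL_refl. Qed.

Lemma fpow_add (a : fps) (m n : nat) : fpow a (m + n) = fmul (fpow a m) (fpow a n).
Proof. induction m as [|m IH]; simpl; [ring|rewrite IH; ring]. Qed.

Lemma fpow_mul (a : fps) (m n : nat) : fpow a (m * n) = fpow (fpow a m) n.
Proof.
  induction n as [|n IH]; [rewrite Nat.mul_0_r; reflexivity|].
  rewrite Nat.mul_succ_r, Nat.add_comm, fpow_add, IH; reflexivity.
Qed.

Lemma fpow_mul_l (a b : fps) (n : nat) : fpow (fmul a b) n = fmul (fpow a n) (fpow b n).
Proof. induction n as [|n IH]; simpl; [ring|rewrite IH; ring]. Qed.

Lemma fpow_one (n : nat) : fpow fone n = fone.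
Proof. induction n as [|n IH]; simpl; [reflexivity|rewrite IH; ring]. Qed.

(** An integer multiple as repeated addition: for a numeral [n] it unfolds into ring operations that
    [ring] understands. *)
Fixpoint ftimes (n : nat) (a : fps) : fps :=
  match n with O => fzero | S k => fadd a (ftimes k a) end.

Lemma ftimes_coef (n : nat) (a : fps) (i : nat) : ftimes n a i = (Z.of_nat n * a i)%Z.
Proof.
  induction n as [|n IH]; [reflexivity|].
  cbn [ftimes]; unfold fadd; rewrite IH, Nat2Z.inj_succ; ring.
Qed.

Lemma fmul_ftimes (n : nat) (a b : fps) : fmul a (ftimes n b) = ftimes n (fmul a b).
Proof. induction n as [|n IH]; cbn [ftimes]; [ring|rewrite <- IH; ring]. Qed.

Lemma Zsum_multiples (p : nat) (f : nat -> Z) : (0 < p)%nat ->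
  (forall n, (n mod p <> 0)%nat -> f n = 0%Z) ->
  forall k j, (j < p)%nat -> Zsum f (S (p * k + j)) = Zsum (fun n => f (p * n)%nat) (S k).
Proof.
  intros Hp Hf.
  assert (Hj : forall k j, (j < p)%nat -> Zsum f (S (p * k + j)) = Zsum f (S (p * k))).
  { intros k; induction j as [|j IH]; intros Hj; [rewrite Nat.add_0_r; reflexivity|].
    rewrite Nat.add_succ_r.
    change (Zsum f (S (S (p * k + j)))) with (Zsum f (S (p * k + j)) + f (S (p * k + j)))%Z.
    rewrite IH by lia.
    rewrite (Hf (S (p * k + j))); [ring|].
    replace (S (p * k + j)) with (S j + k * p)%nat by lia.
    rewrite Nat.Div0.mod_add, Nat.mod_small by lia; lia. }
  intros k j Hjp; rewrite Hj by exact Hjp; clear j Hjp.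
  induction k as [|k IH]; [rewrite Nat.mul_0_r; simpl; rewrite Nat.mul_0_r; reflexivity|].
  change (Zsum (fun n => f (p * n)%nat) (S (S k))) with (Zsum (fun n => f (p * n)%nat) (S k) + f (p * S k)%nat)%Z.
  rewrite <- IH, <- (Hj k (p - 1)%nat) by lia.
  replace (S (p * k + (p - 1))) with (p * S k)%nat by lia; reflexivity.
Qed.

(** A series in [q^p] can be taken out of [U_p]. This is what converts the power of Euler's product
    inside the Hecke operator into a factor outside it. *)
Lemma fU_spread_mul (p : nat) (b c : fps) : (0 < p)%nat ->
  fU p (fmul b (fspread p c)) = fmul (fU p b) c.
Proof.
  intros Hp; rewrite (fmul_comm b), (fmul_comm (fU p b)); extensionality n.
  pose proof (Zsum_multiples p (fun i => fspread p c i * b (p * n - i)%nat)%Z Hp) as M.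
  specialize (M ltac:(intros i Hi; cbv beta; unfold fspread; destruct (Nat.eqb_spec (i mod p) 0); [lia|ring]) n 0%nat Hp).
  rewrite Nat.add_0_r in M; etransitivity; [exact M|].
  apply Zsum_ext; intros i Hi; unfold fspread, fU.
  rewrite (Nat.mul_comm p i), Nat.Div0.mod_mul, Nat.div_mul by lia; cbn [Nat.eqb].
  f_equal; f_equal; nia.
Qed.

Lemma fspread_mul (p : nat) (a b : fps) : (0 < p)%nat ->
  fspread p (fmul a b) = fmul (fspread p a) (fspread p b).
Proof.
  intros Hp; extensionality n; unfold fspread at 1.
  set (k := (n / p)%nat); set (j := (n mod p)%nat).
  assert (Hj : (j < p)%nat) by (apply Nat.mod_upper_bound; lia).
  assert (En : n = (p * k + j)%nat) by (apply Nat.div_mod_eq).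
  unfold fmul at 2; rewrite En.
  rewrite (Zsum_multiples p (fun i => fspread p a i * fspread p b (p * k + j - i)%nat)%Z Hp); [| |exact Hj].
  - destruct (Nat.eqb_spec j 0) as [->|Hj0].
    + unfold fmul; apply Zsum_ext; intros i Hi; unfold fspread.
      rewrite (Nat.mul_comm p i), Nat.Div0.mod_mul, Nat.div_mul by lia.
      replace (p * k + 0 - i * p)%nat with ((k - i) * p)%nat by nia.
      rewrite Nat.Div0.mod_mul, Nat.div_mul by lia; reflexivity.
    + rewrite (Zsum_ext _ (fun _ => 0%Z)); [rewrite Zsum_zero; reflexivity|].
      intros i Hi; unfold fspread at 2.
      replace (p * k + j - p * i)%nat with (j + (k - i) * p)%nat by nia.
      rewrite Nat.Div0.mod_add, Nat.mod_small by lia.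
      destruct (Nat.eqb_spec j 0); [lia|ring].
  - intros i Hi; unfold fspread at 1; destruct (Nat.eqb_spec (i mod p) 0); [lia|ring].
Qed.

Lemma fspread_one (p : nat) : (0 < p)%nat -> fspread p fone = fone.
Proof.
  intros Hp; extensionality n; unfold fspread, fone.
  destruct (Nat.eqb_spec (n mod p) 0) as [E|E].
  - destruct (Nat.eqb_spec (n / p) 0) as [E2|E2], (Nat.eqb_spec n 0) as [E3|E3]; try reflexivity.
    + pose proof (Nat.div_mod_eq n p); lia.
    + subst; rewrite Nat.Div0.div_0_l in E2; lia.
  - destruct (Nat.eqb_spec n 0); [subst; rewrite Nat.Div0.mod_0_l in E; lia|reflexivity].
Qed.

Lemma fspread_pow (p : nat) (a : fps) (k : nat) : (0 < p)%nat ->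
  fspread p (fpow a k) = fpow (fspread p a) k.
Proof. intros Hp; induction k; simpl; [now apply fspread_one|rewrite fspread_mul, IHk; auto]. Qed.

Lemma fspread_fX (p m : nat) : (0 < p)%nat -> fspread p (fX m) = fX (p * m).
Proof.
  intros Hp; extensionality n; unfold fspread, fX.
  pose proof (Nat.div_mod_eq n p); pose proof (Nat.mod_upper_bound n p ltac:(lia)).
  destruct (Nat.eqb_spec (n mod p) 0) as [E|E].
  - destruct (Nat.eqb_spec (n / p) m), (Nat.eqb_spec n (p * m)); try reflexivity; exfalso; nia.
  - destruct (Nat.eqb_spec n (p * m)) as [E2|]; [|reflexivity].
    subst; rewrite Nat.mul_comm, Nat.Div0.mod_mul in E; lia.
Qed.

Lemma fX_pow (m k : nat) : fpow (fX m) k = fX (k * m).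
Proof.
  induction k as [|k IH]; [reflexivity|].
  simpl; rewrite IH, fmul_fX; extensionality n; unfold fshift, fX.
  destruct (Nat.leb_spec m n).
  - destruct (Nat.eqb_spec (n - m) (k * m)), (Nat.eqb_spec n (m + k * m)); try reflexivity; lia.
  - destruct (Nat.eqb_spec n (m + k * m)); [lia|reflexivity].
Qed.

(** The inner binomial coefficients of a prime exponent are divisible by [p]; the quotient is
    written down explicitly for each prime. *)
Lemma one_minus_X_frobenius (p m : nat) : hecke_primes p ->
  fcong (Z.of_nat p) (fpow (one_minus_X m) p) (fspread p (one_minus_X m)).
Proof.
  intros Hp.
  assert (Hs : fspread p (one_minus_X m) = fsub fone (fpow (fX m) p)).
  { rewrite fX_pow, <- fspread_fX by (unfold hecke_primes in Hp; lia).
    rewrite <- (fspread_one p) at 1 by (unfold hecke_primes in Hp; lia).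
    extensionality n; unfold one_minus_X, fspread, fsub; destruct (Nat.eqb (n mod p) 0); reflexivity. }
  rewrite Hs; unfold one_minus_X; set (x := fX m); clearbody x; clear Hs m.
  (* The witness is [((1 - x)^p - (1 - x^p)) / p], whose coefficients are [binomial(p, i) / p] up to
     sign, in Horner form from [p = 5] on. *)
  assert (H : exists h, fsub (fpow (fsub fone x) p) (fsub fone (fpow x p)) = ftimes p h).
  { destruct Hp as [->|[->|[->|[->| ->]]]].
    - exists (fsub (fmul x x) x); cbn [fpow ftimes]; ring.
    - exists (fsub (fmul x x) x); cbn [fpow ftimes]; ring.
    - exists (fmul x (fadd (fopp fone) (fmul x (fadd (ftimes 2 fone) (fmul x (fadd (fopp (ftimes 2 fone)) x))))));
        cbn [fpow ftimes]; ring.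
    - exists (fmul x (fadd (fopp fone) (fmul x (fadd (ftimes 3 fone) (fmul x (fadd (fopp (ftimes 5 fone))
        (fmul x (fadd (ftimes 5 fone) (fmul x (fadd (fopp (ftimes 3 fone)) x)))))))))); cbn [fpow ftimes]; ring.
    - exists (fmul x (fadd (fopp fone) (fmul x (fadd (ftimes 5 fone) (fmul x (fadd (fopp (ftimes 15 fone))
        (fmul x (fadd (ftimes 30 fone) (fmul x (fadd (fopp (ftimes 42 fone)) (fmul x (fadd (ftimes 42 fone)
        (fmul x (fadd (fopp (ftimes 30 fone)) (fmul x (fadd (ftimes 15 fone) (fmul x (fadd (fopp (ftimes 5 fone)) x))))))))))))))))));
        cbn [fpow ftimes]; ring. }
  destruct H as [h H]; intros n.
  change (Z.of_nat p | fsub (fpow (fsub fone x) p) (fsub fone (fpow x p)) n)%Z.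
  rewrite H, ftimes_coef; apply Z.divide_factor_l.
Qed.

Lemma euler_frobenius (p : nat) : hecke_primes p ->
  fcong (Z.of_nat p) (fpow euler p) (fspread p euler).
Proof.
  intros Hp; assert (Hp0 : (0 < p)%nat) by (unfold hecke_primes in Hp; lia).
  assert (Hpart : forall L, fcong (Z.of_nat p) (fpow (euler_part L) p) (fspread p (euler_part L))).
  { induction L as [|L IH].
    - simpl; rewrite fpow_one, fspread_one by exact Hp0; apply fcong_refl.
    - cbn [euler_part]; rewrite fpow_mul_l, fspread_mul by exact Hp0.
      apply fcong_mul; [exact IH|now apply one_minus_X_frobenius]. }
  assert (Hloc : forall k n L, (n <= L)%nat -> fpow euler k n = fpow (euler_part L) k n).
  { induction k as [|k IH]; intros n L HL; [reflexivity|].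
    simpl; apply fmul_local; intros i Hi; [rewrite euler_part_stable by lia; reflexivity|apply IH; lia]. }
  intros n; rewrite (Hloc p n n) by lia.
  replace (fspread p euler n) with (fspread p (euler_part n) n); [apply Hpart|].
  unfold fspread; destruct (Nat.eqb (n mod p) 0); [|reflexivity].
  apply euler_part_stable; apply Nat.Div0.div_le_upper_bound; nia.
Qed.

(** * Lifting the Frobenius congruence to prime powers *)

Fixpoint geom_sum (a b : fps) (n : nat) : fps :=
  match n with O => fzero | S k => fadd (fpow a k) (fmul b (geom_sum a b k)) end.

Lemma geom_sum_spec (a b : fps) (n : nat) :
  fsub (fpow a n) (fpow b n) = fmul (fsub a b) (geom_sum a b n).
Proof.
  induction n as [|n IH]; simpl; [ring|].
  transitivity (fadd (fmul (fsub a b) (fpow a n)) (fmul b (fsub (fpow a n) (fpow b n)))); [ring|].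
  rewrite IH; ring.
Qed.

Lemma geom_sum_cong (D : Z) (a b : fps) (n : nat) : fcong D a b ->
  fcong D (geom_sum a b (S n)) (ftimes (S n) (fpow b n)).
Proof.
  intros H; induction n as [|n IH].
  - simpl; replace (fadd fone (fmul b fzero)) with (fadd fone fzero) by ring; apply fcong_refl.
  - change (geom_sum a b (S (S n))) with (fadd (fpow a (S n)) (fmul b (geom_sum a b (S n)))).
    apply (fcong_trans _ _ (fadd (fpow b (S n)) (fmul b (ftimes (S n) (fpow b n))))).
    + rewrite fcong_L; intros L; apply fcongL_add; revert L; rewrite <- fcong_L.
      * now apply fcong_pow.
      * apply fcong_mul; [apply fcong_refl|exact IH].
    + change (ftimes (S (S n)) (fpow b (S n))) with (fadd (fpow b (S n)) (ftimes (S n) (fpow b (S n)))).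
      rewrite fmul_ftimes; apply fcong_refl.
Qed.

(** In [a^p - b^p = (a - b) * geom_sum a b p] the second factor is congruent to [p b^(p-1)] modulo
    [p], so it supplies the additional factor [p]. *)
Lemma fcong_lift (p : nat) (D : Z) (a b : fps) : (0 < p)%nat -> (Z.of_nat p | D)%Z -> fcong D a b ->
  fcong (D * Z.of_nat p) (fpow a p) (fpow b p).
Proof.
  intros Hp HD H n.
  change (D * Z.of_nat p | fsub (fpow a p) (fpow b p) n)%Z.
  rewrite geom_sum_spec; apply (fmul_divide_L (S n)); [intros i _; apply H| |lia].
  intros i _; destruct p as [|p]; [lia|].
  assert (H1 : fcong (Z.of_nat (S p)) a b) by (intros j; eapply Z.divide_trans; [exact HD|apply H]).
  pose proof (geom_sum_cong _ a b p H1 i) as H2; rewrite ftimes_coef in H2.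
  replace (geom_sum a b (S p) i) with ((geom_sum a b (S p) i - Z.of_nat (S p) * fpow b p i) + Z.of_nat (S p) * fpow b p i)%Z by ring.
  apply Z.divide_add_r; [exact H2|apply Z.divide_factor_l].
Qed.

Lemma euler_frobenius_pow (p e : nat) : hecke_primes p ->
  fcong (Z.of_nat p ^ Z.of_nat (S e)) (fpow euler (p ^ S e)) (fspread p (fpow euler (p ^ e))).
Proof.
  intros Hp; assert (Hp0 : (0 < p)%nat) by (unfold hecke_primes in Hp; lia).
  rewrite fspread_pow by exact Hp0.
  induction e as [|e IH].
  - simpl Nat.pow; rewrite Nat.mul_1_r; simpl fpow at 2.
    replace (fmul (fspread p euler) fone) with (fspread p euler) by ring.
    replace (Z.of_nat p ^ Z.of_nat 1)%Z with (Z.of_nat p) by (simpl; lia); now apply euler_frobenius.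
  - replace (p ^ S (S e))%nat with (p ^ S e * p)%nat by (simpl; ring).
    replace (p ^ S e)%nat with (p ^ e * p)%nat at 2 by (simpl; ring).
    rewrite !fpow_mul.
    replace (Z.of_nat p ^ Z.of_nat (S (S e)))%Z with (Z.of_nat p ^ Z.of_nat (S e) * Z.of_nat p)%Z.
    + apply fcong_lift; auto.
      rewrite Nat2Z.inj_succ, Z.pow_succ_r by lia; apply Z.divide_factor_l.
    + rewrite (Nat2Z.inj_succ (S e)), Z.pow_succ_r by lia; ring.
Qed.

(** * Reduction to finitely many coefficients *)

Lemma congruent_IZR (D x : Z) : congruent_0_mod D (RtoC (IZR x)) <-> (D | x)%Z.
Proof.
  split.
  - intros [m E]; apply RtoC_inj, eq_IZR in E; exists m; rewrite E; ring.
  - intros [m ->]; exists m; do 2 f_equal; ring.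
Qed.

Lemma fmul_fshift_l (k : nat) (a b : fps) : fshift k (fmul a b) = fmul (fshift k a) b.
Proof. rewrite <- !fmul_fX; ring. Qed.

Lemma fU_cong (p : nat) (D : Z) (a b : fps) : fcong D a b -> fcong D (fU p a) (fU p b).
Proof. intros H n; apply H. Qed.

(* Since [E^(24 p M) = E(q^p)^(24 M)] modulo [p^(e+1)], the Hecke transform of
   [f Delta^(p M)] is congruent to [Delta^M] times the image of [f] under [U_p]. *)
Theorem Up_congruence (p M e s k : nat) (f : C -> C) (a : fps) :
  let D := (Z.of_nat p ^ Z.of_nat (S e))%Z in
  hecke_primes p -> (0 < M)%nat -> (24 * M = p ^ e * s)%nat -> (k <= p * M)%nat ->
  (S e <= 12 * (p * M) - 1)%nat -> SL2Z_invariant f ->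
  (forall t, (0 < Im t)%R -> ev a (nome t) (nome t ^ k * f t)) ->
  (forall n, (n <= p * M)%nat -> (D | fU p (fshift (p * M - k) a) n)%Z) ->
  forall n, (D | fU p (fshift (p * M - k) a) n)%Z.
Proof.
  intros D Hp HM Hs Hk He Hf Ha Hlow.
  assert (Hp0 : (0 < p)%nat) by (unfold hecke_primes in Hp; lia).
  set (r := (p * M)%nat) in *.
  assert (Hr : (0 < r)%nat) by (unfold r; nia).
  destruct (hecke_modular p r k f a Hp Hr Hk Hf Ha) as [F [HS HF]].
  set (b := fshift (r - k) a) in *.
  set (u := fU p b) in *.
  set (H := hecke_series p r k a) in *.
  assert (HE : fcong D (fpow euler (24 * r)) (fspread p (fpow euler (24 * M)))).
  { replace (24 * r)%nat with (p ^ S e * s)%nat by (unfold r; simpl; rewrite <- Nat.mul_assoc, <- Hs; ring).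
    rewrite Hs, !fpow_mul, (fspread_pow p (fpow euler (p ^ e))) by exact Hp0.
    apply fcong_pow, euler_frobenius_pow, Hp. }
  assert (HH : fcong D H (fmul (fpow partitions (24 * r)) (fmul u (fpow euler (24 * M))))).
  { unfold H, hecke_series; apply fcong_mul; [apply fcong_refl|].
    apply (fcong_trans _ _ (fU p (hecke_source r k a))).
    (* The term in [q^p] carries [p^(12 r - 1)], which [D = p^(e+1)] divides. *)
    - intros n; unfold fadd.
      match goal with |- (D | ?x * ?y + ?z - ?z)%Z => replace (x * y + z - z)%Z with (x * y)%Z by ring end.
      apply Z.divide_mul_l; unfold D; exists (Z.of_nat p ^ (Z.of_nat (12 * r - 1) - Z.of_nat (S e)))%Z.
      rewrite <- Z.pow_add_r by lia; f_equal; lia.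
    - unfold u; rewrite <- fU_spread_mul by exact Hp0; apply fU_cong.
      unfold hecke_source; rewrite fmul_fshift_l; fold b; apply fcong_mul; [apply fcong_refl|exact HE]. }
  assert (HD : forall n, (D | H n)%Z).
  { intros n; apply congruent_IZR; change (congruent_0_mod D (injC H n)).
    revert n; apply (principal_part_congruence D r F); auto.
    intros n Hn; apply congruent_IZR.
    replace (H n) with ((H n - fmul (fpow partitions (24 * r)) (fmul u (fpow euler (24 * M))) n) +
      fmul (fpow partitions (24 * r)) (fmul u (fpow euler (24 * M))) n)%Z by ring.
    apply Z.divide_add_r; [apply HH|].
    rewrite <- (Z.mul_1_l D); apply (fmul_divide_L (S r) 1 D); [intros; apply Z.divide_1_l| |lia].
    intros i Hi; rewrite <- (Z.mul_1_r D); apply (fmul_divide_L (S r) D 1); [|intros; apply Z.divide_1_l|lia].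
    intros j Hj; apply Hlow; lia. }
  assert (HEP : forall m, fmul (fpow euler m) (fpow partitions m) = fone).
  { intros m; rewrite <- fpow_mul_l, euler_partitions; apply fpow_one. }
  (* The powers of Euler's product are invertible over the integers, so divisibility passes back
     from the Hecke series to [u]. *)
  assert (Hu : u = fmul (fmul (fpow partitions (24 * r)) (fmul u (fpow euler (24 * M))))
     (fmul (fpow euler (24 * r)) (fpow partitions (24 * M)))).
  { transitivity (fmul u (fmul (fmul (fpow euler (24 * r)) (fpow partitions (24 * r))) (fmul (fpow euler (24 * M)) (fpow partitions (24 * M))))); [|ring].
    rewrite !HEP; ring. }
  intros n; rewrite Hu, <- (Z.mul_1_r D).
  apply (fmul_divide_L (S n) D 1); [|intros; apply Z.divide_1_l|lia].
  intros i _.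
  replace (fmul (fpow partitions (24 * r)) (fmul u (fpow euler (24 * M))) i) with
    (H i - (H i - fmul (fpow partitions (24 * r)) (fmul u (fpow euler (24 * M))) i))%Z by ring.
  apply Z.divide_sub_r; [apply HD|apply HH].
Qed.

(** Horner's scheme for [q^d] times the polynomial in [J] with coefficients [cs] in increasing
    degree, where [d = length cs - 1]; the power of [q] clears the pole. *)
Fixpoint jpoly (cs : list Z) : fps :=
  match cs with
  | nil => fzero
  | c :: cs' => fadd (fun n => c * fX (length cs') n)%Z (fmul jseries (jpoly cs'))
  end.

Fixpoint jfun (J : C -> C) (cs : list Z) (t : C) : C :=
  match cs with nil => 0 | c :: cs' => IZR c + J t * jfun J cs' t end.

Lemma ev_zero (q : C) : ev fzero q 0.
Proof. apply (ev_finite fzero q 0); reflexivity. Qed.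

Lemma conv_zero : conv fzero.
Proof. apply conv_of_ev; intros q _; exists 0; apply ev_zero. Qed.

Lemma conv_fX (m : nat) : conv (fX m).
Proof. apply conv_of_ev; intros q _; eexists; apply ev_fX. Qed.

Lemma conv_jpoly (cs : list Z) : conv (jpoly cs).
Proof.
  induction cs as [|c cs IH]; simpl; [apply conv_zero|].
  apply conv_add; [apply conv_fscal, conv_fX|apply conv_mul; [apply conv_jseries|exact IH]].
Qed.

Lemma jpoly_ev (J : C -> C) (cs : list Z) :
  (forall t, (0 < Im t)%R -> ev jseries (nome t) (nome t * J t)) ->
  forall t, (0 < Im t)%R -> ev (jpoly cs) (nome t) (nome t ^ pred (length cs) * jfun J cs t).
Proof.
  intros HJ t Ht; pose proof (nome_lt_1 t Ht) as Hq; induction cs as [|c cs IH].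
  - eapply Ccv_eq; [|apply ev_zero]; simpl; ring.
  - cbn [jpoly jfun length pred].
    eapply Ccv_eq; [|apply ev_add; [apply ev_fscal, ev_fX|
      apply ev_mul; [apply conv_jseries|apply conv_jpoly|exact Hq|apply HJ, Ht|exact IH]]].
    destruct cs as [|c' cs]; simpl; ring.
Qed.

Lemma CpowZ_shift (q : C) (i k : nat) : q <> 0 ->
  q ^ k * CpowZ q (Z.of_nat i - Z.of_nat k) = q ^ i.
Proof.
  intros Hq; destruct (Z.of_nat i - Z.of_nat k)%Z as [|m|m] eqn:E; simpl CpowZ.
  - replace i with k by lia; ring.
  - rewrite <- Cpow_add_r; f_equal; lia.
  - replace k with (i + Pos.to_nat m)%nat by lia; rewrite Cpow_add_r; field; now apply Cpow_nz.
Qed.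

Lemma Int_part_IZR (z : Z) : Int_part (IZR z) = z.
Proof. unfold Int_part; rewrite <- (tech_up (IZR z) (z + 1)); [lia| |]; rewrite plus_IZR; lra. Qed.

Lemma is_Z_expansion (k : nat) (Zk : C -> C) (w : Z -> C) : is_Z (Z.of_nat k) Zk w ->
  forall t, (0 < Im t)%R -> cev (fun i => w (Z.of_nat i - Z.of_nat k)%Z) (nome t) (nome t ^ k * Zk t).
Proof.
  intros [_ [[_ H] _]] t Ht; specialize (H t Ht); apply is_series_Ccv in H.
  eapply Ccv_ext; [|apply (Ccv_scal (nome t ^ k)), H]; intros n; cbv beta.
  rewrite <- Csum_scal; apply Csum_ext; intros i _.
  rewrite <- (CpowZ_shift (nome t) i k (nome_neq_0 t)); ring.
Qed.

Lemma SL2Z_invariant_S (f : C -> C) : SL2Z_invariant f ->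
  forall t, (0 < Im t)%R -> f (- (1) / t) = f t.
Proof.
  intros H t Ht; rewrite <- (H 0 (-1) 1 0 ltac:(lia) t Ht)%Z; f_equal.
  replace (RtoC (IZR (-1))) with (- (1)) by (rewrite <- RtoC_opp; f_equal; lra).
  pose proof (upper_neq_0 t Ht); f_equal; ring.
Qed.

(** Both functions are invariant with poles of order at most [k], so agreement modulo [D] at
    exponents up to 0 spreads to all exponents. This is where the [w n] become integers. *)
Lemma is_Z_congruence (D : Z) (k : nat) (Zk : C -> C) (w : Z -> C) (cs : list Z) (pc : nat -> Z) :
  is_Z (Z.of_nat k) Zk w -> length cs = S k ->
  (forall n, (n <= k)%nat -> product_coef n = IZR (pc n)) ->
  (forall n, (n <= k)%nat -> (D | pc n - jpoly cs n)%Z) ->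
  forall n, congruent_0_mod D (w (Z.of_nat n - Z.of_nat k)%Z + - (1) * injC (jpoly cs) n).
Proof.
  intros HZ Hlen Hpc Hlow.
  destruct j_exists as [J [HJS HJ]].
  apply (principal_part_congruence D k (fun t => Zk t + - (1) * jfun J cs t)).
  - intros t Ht; rewrite (SL2Z_invariant_S Zk) by (auto; apply HZ).
    f_equal; f_equal; clear Hlow Hlen; induction cs as [|c cs IH]; simpl; [reflexivity|].
    rewrite HJS, IH by auto; reflexivity.
  - intros t Ht; eapply Ccv_eq; [|apply cev_plus; [apply (is_Z_expansion k Zk w HZ t Ht)|
      apply cev_scal, (jpoly_ev J cs HJ t Ht)]].
    rewrite Hlen; simpl pred; ring.
  - intros n Hn; destruct HZ as [_ [_ HZ]]; rewrite HZ by lia; rewrite Hpc by exact Hn.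
    unfold injC; rewrite <- RtoC_opp, <- RtoC_mult, <- RtoC_plus.
    replace (IZR (pc n) + - (1) * IZR (jpoly cs n))%R with (IZR (pc n - jpoly cs n)) by (rewrite minus_IZR; ring).
    apply congruent_IZR; auto.
Qed.

Theorem prime_case (p M e s k : nat) (Zk : C -> C) (w : Z -> C) (cs : list Z) (pc : nat -> Z) :
  let D := (Z.of_nat p ^ Z.of_nat (S e))%Z in
  hecke_primes p -> (0 < M)%nat -> (24 * M = p ^ e * s)%nat -> (k <= p * M)%nat ->
  (S e <= 12 * (p * M) - 1)%nat ->
  is_Z (Z.of_nat k) Zk w -> length cs = S k ->
  (forall n, (n <= k)%nat -> product_coef n = IZR (pc n)) ->
  (forall n, (n <= k)%nat -> (D | pc n - jpoly cs n)%Z) ->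
  (forall n, (n <= p * M)%nat -> (p * M - k <= p * n)%nat -> (p * n <> p * M)%nat ->
     (D | jpoly cs (p * n - (p * M - k))%nat)%Z) ->
  forall n : Z, n <> 0%Z -> congruent_0_mod D (w (Z.of_nat p * n)%Z).
Proof.
  intros D Hp HM Hs Hk He HZ Hlen Hpc Hlow Hchk n Hn.
  assert (Hp0 : (0 < p)%nat) by (unfold hecke_primes in Hp; lia).
  set (b := fun i : nat => w (Z.of_nat i - Z.of_nat k)%Z).
  (* The congruence only asserts that an integer exists; [Int_part] names it as a function of the
     index. *)
  set (A0 := fun i : nat => Int_part (Re (b i))).
  assert (HA0 : forall i, b i = RtoC (IZR (A0 i)) /\ (D | A0 i - jpoly cs i)%Z).
  { intros i; destruct (is_Z_congruence D k Zk w cs pc HZ Hlen Hpc Hlow i) as [m Hm].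
    assert (E : b i = RtoC (IZR (D * m + jpoly cs i))).
    { unfold b; rewrite plus_IZR, RtoC_plus, <- Hm; unfold injC; ring. }
    assert (E2 : A0 i = (D * m + jpoly cs i)%Z) by (unfold A0; rewrite E; simpl Re; apply Int_part_IZR).
    rewrite E2; split; [exact E|exists m; ring]. }
  (* Index [k] is exponent 0, where divisibility by [D] is not claimed; the constant term is removed
     there. *)
  set (A := fun i => (A0 i - (if Nat.eqb i k then A0 k else 0))%Z).
  assert (HA : forall t, (0 < Im t)%R -> ev A (nome t) (nome t ^ k * (Zk t - b k))).
  { intros t Ht.
    eapply Ccv_eq; [|eapply Ccv_ext; [|apply cev_plus; [apply (is_Z_expansion k Zk w HZ t Ht)|
      apply (cev_scal (- b k)), (ev_fX k)]]].
    - ring.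
    - intros m; apply Csum_ext; intros i _; fold (b i); unfold injC, A, fX.
      rewrite (proj1 (HA0 i)), minus_IZR, RtoC_minus.
      destruct (Nat.eqb i k); [rewrite (proj1 (HA0 k))|]; ring. }
  assert (HU : forall n', (D | fU p (fshift (p * M - k) A) n')%Z).
  { apply (Up_congruence p M e s k (fun t => Zk t - b k) A); auto.
    - intros a' b' c' d' Hdet t Ht; destruct HZ as [[_ [Hinv _]] _]; rewrite Hinv by auto; reflexivity.
    - intros n' Hn'; unfold fU, fshift; destruct (Nat.leb_spec (p * M - k) (p * n')); [|apply Z.divide_0_r].
      unfold A; destruct (Nat.eqb_spec (p * n' - (p * M - k)) k) as [E|E].
      + rewrite E, Z.sub_diag; apply Z.divide_0_r.
      + rewrite Z.sub_0_r; set (i := (p * n' - (p * M - k))%nat) in *.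
        replace (A0 i) with ((A0 i - jpoly cs i) + jpoly cs i)%Z by ring.
        apply Z.divide_add_r; [apply HA0|apply Hchk; lia]. }
  destruct (Z.lt_ge_cases (Z.of_nat p * n) (- Z.of_nat k)) as [Hlt|Hge].
  { destruct HZ as [_ [[H0 _] _]]; rewrite H0 by exact Hlt; exists 0%Z; rewrite Z.mul_0_r; reflexivity. }
  assert (HnM : (0 <= n + Z.of_nat M)%Z) by nia.
  (* After the shift by [p M - k], index [p n'] belongs to exponent [p (n' - M)]; hence coefficient
     [n + M] of the [fU] series is [w (p n)]. *)
  set (n' := Z.to_nat (n + Z.of_nat M)).
  assert (En' : Z.of_nat n' = (n + Z.of_nat M)%Z) by (unfold n'; rewrite Z2Nat.id; auto).
  assert (Ep : (Z.of_nat (p * n') = Z.of_nat p * n + Z.of_nat (p * M))%Z) by (rewrite !Nat2Z.inj_mul, En'; ring).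
  specialize (HU n'); unfold fU, fshift in HU.
  destruct (Nat.leb_spec (p * M - k) (p * n')) as [Hle|Hle]; [|lia].
  set (i := (p * n' - (p * M - k))%nat) in *.
  assert (Ei : (Z.of_nat i = Z.of_nat p * n + Z.of_nat k)%Z) by (unfold i; lia).
  assert (Hik : i <> k) by (intros E; assert (Z.of_nat p * n = 0)%Z by lia; nia).
  unfold A in HU; destruct (Nat.eqb_spec i k); [contradiction|]; rewrite Z.sub_0_r in HU.
  replace (Z.of_nat p * n)%Z with (Z.of_nat i - Z.of_nat k)%Z by lia.
  change (congruent_0_mod D (b i)); rewrite (proj1 (HA0 i)); apply congruent_IZR; exact HU.
Qed.

(** * Computation with truncated power series *)

Definition of_list (l : list Z) : fps := fun i => nth i l 0%Z.

Fixpoint laxpy (D c : Z) (n : nat) (ys zs : list Z) : list Z :=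
  match n with
  | O => nil
  | S n' => ((c * hd 0 ys + hd 0 zs) mod D)%Z :: laxpy D c n' (tl ys) (tl zs)
  end.

Fixpoint lmul (D : Z) (n : nat) (xs ys : list Z) : list Z :=
  match n with
  | O => nil
  | S n' => laxpy D (hd 0%Z xs) n ys (0%Z :: lmul D n' (tl xs) ys)
  end.

Lemma nth_hd_tl (l : list Z) (i : nat) : nth i l 0%Z = match i with O => hd 0%Z l | S j => nth j (tl l) 0%Z end.
Proof. destruct i, l; try reflexivity; destruct i; reflexivity. Qed.

Lemma laxpy_nth (D c : Z) (n i : nat) (ys zs : list Z) : (i < n)%nat ->
  of_list (laxpy D c n ys zs) i = ((c * of_list ys i + of_list zs i) mod D)%Z.
Proof.
  unfold of_list; revert i ys zs; induction n as [|n IH]; intros i ys zs Hi; [lia|].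
  rewrite (nth_hd_tl ys), (nth_hd_tl zs); cbn [laxpy].
  destruct i as [|i]; [reflexivity|]; cbn [nth]; apply IH; lia.
Qed.

Lemma mod_cong (D x : Z) : (D | x mod D - x)%Z.
Proof.
  destruct (Z.eq_dec D 0) as [->|HD].
  - rewrite Zmod_0_r, Z.sub_diag; apply Z.divide_0_r.
  - exists (- (x / D))%Z; rewrite Z.mod_eq by exact HD; ring.
Qed.

Lemma fmul_of_list_cons (xs : list Z) (y : fps) (i : nat) :
  fmul (of_list xs) y i = (hd 0 xs * y i + match i with O => 0 | S j => fmul (of_list (tl xs)) y j end)%Z.
Proof.
  unfold fmul; rewrite Zsum_shift, Nat.sub_0_r; unfold of_list at 1; rewrite nth_hd_tl; f_equal.
  destruct i as [|j]; [reflexivity|]; apply Zsum_ext; intros m _.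
  unfold of_list; rewrite nth_hd_tl; reflexivity.
Qed.

Lemma lmul_cong (D : Z) (n : nat) (xs ys : list Z) :
  fcongL n D (of_list (lmul D n xs ys)) (fmul (of_list xs) (of_list ys)).
Proof.
  revert xs; induction n as [|n IH]; intros xs i Hi; [lia|].
  cbn [lmul]; rewrite laxpy_nth, fmul_of_list_cons by exact Hi.
  match goal with |- (D | (?u + ?v) mod D - (?u + ?w))%Z =>
    replace ((u + v) mod D - (u + w))%Z with (((u + v) mod D - (u + v)) + (v - w))%Z by ring end.
  apply Z.divide_add_r; [apply mod_cong|].
  destruct i as [|i]; [apply Z.divide_0_r|].
  change (of_list (0%Z :: lmul D n (tl xs) ys) (S i)) with (of_list (lmul D n (tl xs) ys) i).
  apply IH; lia.
Qed.

Lemma lmul_rep (D : Z) (n : nat) (xs ys : list Z) (a b : fps) :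
  fcongL n D (of_list xs) a -> fcongL n D (of_list ys) b ->
  fcongL n D (of_list (lmul D n xs ys)) (fmul a b).
Proof. intros Ha Hb; eapply fcongL_trans; [apply lmul_cong|now apply fcongL_mul]. Qed.

Lemma of_list_shift (k : nat) (l : list Z) : of_list (repeat 0%Z k ++ l) = fshift k (of_list l).
Proof.
  extensionality i; unfold of_list, fshift; destruct (Nat.leb_spec k i) as [H|H].
  - rewrite app_nth2; rewrite repeat_length; auto.
  - rewrite app_nth1 by (rewrite repeat_length; lia); apply nth_repeat.
Qed.

Fixpoint leuler (D : Z) (L m : nat) : list Z :=
  match m with
  | O => 1%Z :: nil
  | S m' => let l := leuler D L m' in laxpy D (-1) L (repeat 0%Z m ++ l) l
  end.

Lemma leuler_rep (D : Z) (L m : nat) : fcongL L D (of_list (leuler D L m)) (euler_part m).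
Proof.
  induction m as [|m IH].
  - intros [|[|i]] _; apply Z.divide_0_r.
  - intros i Hi; cbn [leuler]; rewrite laxpy_nth, of_list_shift by exact Hi.
    cbn [euler_part]; unfold one_minus_X.
    replace (fmul (euler_part m) (fsub fone (fX (S m)))) with (fsub (euler_part m) (fmul (fX (S m)) (euler_part m))) by ring.
    rewrite fmul_fX; unfold fsub.
    set (l := of_list (leuler D L m)) in *.
    replace ((-1 * fshift (S m) l i + l i) mod D - (euler_part m i - fshift (S m) (euler_part m) i))%Z with
      (((-1 * fshift (S m) l i + l i) mod D - (-1 * fshift (S m) l i + l i)) + ((l i - euler_part m i) - (fshift (S m) l i - fshift (S m) (euler_part m) i)))%Z by ring.
    apply Z.divide_add_r; [apply mod_cong|]; apply Z.divide_sub_r; [apply IH, Hi|].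
    unfold fshift; destruct (Nat.leb_spec (S m) i); [apply IH; lia|apply Z.divide_0_r].
Qed.

(** The exponent is [48 = 24 r] with [r = 2], as in [jseries]. *)
Definition leuler48 (D : Z) (L : nat) : list Z :=
  let e := leuler D L L in
  let e3 := lmul D L e (lmul D L e e) in
  let e6 := lmul D L e3 e3 in
  let e12 := lmul D L e6 e6 in
  let e24 := lmul D L e12 e12 in
  lmul D L e24 e24.

Lemma leuler48_rep (D : Z) (L : nat) : fcongL L D (of_list (leuler48 D L)) (fpow euler 48).
Proof.
  assert (He : fcongL L D (of_list (leuler D L L)) euler).
  { intros i Hi; rewrite <- (euler_part_stable L i) by lia; apply leuler_rep, Hi. }
  assert (Hs : forall l k, fcongL L D (of_list l) (fpow euler k) -> fcongL L D (of_list (lmul D L l l)) (fpow euler (k + k))).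
  { intros l k H; rewrite fpow_add; now apply lmul_rep. }
  unfold leuler48; cbv zeta; apply (Hs _ 24%nat), (Hs _ 12%nat), (Hs _ 6%nat), (Hs _ 3%nat).
  replace (fpow euler 3) with (fmul euler (fmul euler euler)) by (simpl; ring).
  apply lmul_rep; [exact He|]; now apply lmul_rep.
Qed.

Fixpoint ldot (xs ys : list Z) : Z :=
  match xs, ys with x :: xs', y :: ys' => (x * y + ldot xs' ys')%Z | _, _ => 0%Z end.

(* Nothing is proved about [linv]: its output is tested by [leqb_one]. *)
Fixpoint linv (D : Z) (n : nat) (es acc : list Z) : list Z :=
  match n with
  | O => rev acc
  | S n' => linv D n' es (((- ldot es acc) mod D)%Z :: acc)
  end.

(* Coefficients of [T_2(Delta^2) / q] in terms of those of [prod (1 - q^n)^48]. *)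
Definition jnum (e48 : fps) (m : nat) : Z :=
  (e48 (2 * m)%nat + 2 ^ 23 * (if (Nat.odd m && Nat.leb 3 m)%bool then e48 (m / 2 - 1)%nat else 0))%Z.

Definition ljseries (D : Z) (L : nat) (e48 inv48 : list Z) : list Z :=
  lmul D L inv48 (map (jnum (of_list e48)) (seq 0 L)).

Lemma jseries_jnum : jseries = fmul (fpow partitions 48) (jnum (fpow euler 48)).
Proof.
  set (G := fshift 2 (fpow euler 48)).
  set (T := fadd (fun n => 2 ^ 23 * fspread 2 G n)%Z (fU 2 G)).
  assert (HT : hecke_series 2 2 0 fone = fmul (fpow partitions 48) T).
  { unfold hecke_series, hecke_source; change (24 * 2)%nat with 48%nat.
    replace (fmul fone (fpow euler 48)) with (fpow euler 48) by ring; reflexivity. }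
  extensionality n; unfold jseries; rewrite HT.
  rewrite (fmul_comm (fpow partitions 48) T), (fmul_comm (fpow partitions 48) (jnum _)).
  unfold fmul; rewrite Zsum_shift.
  assert (HT0 : T 0%nat = 0%Z) by reflexivity.
  rewrite HT0, Z.mul_0_l, Z.add_0_l; apply Zsum_ext; intros m _.
  replace (S n - S m)%nat with (n - m)%nat by lia; f_equal.
  unfold T, jnum, fadd, fU, fspread, G.
  assert (E1 : fshift 2 (fpow euler 48) (2 * S m)%nat = fpow euler 48 (2 * m)%nat).
  { unfold fshift; destruct (Nat.leb_spec 2 (2 * S m)); [f_equal; lia|lia]. }
  rewrite E1.
  (* Index [m] here is index [m + 1] of the Hecke series. The term in [q^2] therefore sits at odd
     [m], and it starts at [m = 3] because [Delta^2] starts at [q^2]. *)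
  assert (E2 : (if Nat.eqb (S m mod 2) 0 then fshift 2 (fpow euler 48) (S m / 2)%nat else 0%Z) =
    (if (Nat.odd m && Nat.leb 3 m)%bool then fpow euler 48 (m / 2 - 1)%nat else 0%Z)).
  { destruct (Nat.odd m) eqn:Em.
    - apply Nat.odd_spec in Em; destruct Em as [h ->].
      replace (S (2 * h + 1)) with (S h * 2)%nat by lia.
      rewrite Nat.Div0.mod_mul, Nat.div_mul by lia; cbn [Nat.eqb andb].
      replace (2 * h + 1)%nat with (1 + h * 2)%nat by lia; rewrite Nat.div_add by lia; change (1 / 2)%nat with 0%nat.
      unfold fshift; destruct (Nat.leb_spec 2 (S h)), (Nat.leb_spec 3 (1 + h * 2)); try lia; f_equal; lia.
    - cbn [andb]; assert (Hev : Nat.even m = true) by (rewrite <- Nat.negb_odd, Em; reflexivity).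
      apply Nat.even_spec in Hev; destruct Hev as [h ->].
      replace (S (2 * h)) with (1 + h * 2)%nat by lia; rewrite Nat.Div0.mod_add; reflexivity. }
  rewrite E2; ring.
Qed.

Lemma jnum_cong (D : Z) (L : nat) (a b : fps) : fcongL (2 * L) D a b -> fcongL L D (jnum a) (jnum b).
Proof.
  intros H n Hn; unfold jnum.
  match goal with |- (D | ?u + ?c * ?v - (?u' + ?c * ?v'))%Z =>
    replace (u + c * v - (u' + c * v'))%Z with ((u - u') + c * (v - v'))%Z by ring end.
  apply Z.divide_add_r; [apply H; lia|]; apply Z.divide_mul_r.
  destruct (Nat.odd n && Nat.leb 3 n)%bool; [|apply Z.divide_0_r].
  apply H; assert (n / 2 <= n)%nat by (apply Nat.Div0.div_le_upper_bound; lia); lia.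
Qed.

Definition leqb_one (D : Z) (L : nat) (l : list Z) : bool :=
  forallb (fun i => Z.eqb ((nth i l 0%Z - fone i) mod D) 0) (seq 0 L).

(** A list that passes the test is an inverse of the 48th power of [euler] modulo [D] up to [L]
    terms; inverses being unique, it represents the 48th power of [partitions]. *)
Lemma ljseries_rep (D : Z) (L : nat) (inv48 : list Z) : D <> 0%Z ->
  leqb_one D L (lmul D L (leuler48 D (2 * L)) inv48) = true ->
  fcongL L D (of_list (ljseries D L (leuler48 D (2 * L)) inv48)) jseries.
Proof.
  intros HD Hc.
  assert (He : fcongL (2 * L) D (of_list (leuler48 D (2 * L))) (fpow euler 48)) by apply leuler48_rep.
  assert (HeL : fcongL L D (of_list (leuler48 D (2 * L))) (fpow euler 48)) by (intros i Hi; apply He; lia).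
  assert (H1 : fcongL L D (fmul (fpow euler 48) (of_list inv48)) fone).
  { apply (fcongL_trans _ _ _ (of_list (lmul D L (leuler48 D (2 * L)) inv48))).
    - apply fcongL_sym, lmul_rep; [exact HeL|apply fcongL_refl].
    - intros i Hi; unfold leqb_one in Hc; rewrite forallb_forall in Hc.
      specialize (Hc i ltac:(apply in_seq; lia)); apply Z.eqb_eq, Z.mod_divide in Hc; auto. }
  assert (H2 : fcongL L D (of_list inv48) (fpow partitions 48)).
  { replace (of_list inv48) with (fmul (fmul (fpow euler 48) (of_list inv48)) (fpow partitions 48)).
    - replace (fpow partitions 48) with (fmul fone (fpow partitions 48)) at 2 by ring.
      apply fcongL_mul; [exact H1|apply fcongL_refl].
    - transitivity (fmul (fmul (fpow euler 48) (fpow partitions 48)) (of_list inv48)); [ring|].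
      rewrite <- fpow_mul_l, euler_partitions, fpow_one; ring. }
  rewrite jseries_jnum; apply lmul_rep; [exact H2|].
  apply (fcongL_trans _ _ _ (jnum (of_list (leuler48 D (2 * L))))); [|apply jnum_cong, He].
  intros i Hi; unfold of_list at 1.
  rewrite (nth_indep _ 0%Z (jnum (of_list (leuler48 D (2 * L))) 0)) by (rewrite length_map, length_seq; exact Hi).
  rewrite map_nth, seq_nth by exact Hi; rewrite Z.sub_diag; apply Z.divide_0_r.
Qed.

Fixpoint ljpoly (D : Z) (L : nat) (jl cs : list Z) : list Z :=
  match cs with
  | nil => nil
  | c :: cs' => laxpy D c L (repeat 0%Z (length cs') ++ 1%Z :: nil) (lmul D L jl (ljpoly D L jl cs'))
  end.

Lemma ljpoly_rep (D : Z) (L : nat) (jl cs : list Z) : fcongL L D (of_list jl) jseries ->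
  fcongL L D (of_list (ljpoly D L jl cs)) (jpoly cs).
Proof.
  intros Hj; induction cs as [|c cs IH].
  - intros i _; simpl; unfold of_list; destruct i; apply Z.divide_0_r.
  - intros i Hi; cbn [ljpoly jpoly]; rewrite laxpy_nth, of_list_shift by exact Hi; unfold fadd.
    assert (E : fshift (length cs) (of_list (1%Z :: nil)) = fX (length cs)).
    { replace (of_list (1%Z :: nil)) with fone; [rewrite <- fmul_fX; ring|].
      extensionality m; destruct m as [|[|m]]; reflexivity. }
    rewrite E.
    match goal with |- (D | (?u + ?v) mod D - (?u + ?w))%Z =>
      replace ((u + v) mod D - (u + w))%Z with (((u + v) mod D - (u + v)) + (v - w))%Z by ring end.
    apply Z.divide_add_r; [apply mod_cong|]; apply lmul_rep; auto.
Qed.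

(** The numbers of partitions of [n] into parts at least 2, up to [n = 12], the largest [k] that
    occurs. *)
Definition product_coefs : list Z := (1 :: 0 :: 1 :: 1 :: 2 :: 2 :: 4 :: 4 :: 7 :: 8 :: 12 :: 14 :: 21 :: nil)%Z.

(** An integer copy of [partial_product], which can be evaluated by computation where the real one
    cannot. *)
Fixpoint zpartial (M : nat) : fps :=
  match M with O => fone | S M' => fmul (zpartial M') (fgeom (M' + 2)) end.

Lemma sum_f_R0_Zsum (f : nat -> R) (g : nat -> Z) (n : nat) :
  (forall i, (i <= n)%nat -> f i = IZR (g i)) -> sum_f_R0 f n = IZR (Zsum g (S n)).
Proof.
  induction n as [|n IH]; intros H.
  - simpl; rewrite H by lia; reflexivity.
  - cbn [sum_f_R0]; rewrite IH, H by (auto; lia).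
    change (Zsum g (S (S n))) with (Zsum g (S n) + g (S n))%Z; rewrite plus_IZR; reflexivity.
Qed.

Lemma partial_product_zpartial (M n : nat) : partial_product M n = IZR (zpartial M n).
Proof.
  revert n; induction M as [|M IH]; intros n; simpl.
  - unfold FPS_one, fone; destruct (Nat.eqb n 0); reflexivity.
  - unfold PS_mult, fmul; apply sum_f_R0_Zsum; intros i Hi.
    rewrite IH, mult_IZR; f_equal; unfold geom, fgeom; destruct (Nat.eqb _ _); reflexivity.
Qed.

Lemma product_coef_list (n : nat) : (n <= 12)%nat -> product_coef n = IZR (of_list product_coefs n).
Proof.
  intros Hn; unfold product_coef; rewrite partial_product_zpartial; f_equal.
  do 13 (destruct n as [|n]; [vm_compute; reflexivity|]); lia.
Qed.

(** The comparisons with [L] prevent [nth] from returning its default 0 beyond the computed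
    coefficients, which would pass the divisibility test without meaning. *)
Definition check_k (D : Z) (p M L k : nat) (jl cs : list Z) : bool :=
  let c := ljpoly D L jl cs in
  (Nat.eqb (length cs) (S k) && Nat.ltb k L &&
   forallb (fun n => Z.eqb ((nth n product_coefs 0%Z - nth n c 0%Z) mod D) 0) (seq 0 (S k)) &&
   forallb (fun n => if (Nat.leb (p * M - k) (p * n) && negb (Nat.eqb (p * n) (p * M)))
      then Nat.ltb (p * n - (p * M - k)) L && Z.eqb (nth (p * n - (p * M - k)) c 0%Z mod D) 0 else true)
     (seq 0 (S (p * M))))%bool.

Lemma check_k_correct (D : Z) (p M L k : nat) (jl cs : list Z) : D <> 0%Z ->
  fcongL L D (of_list jl) jseries -> check_k D p M L k jl cs = true ->
  length cs = S k /\
  (forall n, (n <= k)%nat -> (D | of_list product_coefs n - jpoly cs n)%Z) /\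
  (forall n, (n <= p * M)%nat -> (p * M - k <= p * n)%nat -> (p * n <> p * M)%nat ->
     (D | jpoly cs (p * n - (p * M - k))%nat)%Z).
Proof.
  intros HD Hj Hc; pose proof (ljpoly_rep D L jl cs Hj) as Hr.
  unfold check_k in Hc; set (c := ljpoly D L jl cs) in *; cbv zeta in Hc.
  apply andb_prop in Hc as [Hc H4]; apply andb_prop in Hc as [Hc H3]; apply andb_prop in Hc as [H1 H2].
  apply Nat.eqb_eq in H1; apply Nat.ltb_lt in H2; rewrite forallb_forall in H3, H4.
  split; [exact H1|split].
  - intros n Hn; specialize (H3 n ltac:(apply in_seq; lia)); apply Z.eqb_eq, Z.mod_divide in H3; auto.
    specialize (Hr n ltac:(lia)).
    replace (of_list product_coefs n - jpoly cs n)%Z with ((of_list product_coefs n - of_list c n) + (of_list c n - jpoly cs n))%Z by ring.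
    apply Z.divide_add_r; auto.
  - intros n Hn Hge Hne; specialize (H4 n ltac:(apply in_seq; lia)).
    destruct (Nat.leb_spec (p * M - k) (p * n)); [|lia].
    destruct (Nat.eqb_spec (p * n) (p * M)); [contradiction|]; cbn [andb negb] in H4.
    apply andb_prop in H4 as [H4 H5]; apply Nat.ltb_lt in H4; apply Z.eqb_eq, Z.mod_divide in H5; auto.
    specialize (Hr _ H4); set (i := (p * n - (p * M - k))%nat) in *.
    replace (jpoly cs i) with (of_list c i - (of_list c i - jpoly cs i))%Z by ring.
    apply Z.divide_sub_r; auto.
Qed.

(** The inverse is built from its constant term 1, newest coefficient first, so that a dot product
    with the tail of [e48] is a convolution. *)
Definition check_p (D : Z) (p M L : nat) (css : list (nat * list Z)) : bool :=
  let e48 := leuler48 D (2 * L) in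
  let inv48 := linv D (L - 1) (tl e48) (1%Z :: nil) in
  let jl := ljseries D L e48 inv48 in
  (leqb_one D L (lmul D L e48 inv48) && forallb (fun kc => check_k D p M L (fst kc) jl (snd kc)) css)%bool.

(* For each [k], the coefficients modulo the given prime power, in increasing
   degree, of the polynomial in [J] that is congruent to [Z_k]. *)
Definition css2 : list (nat * list Z) :=
  ((1%nat, 920 :: 1 :: nil) :: (3%nat, 505 :: 901 :: 712 :: 1 :: nil) :: nil)%Z.
Definition css3 : list (nat * list Z) :=
  ((1%nat, 87 :: 1 :: nil) :: (2%nat, 172 :: 174 :: 1 :: nil) ::
   (4%nat, 59 :: 209 :: 1 :: 105 :: 1 :: nil) :: nil)%Z.
Definition css5 : list (nat * list Z) :=
  ((1%nat, 22 :: 1 :: nil) :: (2%nat, 17 :: 19 :: 1 :: nil) :: (3%nat, 22 :: 1 :: 16 :: 1 :: nil) ::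
   (4%nat, 24 :: 13 :: 19 :: 13 :: 1 :: nil) :: (6%nat, 9 :: 2 :: 9 :: 12 :: 7 :: 7 :: 1 :: nil) :: nil)%Z.
Definition css7 : list (nat * list Z) :=
  ((1%nat, 6 :: 1 :: nil) :: (2%nat, 5 :: 5 :: 1 :: nil) :: (3%nat, 2 :: 5 :: 4 :: 1 :: nil) ::
   (4%nat, 2 :: 0 :: 6 :: 3 :: 1 :: nil) :: (5%nat, 2 :: 6 :: 6 :: 1 :: 2 :: 1 :: nil) ::
   (6%nat, 2 :: 6 :: 3 :: 5 :: 4 :: 1 :: 1 :: nil) ::
   (8%nat, 0 :: 5 :: 4 :: 5 :: 4 :: 6 :: 6 :: 6 :: 1 :: nil) :: nil)%Z.
Definition css11 : list (nat * list Z) :=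
  ((1%nat, 5 :: 1 :: nil) :: (2%nat, 3 :: 10 :: 1 :: nil) :: (3%nat, 2 :: 3 :: 4 :: 1 :: nil) ::
   (4%nat, 9 :: 10 :: 6 :: 9 :: 1 :: nil) :: (5%nat, 5 :: 4 :: 3 :: 1 :: 3 :: 1 :: nil) ::
   (6%nat, 4 :: 10 :: 2 :: 7 :: 10 :: 8 :: 1 :: nil) :: (7%nat, 7 :: 8 :: 0 :: 7 :: 4 :: 0 :: 2 :: 1 :: nil) ::
   (8%nat, 4 :: 4 :: 8 :: 4 :: 10 :: 9 :: 4 :: 7 :: 1 :: nil) ::
   (9%nat, 0 :: 1 :: 8 :: 3 :: 4 :: 0 :: 4 :: 0 :: 1 :: 1 :: nil) ::
   (10%nat, 9 :: 7 :: 6 :: 9 :: 3 :: 2 :: 8 :: 4 :: 10 :: 6 :: 1 :: nil) ::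
   (12%nat, 7 :: 4 :: 10 :: 9 :: 9 :: 0 :: 9 :: 7 :: 5 :: 2 :: 6 :: 5 :: 1 :: nil) :: nil)%Z.

(** Throughout, [L = p (p - 1) M + p + 2]: one more than the largest index read, which is reached at
    [n = p M] and [k = p + 1]. *)
Lemma check_2 : check_p (2 ^ 11) 2 128 260 css2 = true.
Proof. vm_compute; reflexivity. Qed.

Lemma check_3 : check_p (3 ^ 5) 3 27 167 css3 = true.
Proof. vm_compute; reflexivity. Qed.

Lemma check_5 : check_p (5 ^ 2) 5 5 107 css5 = true.
Proof. vm_compute; reflexivity. Qed.

Lemma check_7 : check_p 7 7 2 93 css7 = true.
Proof. vm_compute; reflexivity. Qed.

Lemma check_11 : check_p 11 11 2 233 css11 = true.
Proof. vm_compute; reflexivity. Qed.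

Lemma checked_prime_case (pz D : Z) (p M e s L : nat) (css : list (nat * list Z)) (k : Z) (Zk : C -> C) (w : Z -> C) :
  pz = Z.of_nat p -> D = (Z.of_nat p ^ Z.of_nat (S e))%Z ->
  hecke_primes p -> (0 < M)%nat -> (24 * M = p ^ e * s)%nat -> (S e <= 12 * (p * M) - 1)%nat ->
  check_p D p M L css = true ->
  In (Z.to_nat k) (map fst css) -> (0 <= k <= 12)%Z -> (k <= Z.of_nat (p * M))%Z ->
  is_Z k Zk w -> forall n : Z, n <> 0%Z -> congruent_0_mod D (w (pz * n)%Z).
Proof.
  intros -> ED Hp HM Hs He Hc Hcs Hk12 Hk HZ.
  apply in_map_iff in Hcs as [[k' cs] [Ek Hcs]]; cbn [fst] in Ek; subst k'.
  assert (HD : D <> 0%Z) by (rewrite ED; apply Z.pow_nonzero; unfold hecke_primes in Hp; lia).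
  unfold check_p in Hc; cbv zeta in Hc; apply andb_prop in Hc as [Hinv Hc].
  pose proof (ljseries_rep D L _ HD Hinv) as Hj.
  rewrite forallb_forall in Hc; specialize (Hc _ Hcs); cbn [fst snd] in Hc.
  destruct (check_k_correct D p M L (Z.to_nat k) _ cs HD Hj Hc) as (Hlen & Hlow & Hchk).
  rewrite ED in *; apply (prime_case p M e s (Z.to_nat k) Zk w cs (of_list product_coefs)); auto.
  - lia.
  - rewrite Z2Nat.id by lia; exact HZ.
  - intros n Hn; apply product_coef_list; lia.
Qed.

Lemma prime_le_11 (p : Z) : prime p -> (p <= 11)%Z -> (p = 2 \/ p = 3 \/ p = 5 \/ p = 7 \/ p = 11)%Z.
Proof.
  intros Hp H; pose proof (prime_ge_2 p Hp) as H2.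
  assert (Hnot : forall d m, (1 < d)%Z -> (1 < m)%Z -> p <> (d * m)%Z).
  { intros d m Hd Hm E; destruct (prime_divisors p Hp d) as [?|[?|[?|?]]]; try nia.
    exists m; rewrite E; ring. }
  pose proof (Hnot 2 2)%Z; pose proof (Hnot 2 3)%Z; pose proof (Hnot 2 4)%Z;
  pose proof (Hnot 3 3)%Z; pose proof (Hnot 2 5)%Z; lia.
Qed.

Theorem theorem1p3 (p k : Z) (Zk : C -> C) (w : Z -> C)
  (hp : prime p) (hp11 : (p <= 11)%Z)
  (hk : (1 <= k <= p - 1)%Z \/ k = (p + 1)%Z)
  (hZ : is_Z k Zk w) :
  forall n : Z, n <> 0%Z ->
    (p = 2%Z -> congruent_0_mod (2 ^ 11)%Z (w (p * n)%Z)) /\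
    (p = 3%Z -> congruent_0_mod (3 ^ 5)%Z (w (p * n)%Z)) /\
    (p = 5%Z -> congruent_0_mod (5 ^ 2)%Z (w (p * n)%Z)) /\
    (p = 7%Z \/ p = 11%Z -> congruent_0_mod p (w (p * n)%Z)).
Proof.
  intros n Hn; destruct (prime_le_11 p hp hp11) as [->|[->|[->|[->| ->]]]].
  - repeat split; try lia; intros _.
    (* The numbers after [p] are [M = 128], [e = 10], [s = 3] and [L = 260], with
       [24 * 128 = 2^10 * 3]; the other primes follow the same pattern. *)
    apply (checked_prime_case 2 (2 ^ 11) 2 128 10 3 260 css2 k Zk w eq_refl eq_refl (or_introl eq_refl));
      [lia|reflexivity|lia|exact check_2| |lia|lia|exact hZ|exact Hn].
    assert (Hk : (k = 1 \/ k = 3)%Z) by lia.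
    destruct Hk as [->| ->]; repeat (first [left; reflexivity|right]).
  - repeat split; try lia; intros _.
    apply (checked_prime_case 3 (3 ^ 5) 3 27 4 8 167 css3 k Zk w eq_refl eq_refl (or_intror (or_introl eq_refl)));
      [lia|reflexivity|lia|exact check_3| |lia|lia|exact hZ|exact Hn].
    assert (Hk : (k = 1 \/ k = 2 \/ k = 4)%Z) by lia.
    destruct Hk as [->|[->| ->]]; repeat (first [left; reflexivity|right]).
  - repeat split; try lia; intros _.
    apply (checked_prime_case 5 (5 ^ 2) 5 5 1 24 107 css5 k Zk w eq_refl eq_refl (or_intror (or_intror (or_introl eq_refl))));
      [lia|reflexivity|lia|exact check_5| |lia|lia|exact hZ|exact Hn].
    assert (Hk : (k = 1 \/ k = 2 \/ k = 3 \/ k = 4 \/ k = 6)%Z) by lia.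
    destruct Hk as [->|[->|[->|[->| ->]]]]; repeat (first [left; reflexivity|right]).
  - repeat split; try lia; intros _.
    apply (checked_prime_case 7 7 7 2 0 48 93 css7 k Zk w eq_refl eq_refl (or_intror (or_intror (or_intror (or_introl eq_refl)))));
      [lia|reflexivity|lia|exact check_7| |lia|lia|exact hZ|exact Hn].
    assert (Hk : (k = 1 \/ k = 2 \/ k = 3 \/ k = 4 \/ k = 5 \/ k = 6 \/ k = 8)%Z) by lia.
    destruct Hk as [->|[->|[->|[->|[->|[->| ->]]]]]]; repeat (first [left; reflexivity|right]).
  - repeat split; try lia; intros _.
    apply (checked_prime_case 11 11 11 2 0 48 233 css11 k Zk w eq_refl eq_refl (or_intror (or_intror (or_intror (or_intror eq_refl)))));
      [lia|reflexivity|lia|exact check_11| |lia|lia|exact hZ|exact Hn].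
    assert (Hk : (k = 1 \/ k = 2 \/ k = 3 \/ k = 4 \/ k = 5 \/ k = 6 \/ k = 7 \/ k = 8 \/ k = 9 \/ k = 10 \/ k = 12)%Z) by lia.
    destruct Hk as [->|[->|[->|[->|[->|[->|[->|[->|[->|[->| ->]]]]]]]]]]; repeat (first [left; reflexivity|right]).
Qed.
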